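(* For integers $k,l,m,n$ let $Q=Q(k,l,m,n;a,b,c,x)$ be the uniquely determined coefficient of ${}_2\phi_1(aq,bq;cq;q,x)$ in the three-term relation $${}_2\phi_1(aq^k,bq^l;cq^m;q,xq^n)=Q\cdot{}_2\phi_1(aq,bq;cq;q,x)+R\cdot{}_2\phi_1(a,b;c;q,x),$$ where $Q,R$ are rational functions of $a,b,c,q,x$. Let $G=\langle\sigma_0,\sigma_1,\sigma_2,\sigma_3\rangle$ be the group of order $96$ defined in the context, acting by $(\sigma Q)(k,l,m,n;a,b,c,x)=Q(\sigma^{-1}(k,l,m,n;a,b,c,x))$. Then $Q$ has symmetries under the action of $G$, that is, it possesses $96$ symmetries: for every $\sigma\in G$, $Q$ equals $\sigma Q$ times an explicit factor obtained by composing the following identities for the generators. For all integers $k,l,m,n$, as identities of rational functions of $a,b,c,q,x$: $$Q(k,l,m,n;a,b,c,x)=\frac{(-1)^{m+1}(c)_m(cq)_m(aq/c)_{k-m}(bq/c)_{l-m}(x)_n\,x^{-m}}{q^{m(m-1)/2+mn}\,c^{m+n}\,(aq)_k(bq)_l(abxq/c)_{k+l-m+n}}\,(\sigma_0Q)(k,l,m,n;a,b,c,x),$$ $$Q(k,l,m,n;a,b,c,x)=\frac{(1-b)(c-abx)}{(c-a)(c-b)}\,\frac{(cq)_{m-1}(xq)_{n-1}}{(aq)_{k-1}(bxq)_{l+n-1}}\,(\sigma_1Q)(k,l,m,n;a,b,c,x),$$ $$Q(k,l,m,n;a,b,c,x)=\frac{(-1)^{m+1}(1-a)(1-b)(cq)_{m-1}(c/q^2)_{m+1}(aq/c)_{k-m}(bq/c)_{l-m}}{q^{m(m-1)/2+(m-1)(n-1)}\,c^{m+n-1}\,(a/q)_{k+1}(b/q)_{l+1}(abxq/c)_{k+l-m+n-1}}\,(xq)_{n-1}\,x^{-m}\,(\sigma_2Q)(k,l,m,n;a,b,c,x),$$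 $$Q(k,l,m,n;a,b,c,x)=(\sigma_3Q)(k,l,m,n;a,b,c,x).$$
   Context: Here $0<|q|<1$, $(a;q)_\infty=\prod_{j=0}^\infty(1-aq^j)$, and for every integer $i$ (possibly negative) $(a)_i:=(a;q)_i:=(a;q)_\infty/(aq^i;q)_\infty$. The basic hypergeometric series is ${}_2\phi_1(a,b;c;q,x)=\sum_{i=0}^\infty\frac{(a;q)_i(b;q)_i}{(q;q)_i(c;q)_i}x^i$. It is a known fact that for each $(k,l,m,n)\in\mathbb{Z}^4$ there is exactly one pair $(Q,R)$ of rational functions of $a,b,c,q,x$ for which the three-term relation in the claim holds identically (for generic parameters and $|x|$ small); this defines $Q(k,l,m,n;a,b,c,x)$. The group $G$ is generated, under composition, by the mappings on tuples $(k,l,m,n;a,b,c,x)$ (with $k,l,m,n$ integers) $$\sigma_0:(k,l,m,n;a,b,c,x)\mapsto(-k,-l,-m,-n;aq^k,bq^l,cq^m,xq^n),$$ $$\sigma_1:(k,l,m,n;a,b,c,x)\mapsto(n,m-k,l+n,k;x,c/a,bx,a),$$ $$\sigma_2:(k,l,m,n;a,b,c,x)\mapsto(-k,-l,-m,k+l-m+n;q/a,q/b,q^2/c,abx/c),$$ $$\sigma_3:(k,l,m,n;a,b,c,x)\mapsto(l,k,m,n;b,a,c,x).$$ The action on $Q$ substitutes the components of $\sigma^{-1}(k,l,m,n;a,b,c,x)$ for the arguments of $Q$. *)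

(* Defs.v *)
From HB Require Import structures.
From mathcomp Require Import all_boot all_order all_algebra.
From mathcomp Require Import generic_quotient complex.
From mathcomp Require mpoly.
From mathcomp Require Import all_classical all_reals all_analysis.
From mathcomp Require Import ring.
(* The notations of mpoly are incompatible with those of MathComp-Analysis. *)
Import (canonicals, coercions) mpoly.

Set Implicit Arguments.
Unset Strict Implicit.
Unset Printing Implicit Defensive.

Import Order.TTheory GRing.Theory Num.Theory numFieldNormedType.Exports.
Local Open Scope ring_scope.

(* The complex numbers; the type ascription gives access to the topology that
   MathComp-Analysis puts on every numFieldType. *)
Definition cplx (R : realType) : numClosedFieldType := R[i].

Definition qpoch_inf (R : realType) (q a : cplx R) : cplx R :=
  limn (fun n : nat => \prod_(j < n) (1 - a * q ^+ j)).

(* (a;q)_i for a complex number a and an integer i of either sign *)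
Definition qpochC (R : realType) (q a : cplx R) (i : int) : cplx R :=
  qpoch_inf q a / qpoch_inf q (a * q ^ i).

Definition phi21 (R : realType) (a b c q x : cplx R) : cplx R :=
  limn (series (fun i : nat =>
    qpochC q a i * qpochC q b i / (qpochC q q i * qpochC q c i) * x ^+ i)).

(* (a;q)_i as a rational expression in a and q, hence meaningful in any field;
   qpochCE below identifies it with the quotient of infinite products. *)
Definition qpoch (K : fieldType) (q a : K) (i : int) : K :=
  match i with
  | Posz n => \prod_(j < n) (1 - a * q ^+ j)
  | Negz n => (\prod_(j < n.+1) (1 - a * q ^- j.+1))^-1
  end.

Section Convergence.
Variable R : realType.
Local Notation C := (cplx R).
Import Normc.

Lemma cvg_series_normc (u : nat -> C) (v : nat -> R) :
  (forall n, normc (u n) <= v n) -> cvgn (series v) -> cvgn (series u).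
Proof.
move=> uv vcvg.
have n0 (z : C) : 0 <= normc z by case: z => x y; exact: sqrtr_ge0.
have v0 n : 0 <= v n by apply: le_trans (uv n).
have re_le (z : C) : `|complex.Re z| <= normc z.
  by case: z => x y /=; rewrite -sqrtr_sqr ler_wsqrtr// lerDl sqr_ge0.
have im_le (z : C) : `|complex.Im z| <= normc z.
  by case: z => x y /=; rewrite -sqrtr_sqr ler_wsqrtr// lerDr sqr_ge0.
have le_reim (z : C) : normc z <= `|complex.Re z| + `|complex.Im z|.
  case: z => x y /=.
  rewrite -[leRHS]ger0_norm ?addr_ge0// -sqrtr_sqr ler_wsqrtr//.
  by rewrite sqrrD !real_normK ?num_real// lerD2r lerDl mulrn_wge0// mulr_ge0.
have cv (f : C -> R) : (forall z, `|f z| <= normc z) -> cvgn (series (f \o u)).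
  move=> fz; apply: normed_cvg; apply: series_le_cvg vcvg => //= n.
  exact: le_trans (fz _) (uv n).
have /cvg_ex[x xP] := cv _ re_le; have /cvg_ex[y yP] := cv _ im_le.
have reD (z w : C) : complex.Re (z + w) = complex.Re z + complex.Re w.
  by case: z w => ? ? [].
have imD (z w : C) : complex.Im (z + w) = complex.Im z + complex.Im w.
  by case: z w => ? ? [].
have sRe n : complex.Re (series u n) = series (@complex.Re R \o u) n.
  elim: n => [|n ih]; first by rewrite /series/= !big_nil.
  by rewrite !seriesSr reD ih.
have sIm n : complex.Im (series u n) = series (@complex.Im R \o u) n.
  elim: n => [|n ih]; first by rewrite /series/= !big_nil.
  by rewrite !seriesSr imD ih.
apply/cvg_ex; exists (Complex x y : C); apply/cvgrPdist_lt => -[e e'].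
move=> /andP[/eqP/= -> e0].
have e20 : 0 < e / 2 by rewrite divr_gt0.
move/cvgrPdist_lt : xP => /(_ _ e20) xP; move/cvgrPdist_lt : yP => /(_ _ e20) yP.
near=> n; rewrite [X in X < _](_ : _ = real_complex R (normc (Complex x y - series u n)))//.
rewrite ltcR (le_lt_trans (le_reim _))// (splitr e) ltrD//.
- rewrite (_ : complex.Re _ = x - series (@complex.Re R \o u) n).
    by near: n; exact: xP.
  by rewrite -sRe; case: (series u n).
- rewrite (_ : complex.Im _ = y - series (@complex.Im R \o u) n).
    by near: n; exact: yP.
  by rewrite -sIm; case: (series u n).
Unshelve. all: by end_near. Qed.

Lemma cvg_qpoch_inf (q a : C) : 0 < `|q| < 1 ->
  cvgn (fun n : nat => \prod_(j < n) (1 - a * q ^+ j)).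
Proof.
move=> /andP[]; rewrite [`|q|](_ : _ = real_complex R (normc q))// !ltcR => q0 q1.
set P := fun n => _.
have n0 (z : C) : 0 <= normc z by case: z => x y; exact: sqrtr_ge0.
have nD (z w : C) : normc (z - w) <= normc z + normc w.
  by rewrite (le_trans (le_normcD _ _))// normcN.
have nX n : normc (q ^+ n) = normc q ^+ n.
  elim: n => [|n ih]; first by rewrite !expr0 normc1.
  by rewrite !exprS normcM ih.
have P1 n : P n.+1 = P n * (1 - a * q ^+ n) by rewrite /P big_ord_recr.
have q1' : `|normc q| < 1 by rewrite ger0_norm.
have bnd n : normc (P n) <= expR (series (geometric (normc a) (normc q)) n).
  elim: n => [|n ih].
    by rewrite /P big_ord0 normc1 /series/= big_nil expR0.
  rewrite P1 normcM seriesSr expRD ler_pM//.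
  rewrite (le_trans (nD _ _))// normc1 normcM nX (le_trans _ (expR_ge1Dx _))//.
pose M := expR (normc a / (1 - normc q)).
have {}bnd n : normc (P n) <= M.
  by rewrite (le_trans (bnd n))// ler_expR geometric_le_lim.
have : cvgn (series (telescope P)).
  apply: (@cvg_series_normc _ (geometric (M * normc a) (normc q))).
    move=> n; rewrite [telescope P n](_ : _ = P n.+1 - P n)// P1 mulrBr mulr1 addrAC subrr add0r normcN !normcM nX.
    by rewrite mulrA ler_wpM2r ?exprn_ge0// ler_wpM2r.
  exact: is_cvg_geometric_series.
rewrite telescopeK => /(is_cvgD (is_cvg_cst (P 0%N))) h.
rewrite (_ : P = (fun=> P 0%N) \+ [sequence P n - P 0%N]_n)//.
by apply/funext => n /=; rewrite addrC subrK.
Qed.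

Lemma qpoch_infS (q a : C) : 0 < `|q| < 1 ->
  qpoch_inf q a = (1 - a) * qpoch_inf q (a * q).
Proof.
move=> q01; apply/(@cvg_lim C); first exact: norm_hausdorff.
rewrite -cvg_shiftS.
rewrite [X in (X @ _)%classic](_ : _ =
    fun n => (1 - a) * \prod_(j < n) (1 - a * q * q ^+ j)).
  by apply: cvgMl_tmp; exact: cvg_qpoch_inf.
apply/funext => n /=; rewrite big_ord_recl expr0 mulr1; congr (_ * _).
by apply: eq_bigr => j _; rewrite exprS mulrA.
Qed.

Lemma qpoch_inf_neq0 (q a : C) : 0 < `|q| < 1 ->
  (forall j : nat, a * q ^+ j != 1) -> qpoch_inf q a != 0.
Proof.
move=> q01; have [q0 q1] : 0 < normc q /\ normc q < 1.
  by move/andP: q01; rewrite [`|q|](_ : _ = real_complex R (normc q))// !ltcR.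
have n0 (z : C) : 0 <= normc z by case: z => x y; exact: sqrtr_ge0.
have q1' : `|normc q| < 1 by rewrite ger0_norm.
have nX n : normc (q ^+ n) = normc q ^+ n.
  elim: n => [|n ih]; first by rewrite !expr0 normc1.
  by rewrite !exprS normcM ih.
have small (b : C) : normc b / (1 - normc q) <= 2^-1 -> qpoch_inf q b != 0.
  move=> b2; pose P n := \prod_(j < n) (1 - b * q ^+ j).
  pose s := series (geometric (normc b) (normc q)).
  have s12 n : s n <= 2^-1 by rewrite (le_trans _ b2)// geometric_le_lim.
  have low n : 1 - s n <= normc (P n).
    elim: n => [|n ih].
      by rewrite /P /s /series/= big_ord0 big_nil subr0 normc1.
    rewrite /P big_ord_recr/= -/(P n) normcM /s seriesSr -/s /=.
    have sn : 1 - normc b * normc q ^+ n <= normc (1 - b * q ^+ n).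
      have := le_normcD (1 - b * q ^+ n) (b * q ^+ n).
      by rewrite subrK normc1 normcM nX lerBlDr.
    have s0 : 0 <= s n by apply: sumr_ge0 => *; rewrite mulr_ge0 ?exprn_ge0.
    have g0 : 0 <= normc b * normc q ^+ n by rewrite mulr_ge0 ?exprn_ge0.
    have := s12 n; move: sn ih (n0 (1 - b * q ^+ n)); clear -s0 g0.
    move: (normc _) (normc (1 - _)) (s n) (_ * _) s0 g0 => p t u g u0 g0 h1 h2 h3 h4.
    apply: le_trans (_ : (1 - u) * t <= _); last by rewrite ler_wpM2r.
    have : (1 - u) * (1 - g) <= (1 - u) * t.
      by rewrite ler_wpM2l// subr_ge0 (le_trans h4)// invf_le1// ler1n.
    apply: le_trans; rewrite (_ : (1 - u) * _ = 1 - (u + g) + u * g); last by ring.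
    by rewrite lerDl mulr_ge0.
  apply/eqP => b0; have := @cvg_qpoch_inf q b q01 => /cvg_norm; rewrite -/(qpoch_inf q b) b0.
  rewrite normr0 => /cvgrPdist_lt /(_ (real_complex R 2^-1)).
  rewrite ltcR invr_gt0 ltr0n => /(_ isT)[N _ /(_ N (leqnn N))].
  rewrite /= sub0r normrN normr_id.
  rewrite [`|_|](_ : _ = real_complex R (normc (P N)))// ltcR.
  apply/negP; rewrite -leNgt (le_trans _ (low N))//.
  by rewrite lerBrDr -lerBrDl (le_trans (s12 N))// lerBrDr -[2^-1]mul1r -splitr.
have [N hN] : exists N, normc (a * q ^+ N) / (1 - normc q) <= 2^-1.
  have e0 : 0 < 2^-1 :> R by rewrite invr_gt0.
  have := cvg_geometric (normc a / (1 - normc q)) q1'.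
  move=> /cvgrPdist_lt /(_ _ e0)[N _ /(_ N (leqnn N))].
  rewrite /= sub0r normrN ger0_norm.
    by move=> /ltW h; exists N; rewrite normcM nX mulrAC.
  by rewrite mulr_ge0 ?exprn_ge0// divr_ge0// subr_ge0 ltW.
elim: N a hN => [|N ih] a hN aq1.
  by apply: small; move: hN; rewrite expr0 mulr1.
rewrite qpoch_infS// mulf_neq0//.
  by have := aq1 0; rewrite expr0 mulr1 subr_eq0 eq_sym.
apply: ih => [|j]; first by move: hN; rewrite exprS mulrA.
by have := aq1 j.+1; rewrite exprS mulrA.
Qed.

(* a q^(i+j) = 1 for some natural number j is the case in which the quotient
   defining (a;q)_i has a zero denominator. *)
Lemma qpochCE (q a : C) (i : int) : 0 < `|q| < 1 ->
  (forall j : nat, a * q ^ (i + j%:Z) != 1) -> qpochC q a i = qpoch q a i.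
Proof.
move=> q01 aq1; have q0 : q != 0 by rewrite -normr_gt0; case/andP: q01.
have prodE n b : qpoch_inf q b = \prod_(j < n) (1 - b * q ^+ j) * qpoch_inf q (b * q ^+ n).
  elim: n => [|n ih]; first by rewrite big_ord0 mul1r expr0 mulr1.
  by rewrite ih big_ord_recr/= qpoch_infS// -!mulrA -exprSr.
have nz : qpoch_inf q (a * q ^ i) != 0.
  by apply: qpoch_inf_neq0 => // j; have := aq1 j; rewrite expfzDr// mulrA.
rewrite /qpochC; case: i aq1 nz => n aq1 nz /=.
  by rewrite (prodE n a) -exprnP mulfK.
move: nz; rewrite NegzE -exprnN => nz.
have := prodE n.+1 (a * q ^- n.+1); rewrite mulfVK ?expf_neq0// => h.
rewrite h in nz *; rewrite invfM mulrCA mulfV ?mulr1; last first.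
  by move: nz; rewrite mulf_eq0 negb_or => /andP[].
congr (_^-1); rewrite (reindex_inj rev_ord_inj)/=; apply: eq_bigr => j _.
rewrite -mulrA; congr (1 - a * _).
rewrite -[X in _ ^- X](subnK (ltn_ord j)) subSS exprD invfM mulrAC.
by rewrite mulVf ?mul1r// expf_neq0.
Qed.

End Convergence.

(* The group G, over an arbitrary field K with a fixed nonzero element q *)
Section Symmetries.
Variables (K : fieldType) (q : K) (q_neq0 : q != 0).

(* Tuples (k,l,m,n;a,b,c,x); a, b, c, x are required to be nonzero so that the
   maps sigma_i are bijections. *)
Record args := Args {
  ak : int; al : int; am : int; an : int;
  aa : K; ab : K; ac : K; ax : K;
  args_neq0 : [&& aa != 0, ab != 0, ac != 0 & ax != 0] }.

Lemma sigma0_neq0 (t : args) : [&& aa t * q ^ ak t != 0,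
  ab t * q ^ al t != 0, ac t * q ^ am t != 0 & ax t * q ^ an t != 0].
Proof.
case: t => k l m n a b c x /= /and4P[a0 b0 c0 x0].
by rewrite !mulf_neq0 // expfz_neq0.
Qed.

Definition sigma0 (t : args) : args :=
  Args (- ak t) (- al t) (- am t) (- an t) (sigma0_neq0 t).

Lemma sigma1_neq0 (t : args) :
  [&& ax t != 0, ac t / aa t != 0, ab t * ax t != 0 & aa t != 0].
Proof.
case: t => k l m n a b c x /= /and4P[a0 b0 c0 x0].
by rewrite !mulf_neq0 ?invr_eq0 // a0 x0.
Qed.

Definition sigma1 (t : args) : args :=
  Args (an t) (am t - ak t) (al t + an t) (ak t) (sigma1_neq0 t).

Lemma sigma2_neq0 (t : args) : [&& q / aa t != 0, q / ab t != 0,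
  q ^+ 2 / ac t != 0 & aa t * ab t * ax t / ac t != 0].
Proof.
case: t => k l m n a b c x /= /and4P[a0 b0 c0 x0].
by rewrite !mulf_neq0 ?invr_eq0 ?expf_neq0.
Qed.

Definition sigma2 (t : args) : args :=
  Args (- ak t) (- al t) (- am t) (ak t + al t - am t + an t) (sigma2_neq0 t).

Lemma sigma3_neq0 (t : args) :
  [&& ab t != 0, aa t != 0, ac t != 0 & ax t != 0].
Proof. by case: t => k l m n a b c x /= /and4P[-> -> -> ->]. Qed.

Definition sigma3 (t : args) : args :=
  Args (al t) (ak t) (am t) (an t) (sigma3_neq0 t).

(* inverse of a bijection *)
Definition invmap (s : args -> args) : args -> args :=
  fun t => if pselect (exists u, s u = t) is left h then projT1 (cid h) else t.

Inductive symG : set (args -> args) :=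
| symG0 : symG sigma0
| symG1 : symG sigma1
| symG2 : symG sigma2
| symG3 : symG sigma3
| symG_id : symG idfun
| symG_comp s u : symG s -> symG u -> symG (s \o u)
| symG_inv s : symG s -> symG (invmap s).

Definition act (s : args -> args) (f : args -> K) : args -> K :=
  fun t => f (invmap s t).

Local Notation "[ u ]_ i" := (qpoch q u i) (at level 2, i at level 2).

Definition factor0 (t : args) : K :=
  let: Args k l m n a b c x _ := t in
  ((-1) ^ (m + 1) * [c]_m * [c * q]_m * [a * q / c]_(k - m)
     * [b * q / c]_(l - m) * [x]_n * x ^ (- m))
  / (q ^ ((m * (m - 1) %/ 2)%Z + m * n) * c ^ (m + n)
     * [a * q]_k * [b * q]_l * [a * b * x * q / c]_(k + l - m + n)).

Definition factor1 (t : args) : K :=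
  let: Args k l m n a b c x _ := t in
  ((1 - b) * (c - a * b * x)) / ((c - a) * (c - b))
  * (([c * q]_(m - 1) * [x * q]_(n - 1))
     / ([a * q]_(k - 1) * [b * x * q]_(l + n - 1))).

Definition factor2 (t : args) : K :=
  let: Args k l m n a b c x _ := t in
  ((-1) ^ (m + 1) * (1 - a) * (1 - b) * [c * q]_(m - 1)
     * [c / q ^+ 2]_(m + 1) * [a * q / c]_(k - m) * [b * q / c]_(l - m))
  / (q ^ ((m * (m - 1) %/ 2)%Z + (m - 1) * (n - 1)) * c ^ (m + n - 1)
     * [a / q]_(k + 1) * [b / q]_(l + 1)
     * [a * b * x * q / c]_(k + l - m + n - 1))
  * [x * q]_(n - 1) * x ^ (- m).

(* sym_factor s f: the identity Q = f * (s Q) is obtained by composing the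
   identities for the generators. In the last case, Q = f * (s Q) is rewritten
   as s^-1 Q = (s^-1 f) * Q. *)
Inductive sym_factor : (args -> args) -> (args -> K) -> Prop :=
| sym_factor0 : sym_factor sigma0 factor0
| sym_factor1 : sym_factor sigma1 factor1
| sym_factor2 : sym_factor sigma2 factor2
| sym_factor3 : sym_factor sigma3 (fun=> 1)
| sym_factor_id : sym_factor idfun (fun=> 1)
| sym_factor_comp s f u g : sym_factor s f -> sym_factor u g ->
    sym_factor (s \o u) (fun t => f t * act s g t)
| sym_factor_inv s f : sym_factor s f ->
    sym_factor (invmap s) (fun t => (act (invmap s) f t)^-1).

End Symmetries.

(* Complex rational functions in the five indeterminates a, b, c, q, x, which
   are numbered 0, 1, 2, 3, 4 in this order *)
Definition ratfun (R : realType) : fieldType :=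
  {fraction (mpoly.mpoly 5 (cplx R))}.

Lemma fractionE (T : idomainType) (f : {fraction T}) :
  exists N D : T, D != 0 /\ f = tofrac N / tofrac D.
Proof.
exists (frac (repr f)).1, (frac (repr f)).2; split; first exact: denom_ratioP.
set x := repr f; have d0 : (frac x).2 != 0 by exact: denom_ratioP.
have t0 : tofrac (frac x).2 != 0 by rewrite tofrac_eq0.
apply: (mulIf t0); rewrite mulfVK// -[f in LHS]reprK -/x; unlock tofrac.
rewrite -[LHS]FracField.pi_mul; apply/eqmodP.
rewrite /= FracField.equivfE /FracField.mulf !numden_Ratio ?oner_neq0 ?mulf_neq0 ?oner_neq0//.
by rewrite !mulr1 mulrC.
Qed.

Section RationalFunctions.
Variable R : realType.
Local Notation C := (cplx R).
Local Notation P5 := (mpoly.mpoly 5 C).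

Definition rconst (z : C) : ratfun R := tofrac (mpoly.mpolyC 5 z : P5).

Definition rvar (i : 'I_5) : ratfun R :=
  tofrac (mpoly.mpolyX C (mpoly.mnm1 i) : P5).

Definition Xa := rvar 0.
Definition Xb := rvar 1.
Definition Xc := rvar 2.
Definition Xq := rvar 3.
Definition Xx := rvar 4.

Definition coords (K : fieldType) (a b c q x : K) : 'I_5 -> K :=
  fun i => nth 0 [:: a; b; c; q; x] i.

(* f is regular at the point v of K^5, with value y; K is an extension of C
   through iota. *)
Definition rat_at (K : fieldType) (iota : C -> K) (v : 'I_5 -> K)
    (f : ratfun R) (y : K) : Prop :=
  exists N D : P5, [/\ f = tofrac N / tofrac D, mpoly.mmap iota v D != 0
                     & y = mpoly.mmap iota v N / mpoly.mmap iota v D].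

Definition rat_regular (K : fieldType) (iota : C -> K) (v : 'I_5 -> K)
    (f : ratfun R) : Prop := exists y, rat_at iota v f y.

Definition rat_eval (K : fieldType) (iota : C -> K) (v : 'I_5 -> K)
    (f : ratfun R) : K := xget 0 (rat_at iota v f).

Lemma rat_evalE (K : fieldType) (iota : {rmorphism C -> K}) (v : 'I_5 -> K)
    (N D : P5) : mpoly.mmap iota v D != 0 ->
  rat_eval iota v (tofrac N / tofrac D) =
    mpoly.mmap iota v N / mpoly.mmap iota v D.
Proof.
have ev0 (E : P5) : mpoly.mmap iota v E != 0 -> tofrac E != 0.
  by apply: contra; rewrite tofrac_eq0 => /eqP ->; rewrite mpoly.mmap0.
move=> D0; apply: xget_unique; first by exists N, D.
move=> y [N' [D' [/eqP + D0' ->]]]; rewrite eqr_div; [|exact: ev0..].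
rewrite -!tofracM tofrac_eq => /eqP /(congr1 (mpoly.mmap iota v)).
have mM p r : mpoly.mmap iota v (p * r) = mpoly.mmap iota v p * mpoly.mmap iota v r.
  exact: (mpoly.mmap_is_multiplicative v iota).1.
by rewrite !mM => h; apply/eqP; rewrite eqr_div// -h.
Qed.

(* The three-term relation, at all points where its three series converge, no
   Pochhammer symbol degenerates, and Q and S are defined *)
Definition three_term (k l m n : int) (Q S : ratfun R) : Prop :=
  forall a b c q x : C, 0 < `|q| < 1 ->
    (forall j : int, [/\ a != q ^ j, b != q ^ j & c != q ^ j]) ->
    `|x| < 1 -> `|x * q ^ n| < 1 ->
    let v := coords a b c q x in
    rat_regular idfun v Q -> rat_regular idfun v S ->
    phi21 (a * q ^ k) (b * q ^ l) (c * q ^ m) q (x * q ^ n) =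
      rat_eval idfun v Q * phi21 (a * q) (b * q) (c * q) q x
      + rat_eval idfun v S * phi21 a b c q x.

Definition is_Q (k l m n : int) (Q : ratfun R) : Prop :=
  exists S : ratfun R, three_term k l m n Q S.

Lemma rvar_neq0 i : rvar i != 0.
Proof.
rewrite /rvar tofrac_eq0; apply/eqP => /(congr1 (mpoly.mcoeff (mpoly.mnm1 i))).
by rewrite mpoly.mcoeffX eqxx mpoly.mcoeff0 => /eqP; rewrite oner_eq0.
Qed.

Lemma Xq_neq0 : Xq != 0. Proof. exact: rvar_neq0. Qed.

Lemma generic_neq0 : [&& Xa != 0, Xb != 0, Xc != 0 & Xx != 0].
Proof. by apply/and4P; split; exact: rvar_neq0. Qed.

(* the tuple (k,l,m,n;a,b,c,x) with a, b, c, x the indeterminates *)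
Definition generic (k l m n : int) : args (ratfun R) :=
  Args k l m n generic_neq0.

(* (k,l,m,n;a,b,c,x) |-> Q(k,l,m,n;a,b,c,x): a, b, c, x are substituted for the
   corresponding indeterminates, q is left unchanged. *)
Definition subst (Q : int -> int -> int -> int -> ratfun R)
    (t : args (ratfun R)) : ratfun R :=
  rat_eval rconst (coords (aa t) (ab t) (ac t) Xq (ax t))
    (Q (ak t) (al t) (am t) (an t)).

Lemma subst_generic (Q : int -> int -> int -> int -> ratfun R) (k l m n : int) :
  subst Q (generic k l m n) = Q k l m n.
Proof.
rewrite /subst/=; have [N [D [D0 ->]]] := fractionE (Q k l m n).
pose iota : {rmorphism C -> ratfun R} := @FracField.tofrac P5 \o @mpoly.mpolyC 5 C.
pose v := coords Xa Xb Xc Xq Xx.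
have vE i : v i = rvar i by case: i => [[|[|[|[|[|]]]]]] //= i5; congr rvar; exact: val_inj.
have E p : mpoly.mmap iota v p = tofrac p.
  rewrite [in RHS](mpoly.mpolyE p) rmorph_sum; apply: eq_bigr => mm _.
  rewrite -mpoly.mul_mpolyC rmorphM; congr (_ * _).
  rewrite mpoly.mpolyXE_id rmorph_prod; apply: eq_bigr => i _.
  by rewrite rmorphXn vE.
have := @rat_evalE (ratfun R) iota v N D; rewrite !E; apply.
by rewrite tofrac_eq0.
Qed.

End RationalFunctions.

(* Main.v *)
Require Import Defs.
From HB Require Import structures.
From mathcomp Require Import all_boot all_order all_algebra.
From mathcomp Require Import complex.
From mathcomp Require Import all_classical all_reals all_analysis.
From mathcomp Require Import ring lra.
From mathcomp Require mpoly.
Import (canonicals, coercions) mpoly.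
Set Implicit Arguments.
Unset Strict Implicit.
Unset Printing Implicit Defensive.
Import Order.TTheory GRing.Theory Num.Theory numFieldNormedType.Exports.
Local Open Scope ring_scope.

(** The coefficient Q is characterised by linear recurrences in (k, l, m, n),
    after which each symmetry is a statement of uniqueness.

    Heine's contiguous relations express the series at parameters shifted by
    one power of q through phi(a, b; c; x) and phi(aq, bq; cq; x). Read at all
    shifts they form a system of linear recurrences on Z^4 ([contiguous]),
    solved by (k, l, m, n) |-> phi(a q^k, b q^l; c q^m; x q^n)
    ([phi21_contiguity]). If A and B are rational functions such that
    A phi(aq, bq; cq; x) + B phi(a, b; c; x) vanishes near x = 0 for enough
    parameters, then A = 0 ([rational_independence]). Subtracting three-term
    relations therefore shows that Q solves the same system
    ([is_Q_contiguous]), with the value 0 at the origin and 1 at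
    e = (1, 1, 1, 0) ([is_Q_origin], [is_Q_unit], [is_Q_unique]).

    Away from coincidences between powers of q, the values of a solution f at
    v and v + e determine, and are determined by, those at each neighbour of v
    and its translate by e. Hence a solution is determined by its values at 0
    and e ([contiguous_unique]). The four generators follow.
    - sigma3 exchanges a and b, and so do the equations of the system.
    - For sigma1 and sigma2, a solution at the new parameters, composed with
      the map on the indices and multiplied by the explicit factor, solves the
      system at the old parameters ([contiguous_heine],
      [contiguous_inversion]). Behind this are Heine's transformation for
      sigma1 and, for sigma2, the second solution of the q-difference equation
      rewritten by the q-Euler transformation, both seen only through the
      recurrences.
    - For sigma0, the Casoratian f(v) g(v + e) - g(v) f(v + e) of two solutions
      is multiplied by an explicit determinant at each step on Z^4. With f = Q
      and g the solution normalised at the point (k, l, m, n), it equals minus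
      sigma0 Q at the origin and Q at (k, l, m, n) ([reflection_identity]);
      the product of the determinants is, up to sign, the factor.

    An identity for a composite of generators uses the generator identities at
    the points of the orbit of the generic tuple. The coordinates of such a
    point together with q are algebraically independent, so that evaluation
    there is an endomorphism of the field of rational functions
    ([alg_indep_morphism]) and carries the system to the system at the new
    parameters ([subst_solution]). Induction on the derivation then covers
    every element of the group ([sym_factorP]).

    Finally, sigma0 commutes with the other generators, and these act on
    (q, a, b, c, x) by monomials, hence by integer matrices. A finite
    computation finds 48 products of sigma1, sigma2, sigma3, closed under
    multiplication by the generators, and shows that with their products by
    sigma0 they are 96 distinct maps ([card_symG]). *)

(** * The contiguity system *)

Section ContiguitySystem.
Variables (K : fieldType) (q : K) (q0 : q != 0).
Implicit Types (a b c x : K) (f g h : int -> int -> int -> int -> K).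

(** Heine's contiguous relations, as satisfied by
    f(k, l, m, n) = 2phi1(a q^k, b q^l; c q^m; q, x q^n); see
    [phi21_contiguity]. *)
Definition contiguous a b c x f : Prop := forall k l m n : int,
  let a' := a * q ^ k in let b' := b * q ^ l in
  let c' := c * q ^ m in let x' := x * q ^ n in
  let fe := f (k + 1) (l + 1) (m + 1) n in
  [/\ f (k + 1) l m n = f k l m n + a' * x' * (1 - b') / (1 - c') * fe,
      f k (l + 1) m n = f k l m n + b' * x' * (1 - a') / (1 - c') * fe,
      f k l m n = f k l (m + 1) n + c' * x' * (1 - a') * (1 - b')
         / ((1 - c') * (1 - c' * q)) * f (k + 1) (l + 1) (m + 2) n
    & f k l m (n + 1) = f k l m n - x' * (1 - a') * (1 - b') / (1 - c') * fe].

(** Excludes the coincidences that would produce a zero or a pole, at some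
    lattice point, in the coefficients of the system, in the determinants of
    its steps or in the three factors. *)
Definition q_generic a b c x : Prop := forall j : int,
  [/\ a * q ^ j != 1, b * q ^ j != 1, c * q ^ j != 1, x * q ^ j != 1 &
      [/\ a * q ^ j != c, b * q ^ j != c, a * b * x * q ^ j != c
        & b * x * q ^ j != 1]].

Lemma contiguous_shift a b c x f k l m n : contiguous a b c x f ->
  contiguous (a * q ^ k) (b * q ^ l) (c * q ^ m) (x * q ^ n)
    (fun k' l' m' n' => f (k + k') (l + l') (m + m') (n + n')).
Proof.
move=> H k' l' m' n' /=; have := H (k + k') (l + l') (m + m') (n + n').
have E (y : K) i j : y * q ^ (i + j) = y * q ^ i * q ^ j.
  by rewrite expfzDr// mulrA.
by rewrite /= !E !addrA.
Qed.

Lemma q_generic_shift a b c x k l m n : q_generic a b c x ->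
  q_generic (a * q ^ k) (b * q ^ l) (c * q ^ m) (x * q ^ n).
Proof.
move=> H j; have nz i : q ^ i != 0 by rewrite expfz_neq0.
have E (y : K) i : y * q ^ i * q ^ j = y * q ^ (i + j) by rewrite expfzDr// mulrA.
have M (y z : K) i : (y == z * q ^ i) = (y * q ^ (- i) == z).
  rewrite -invr_expz; apply/eqP/eqP => [->|<-]; first by rewrite mulfK.
  by rewrite mulfVK.
rewrite !E !M -!mulrA -!expfzDr//; split.
- by case: (H (k + j)).
- by case: (H (l + j)).
- by case: (H (m + j)).
- by case: (H (n + j)).
split.
- by case: (H (k + (j - m))) => _ _ _ _ []; rewrite -addrA.
- by case: (H (l + (j - m))) => _ _ _ _ []; rewrite -addrA.
- case: (H (k + l + n + j - m)) => _ _ _ _ [_ _ + _]; congr (_ != _).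
  by rewrite !expfzDr//; ring.
- case: (H (l + n + j)) => _ _ _ _ [_ _ _]; congr (_ != _).
  by rewrite !expfzDr//; ring.
Qed.

(** Turns an identity modulo one relation A = B into a field identity, once
    the multiplier s of that relation is known. *)
Lemma eq_lincomb (L R A B s : K) : A = B -> L - R = s * (A - B) -> L = R.
Proof. by move=> -> /eqP; rewrite subrr mulr0 subr_eq0 => /eqP. Qed.

(** Closes a goal that is one of the four relations at the given shifts, up
    to the evaluation of q^0, q^1 and q^(-1). *)
Tactic Notation "by_contiguity" constr(H) uconstr(k) uconstr(l) uconstr(m)
    uconstr(n) :=
  let EA := fresh in let EB := fresh in let EC := fresh in let EX := fresh in
  destruct (H k l m n) as [EA EB EC EX]; cbv zeta in *;
  rewrite ?expr0z ?expr1z ?exprN1 ?mulr1 in EA EB EC EX;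
  first [exact: EA | exact: EB | exact: EC | exact: EX].

Lemma q_generic_neq0 a b c x j : q_generic a b c x ->
  [/\ 1 - a * q ^ j != 0, 1 - b * q ^ j != 0, 1 - c * q ^ j != 0,
      1 - x * q ^ j != 0 &
      [/\ c - a * q ^ j != 0, c - b * q ^ j != 0, c - a * b * x * q ^ j != 0
        & 1 - b * x * q ^ j != 0]].
Proof.
by move=> /(_ j); rewrite !subr_eq0 ![_ == 1]eq_sym ![_ == c]eq_sym.
Qed.

(** Two routes lead to f(1, 1, 0, 0), one through the relations in a and b and
    one through the relation in c. Equating them leaves a second-order
    recurrence in the direction (1, 1, 1, 0). *)
Lemma contiguity_e2 a b c x f : q_generic a b c x -> contiguous a b c x f ->
  f 0 0 0 0 =
    x * (1 - a * q) * (1 - b * q) * (c - a * b * q * x)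
      / ((1 - c) * (1 - c * q)) * f 2 2 2 0
    - (a * x * (1 - b) / (1 - c) + b * x * (1 - a * q) / (1 - c) - 1) * f 1 1 1 0.
Proof.
move=> ND Cf.
have E1 : f 1 0 0 0 = f 0 0 0 0 + a * x * (1 - b) / (1 - c) * f 1 1 1 0.
  by_contiguity Cf 0 0 0 0.
have E2 : f 1 1 0 0 = f 1 0 0 0 + b * x * (1 - a * q) / (1 - c) * f 2 1 1 0.
  by_contiguity Cf 1 0 0 0.
have E3 : f 2 1 1 0 = f 1 1 1 0 + (a * q) * x * (1 - b * q) / (1 - c * q) * f 2 2 2 0.
  by_contiguity Cf 1 1 1 0.
have E4 : f 1 1 0 0 = f 1 1 1 0 + c * x * (1 - a * q) * (1 - b * q) /
     ((1 - c) * (1 - c * q)) * f 2 2 2 0.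
  by_contiguity Cf 1 1 0 0.
have [_ _ + _ _] := q_generic_neq0 0 ND; rewrite expr0z mulr1 => c0.
have [_ _ + _ _] := q_generic_neq0 1 ND; rewrite expr1z => c1.
by apply: (@eq_lincomb _ _ _ _ 1 E4); rewrite E2 E1 E3; field; rewrite c0 c1.
Qed.

(** The recurrence makes (u0, u1) a linear image of (y0, y1); the last two
    hypotheses say that its determinant is nonzero. *)
Lemma pair_step_eq0 (y0 y1 y2 u0 u1 s s' r t : K) :
  y0 = t * y2 - r * y1 -> u0 = y0 + s * y1 -> u1 = y1 + s' * y2 ->
  t != 0 -> t + s' * (r - s) != 0 ->
  (y0 = 0 /\ y1 = 0) <-> (u0 = 0 /\ u1 = 0).
Proof.
move=> -> -> -> t0 d0; split=> [[+ y10]|[+ /eqP]].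
  rewrite y10 !mulr0 !oppr0 !addr0 => /eqP; rewrite mulf_eq0 (negPf t0).
  by move=> /eqP ->; rewrite !mulr0 addr0.
rewrite addr_eq0 => + /eqP y1E; rewrite y1E => /eqP.
have -> : t * y2 - r * - (s' * y2) + s * - (s' * y2) = (t + s' * (r - s)) * y2.
    by ring.
by rewrite mulf_eq0 (negPf d0) /= => /eqP ->; rewrite !(mulr0, oppr0, addr0).
Qed.

(** The Casoratian of two solutions is multiplied by the determinant
    (t + s' (r - s)) / t of the map from (y0, y1) to (u0, u1). *)
Lemma casoratian_step (y0 y1 y2 u0 u1 z0 z1 z2 w0 w1 s s' r t : K) :
  y0 = t * y2 - r * y1 -> u0 = y0 + s * y1 -> u1 = y1 + s' * y2 ->
  z0 = t * z2 - r * z1 -> w0 = z0 + s * z1 -> w1 = z1 + s' * z2 ->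
  t * (u0 * w1 - w0 * u1) = (t + s' * (r - s)) * (y0 * z1 - z0 * y1).
Proof. by move=> -> -> -> -> -> ->; ring. Qed.

Lemma int_shift_ind (P : int -> Prop) : P 0 ->
  (forall i, P i <-> P (i + 1)) -> forall i, P i.
Proof.
move=> P0 PS; elim/int_rec => [//|n /PS|n Pn]; first by rewrite -PoszD addn1.
by apply/PS; rewrite -addn1 PoszD opprD addrNK.
Qed.

Lemma int4_shift_ind (P : int -> int -> int -> int -> Prop) : P 0 0 0 0 ->
  (forall k l m n, P k l m n <-> P (k + 1) l m n) ->
  (forall k l m n, P k l m n <-> P k (l + 1) m n) ->
  (forall k l m n, P k l m n <-> P k l (m + 1) n) ->
  (forall k l m n, P k l m n <-> P k l m (n + 1)) ->
  forall k l m n, P k l m n.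
Proof.
move=> P0 PA PB PC PX k l m n; move: k; apply: int_shift_ind => //.
move: l; apply: int_shift_ind => //; move: m; apply: int_shift_ind => //.
by move: n; apply: int_shift_ind.
Qed.

(** The four elementary steps on the pair of values at v and v + (1, 1, 1, 0),
    in the form that [pair_step_eq0] and [casoratian_step] expect. The relation
    in c is read as a step from m to m - 1, which keeps the new value on the
    left. *)
Lemma contiguity_pairs a b c x f : contiguous a b c x f ->
  [/\ f 1 0 0 0 = f 0 0 0 0 + a * x * (1 - b) / (1 - c) * f 1 1 1 0 /\
      f 2 1 1 0 = f 1 1 1 0 + a * q * x * (1 - b * q) / (1 - c * q) * f 2 2 2 0,
      f 0 1 0 0 = f 0 0 0 0 + b * x * (1 - a) / (1 - c) * f 1 1 1 0 /\
      f 1 2 1 0 = f 1 1 1 0 + b * q * x * (1 - a * q) / (1 - c * q) * f 2 2 2 0,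
      f 0 0 (-1) 0 = f 0 0 0 0
        + c / q * x * (1 - a) * (1 - b) / ((1 - c / q) * (1 - c)) * f 1 1 1 0 /\
      f 1 1 0 0 = f 1 1 1 0
        + c * x * (1 - a * q) * (1 - b * q) / ((1 - c) * (1 - c * q)) * f 2 2 2 0
    & f 0 0 0 1 = f 0 0 0 0
        + - (x * (1 - a) * (1 - b) / (1 - c)) * f 1 1 1 0 /\
      f 1 1 1 1 = f 1 1 1 0
        + - (x * (1 - a * q) * (1 - b * q) / (1 - c * q)) * f 2 2 2 0].
Proof.
move=> Cf; split; split.
- by_contiguity Cf 0 0 0 0.
- by_contiguity Cf 1 1 1 0.
- by_contiguity Cf 0 0 0 0.
- by_contiguity Cf 1 1 1 0.
- rewrite -[X in _ / (_ * (1 - X))](divfK q0 c); by_contiguity Cf 0 0 (-1) 0.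
- by_contiguity Cf 1 1 0 0.
- rewrite mulNr; by_contiguity Cf 0 0 0 0.
- rewrite mulNr; by_contiguity Cf 1 1 1 0.
Qed.

Section Steps.
Variables (a b c x : K).
Hypothesis ND : q_generic a b c x.
Let t := x * (1 - a * q) * (1 - b * q) * (c - a * b * q * x)
      / ((1 - c) * (1 - c * q)).
Let r := a * x * (1 - b) / (1 - c) + b * x * (1 - a * q) / (1 - c) - 1.

(** The determinants of the four steps factor completely. This shows both that
    no step degenerates and that the determinants are the ratios of [factor0]
    at neighbouring points ([factor0_steps]). *)
Lemma step_dets (x0 : x != 0) :
  [/\ t != 0,
  t + a * q * x * (1 - b * q) / (1 - c * q) * (r - a * x * (1 - b) / (1 - c)) =
  t * ((c - a * q) / ((1 - a * q) * (c - a * b * q * x))),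
  t + b * q * x * (1 - a * q) / (1 - c * q) * (r - b * x * (1 - a) / (1 - c)) =
  t * ((c - b * q) / ((1 - b * q) * (c - a * b * q * x))),
  t + c * x * (1 - a * q) * (1 - b * q) / ((1 - c) * (1 - c * q))
    * (r - c / q * x * (1 - a) * (1 - b) / ((1 - c / q) * (1 - c))) =
  t * (- (c - a * q) * (c - b * q) * x
    / ((q - c) * (1 - c) * (c - a * b * q * x))) &
  t + - (x * (1 - a * q) * (1 - b * q) / (1 - c * q))
    * (r + x * (1 - a) * (1 - b) / (1 - c)) =
  t * ((1 - x) / (c - a * b * q * x))].
Proof.
have [_ _ + _ _] := q_generic_neq0 0 ND; rewrite expr0z mulr1 => c0.
have [a1 b1 + _ [_ _ abx _]] := q_generic_neq0 1 ND.
rewrite expr1z in a1 b1 abx * => c1.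
have [_ _ + _ _] := q_generic_neq0 (-1) ND; rewrite exprN1 => cN.
have abx' : c - a * b * q * x != 0 by apply: contra abx => /eqP <-; apply/eqP; ring.
have cN' : q - c != 0 by rewrite (_ : _ - _ = (1 - c / q) * q) ?mulf_neq0//; field.
have t0 : t != 0 by rewrite !mulf_neq0// ?invr_eq0 !mulf_neq0.
split=> //; rewrite /t /r; field; rewrite ?q0 ?c0 ?c1 ?abx' ?cN' ?a1 ?b1//.
Qed.
End Steps.
End ContiguitySystem.

(** * Uniqueness of solutions and the Casoratian *)

Section Uniqueness.
Variables (K : fieldType) (q : K) (q0 : q != 0).
Implicit Types (a b c x : K) (f g h : int -> int -> int -> int -> K).

Definition base_zero f k l m n :=
  f k l m n = 0 /\ f (k + 1) (l + 1) (m + 1) n = 0.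

Definition casoratian f g k l m n :=
  f k l m n * g (k + 1) (l + 1) (m + 1) n - g k l m n * f (k + 1) (l + 1) (m + 1) n.

Lemma origin_steps a b c x f g : q_generic q a b c x -> x != 0 ->
  contiguous q a b c x f -> contiguous q a b c x g ->
  [/\ [/\ base_zero f 0 0 0 0 <-> base_zero f 1 0 0 0,
      base_zero f 0 0 0 0 <-> base_zero f 0 1 0 0,
      base_zero f 0 0 0 0 <-> base_zero f 0 0 (-1) 0 &
      base_zero f 0 0 0 0 <-> base_zero f 0 0 0 1],
   casoratian f g 1 0 0 0 = (c - a * q) / ((1 - a * q) * (c - a * b * q * x))
      * casoratian f g 0 0 0 0,
   casoratian f g 0 1 0 0 = (c - b * q) / ((1 - b * q) * (c - a * b * q * x))
      * casoratian f g 0 0 0 0,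
   casoratian f g 0 0 (-1) 0 = (- (c - a * q) * (c - b * q) * x
    / ((q - c) * (1 - c) * (c - a * b * q * x))) * casoratian f g 0 0 0 0 &
   casoratian f g 0 0 0 1 = (1 - x) / (c - a * b * q * x)
      * casoratian f g 0 0 0 0].
Proof.
move=> ND x0 Cf Cg.
have ef := contiguity_e2 ND Cf; have eg := contiguity_e2 ND Cg.
have [[fA fA'] [fB fB'] [fC fC'] [fX fX']] := contiguity_pairs q0 Cf.
have [[gA gA'] [gB gB'] [gC gC'] [gX gX']] := contiguity_pairs q0 Cg.
have [t0 dA dB dC dX] := step_dets q0 ND x0.
have [_ _ c0 xq0 [ca0 cb0 _ _]] := q_generic_neq0 0 ND.
have [a1 b1 c1 _ [ca1 cb1 cabx _]] := q_generic_neq0 1 ND.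
have [_ _ cN _ _] := q_generic_neq0 (-1) ND.
rewrite expr0z !mulr1 in c0 xq0 ca0 cb0; rewrite expr1z in a1 b1 c1 ca1 cb1 cabx.
rewrite exprN1 in cN.
have cabx' : c - a * b * q * x != 0.
  by apply: contra cabx => /eqP <-; apply/eqP; ring.
have cN' : q - c != 0 by rewrite (_ : _ - _ = (1 - c / q) * q) ?mulf_neq0//; field.
split; first split.
- apply: (pair_step_eq0 ef fA fA') => //.
  by rewrite dA !mulf_neq0 ?invr_eq0 ?mulf_neq0.
- apply: (pair_step_eq0 ef fB fB') => //.
  by rewrite dB !mulf_neq0 ?invr_eq0 ?mulf_neq0.
- apply: (pair_step_eq0 ef fC fC') => //.
  by rewrite dC !mulf_neq0 ?oppr_eq0 ?invr_eq0 ?mulf_neq0.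
- apply: (pair_step_eq0 ef fX fX') => //.
  by rewrite opprK dX !mulf_neq0 ?oppr_eq0 ?invr_eq0 ?mulf_neq0.
- by apply: (mulfI t0); rewrite (casoratian_step ef fA fA' eg gA gA') dA -mulrA.
- by apply: (mulfI t0); rewrite (casoratian_step ef fB fB' eg gB gB') dB -mulrA.
- by apply: (mulfI t0); rewrite (casoratian_step ef fC fC' eg gC gC') dC -mulrA.
- apply: (mulfI t0); rewrite (casoratian_step ef fX fX' eg gX gX') opprK dX.
  by rewrite -mulrA.
Qed.

(** The system is invariant under translation of the lattice if the parameters
    are shifted accordingly, so that the steps at the origin suffice. *)
Lemma lattice_steps a b c x f g : q_generic q a b c x -> x != 0 ->
  contiguous q a b c x f -> contiguous q a b c x g ->
  forall k l m n : int, let a' := a * q ^ k in let b' := b * q ^ l in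
  let c' := c * q ^ m in let x' := x * q ^ n in
  let c'' := c * q ^ (m + 1) in
  [/\ [/\ base_zero f k l m n <-> base_zero f (k + 1) l m n,
      base_zero f k l m n <-> base_zero f k (l + 1) m n,
      base_zero f k l m n <-> base_zero f k l (m + 1) n &
      base_zero f k l m n <-> base_zero f k l m (n + 1)],
   casoratian f g (k + 1) l m n =
      (c' - a' * q) / ((1 - a' * q) * (c' - a' * b' * q * x'))
      * casoratian f g k l m n,
   casoratian f g k (l + 1) m n =
      (c' - b' * q) / ((1 - b' * q) * (c' - a' * b' * q * x'))
      * casoratian f g k l m n,
   casoratian f g k l m n = (- (c'' - a' * q) * (c'' - b' * q) * x'
     / ((q - c'') * (1 - c'') * (c'' - a' * b' * q * x')))
      * casoratian f g k l (m + 1) n &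
   casoratian f g k l m (n + 1) = (1 - x') / (c' - a' * b' * q * x')
      * casoratian f g k l m n].
Proof.
move=> ND x0 Cf Cg k l m n /=.
have steps k' l' m' n' := origin_steps (q_generic_shift q0 k' l' m' n' ND)
  (mulf_neq0 x0 (expfz_neq0 n' q0)) (contiguous_shift q0 k' l' m' n' Cf)
  (contiguous_shift q0 k' l' m' n' Cg).
have [[ZA ZB _ ZX] CA CB _ CX] := steps k l m n.
have [[_ _ ZC _] _ _ CC _] := steps k l (m + 1) n.
rewrite /base_zero /casoratian /= !addr0 ?add0r !addrA ?addrK in
  ZA ZB ZC ZX CA CB CC CX *.
by split=> //; split=> //; rewrite /base_zero ZC.
Qed.

Lemma contiguous_eq0 a b c x f : q_generic q a b c x -> x != 0 ->
  contiguous q a b c x f -> f 0 0 0 0 = 0 -> f 1 1 1 0 = 0 ->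
  forall k l m n, f k l m n = 0.
Proof.
move=> ND x0 Cf f0 fe k l m n.
suff: base_zero f k l m n by case.
have steps k' l' m' n' := let: And5 s _ _ _ _ :=
  lattice_steps ND x0 Cf Cf k' l' m' n' in s.
by move: k l m n; apply: int4_shift_ind => // k l m n; case: (steps k l m n).
Qed.

Lemma contiguousB a b c x f g (s : K) : contiguous q a b c x f ->
  contiguous q a b c x g ->
  contiguous q a b c x (fun k l m n => f k l m n - s * g k l m n).
Proof.
move=> Cf Cg k l m n /=; have [fA fB fC fX] := Cf k l m n.
by have [-> -> -> ->] := Cg k l m n; rewrite fA fB fX fC; split; ring.
Qed.

Lemma contiguous_unique a b c x f g : q_generic q a b c x -> x != 0 ->
  contiguous q a b c x f -> contiguous q a b c x g ->
  f 0 0 0 0 = 0 -> f 1 1 1 0 = 1 -> g 0 0 0 0 = 0 -> g 1 1 1 0 = 1 ->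
  forall k l m n, f k l m n = g k l m n.
Proof.
move=> ND x0 Cf Cg f0 f1 g0 g1 k l m n; apply/eqP; rewrite -subr_eq0 -[g _ _ _ _]mul1r.
apply/eqP; move: k l m n; apply: (contiguous_eq0 ND x0 (contiguousB 1 Cf Cg)).
  by rewrite f0 g0 mulr0 subr0.
by rewrite f1 g1 mulr1 subrr.
Qed.

Lemma scaled_eq (d w y z : K) : d != 0 -> (w = - y * z) <-> (d * w = - (d * y) * z).
Proof.
move=> d0; rewrite -mulrN -mulrA; split=> [->//|]; exact: mulfI.
Qed.

(** Translating g by (-k, -l, -m, -n) gives a second solution g' of the system
    of f. The Casoratian of f and g' is - g(-k, -l, -m, -n) at the origin, as
    f vanishes there and is 1 at (1, 1, 1, 0); at (k, l, m, n) it is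
    f(k, l, m, n), as g' is normalised there in the same way. The function - F
    follows the Casoratian from the one point to the other. *)
Lemma reflection_identity a b c x f g F (k l m n : int) :
  q_generic q a b c x -> x != 0 ->
  contiguous q a b c x f -> f 0 0 0 0 = 0 -> f 1 1 1 0 = 1 ->
  contiguous q (a * q ^ k) (b * q ^ l) (c * q ^ m) (x * q ^ n) g ->
  g 0 0 0 0 = 0 -> g 1 1 1 0 = 1 -> F 0 0 0 0 = -1 ->
  (forall k l m n : int, let a' := a * q ^ k in let b' := b * q ^ l in
     let c' := c * q ^ m in let x' := x * q ^ n in let c'' := c * q ^ (m + 1) in
   [/\ F (k + 1) l m n =
         (c' - a' * q) / ((1 - a' * q) * (c' - a' * b' * q * x')) * F k l m n,
       F k (l + 1) m n =
         (c' - b' * q) / ((1 - b' * q) * (c' - a' * b' * q * x')) * F k l m n,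
       F k l m n = (- (c'' - a' * q) * (c'' - b' * q) * x'
         / ((q - c'') * (1 - c'') * (c'' - a' * b' * q * x'))) * F k l (m + 1) n &
       F k l m (n + 1) = (1 - x') / (c' - a' * b' * q * x') * F k l m n]) ->
  f k l m n = F k l m n * g (- k) (- l) (- m) (- n).
Proof.
move=> ND x0 Cf f0 f1 Cg g0 g1 F0 HF.
pose g' k' l' m' n' := g (- k + k') (- l + l') (- m + m') (- n + n').
have Cg' : contiguous q a b c x g'.
  have := contiguous_shift q0 (- k) (- l) (- m) (- n) Cg.
  by rewrite -!mulrA -!expfzDr// !subrr expr0z !mulr1.
have steps := lattice_steps ND x0 Cf Cg'.
have NDs k' l' m' n' := q_generic_neq0 0 (q_generic_shift q0 k' l' m' n' ND).
have NDs1 k' l' m' n' := q_generic_neq0 1 (q_generic_shift q0 k' l' m' n' ND).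
have NDsN k' l' m' n' := q_generic_neq0 (-1) (q_generic_shift q0 k' l' m' n' ND).
have HW k' l' m' n' :
   casoratian f g' k' l' m' n' = - F k' l' m' n' * casoratian f g' 0 0 0 0.
  { move: k' l' m' n'; apply: int4_shift_ind => [|k' l' m' n'|k' l' m' n'|k' l' m' n'|k' l' m' n'].
  - by rewrite F0 opprK mul1r.
  all: have [_ _ c0 xq0 [ca0 cb0 _ _]] := NDs k' l' m' n'.
  all: have [a1 b1 c1 _ [ca1 cb1 cabx _]] := NDs1 k' l' m' n'.
  all: have [_ _ d0 _ [da0 db0 _ _]] := NDs k' l' (m' + 1) n'.
  all: have [_ _ _ _ [da1 db1 dabx _]] := NDs1 k' l' (m' + 1) n'.
  all: have [_ _ dN _ _] := NDsN k' l' (m' + 1) n'.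
  all: have [wA wB wC wX] := HF k' l' m' n'.
  all: have [_ WA WB WC WX] := steps k' l' m' n'.
  all: rewrite !(expr0z, mulr1) in c0 xq0 ca0 cb0 d0 da0 db0.
  all: rewrite !expr1z in a1 b1 c1 ca1 cb1 cabx da1 db1 dabx; rewrite exprN1 in dN.
  all: have cE (s t u v : K) : s - t * u * v * q = s - t * u * q * v by ring.
  all: rewrite cE in cabx; rewrite cE in dabx.
  all: have qE (s : K) : 1 - s / q != 0 -> q - s != 0.
  1,3,5,7: by move=> h; rewrite (_ : q - s = (1 - s / q) * q) ?mulf_neq0//; field.
  all: move/qE: dN => dN.
  - rewrite wA WA; apply: scaled_eq.
    by rewrite !mulf_neq0// ?invr_eq0 ?mulf_neq0.
  - rewrite wB WB; apply: scaled_eq.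
    by rewrite !mulf_neq0// ?invr_eq0 ?mulf_neq0.
  - rewrite wC WC; apply: iff_sym; apply: scaled_eq.
    by rewrite !mulf_neq0// ?oppr_eq0 ?invr_eq0 ?mulf_neq0// expfz_neq0.
  - rewrite wX WX; apply: scaled_eq.
    by rewrite !mulf_neq0// ?invr_eq0 ?mulf_neq0. }
have := HW k l m n; rewrite /casoratian /g' !addr0 !addrA !addNr add0r.
by rewrite g0 g1 f0 f1 !(mul0r, mulr1, sub0r, subr0) mulrNN.
Qed.
End Uniqueness.

(** * Heine's transformation and the inversion of parameters *)

Lemma exprN2z (K : unitRingType) (y : K) : y ^ (-2) = (y * y)^-1.
Proof. by rewrite -expr2. Qed.

Lemma small_intE : (((0 + 1)%R = 1%R :> int) * ((1 + 1)%R = 2%R :> int)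
  * ((-1 + 1)%R = 0%R :> int) * ((-2 + 1)%R = (-1)%R :> int)
  * ((0 + 2)%R = 2%R :> int) * ((-1 + 2)%R = 1%R :> int)
  * ((-2 + 2)%R = 0%R :> int) * ((1 + 2)%R = 3%R :> int))%type.
Proof. by []. Qed.

(** Reads a relation indexed by lattice points at small numeric indices, with
    the indices reduced to numerals. *)
Tactic Notation "instance" uconstr(H) "at" uconstr(k) uconstr(l) uconstr(m) uconstr(n)
    "as" ident(E) :=
  pose proof (H k l m n) as E; cbv zeta in E;
  rewrite ?expr0z ?expr1z ?exprN1 ?exprN2z ?mulr1 ?small_intE in E.

Section Transformations.
Variables (K : fieldType) (q : K) (q0 : q != 0).
Implicit Types (a b c x : K) (f g h F : int -> int -> int -> int -> K).

Lemma contiguous_swap a b c x h : contiguous q b a c x h ->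
  contiguous q a b c x (fun k l m n => h l k m n).
Proof.
move=> Ch k l m n /=; have [hA hB hC hX] := Ch l k m n.
split; [exact: hB | exact: hA | rewrite hC | rewrite hX]; congr (_ + _).
  by congr (_ * _); congr (_ / _); ring.
by congr (- (_ / _ * _)); ring.
Qed.

Lemma contiguity_e2_at a b c x f : q_generic q a b c x -> contiguous q a b c x f ->
  forall k l m n : int, let a' := a * q ^ k in let b' := b * q ^ l in
  let c' := c * q ^ m in let x' := x * q ^ n in
  f k l m n =
    x' * (1 - a' * q) * (1 - b' * q) * (c' - a' * b' * q * x')
      / ((1 - c') * (1 - c' * q)) * f (k + 2) (l + 2) (m + 2) n
    - (a' * x' * (1 - b') / (1 - c') + b' * x' * (1 - a' * q) / (1 - c') - 1)
      * f (k + 1) (l + 1) (m + 1) n.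
Proof.
move=> ND Cf k l m n; have := contiguity_e2 (q_generic_shift q0 k l m n ND)
  (contiguous_shift q0 k l m n Cf).
by rewrite /= !addr0.
Qed.

Lemma contiguityA a b c x f : contiguous q a b c x f -> forall k l m n : int,
  f (k + 1) l m n = f k l m n + a * q ^ k * (x * q ^ n) * (1 - b * q ^ l)
    / (1 - c * q ^ m) * f (k + 1) (l + 1) (m + 1) n.
Proof. by move=> Cf k l m n; case: (Cf k l m n). Qed.

Lemma contiguityB a b c x f : contiguous q a b c x f -> forall k l m n : int,
  f k (l + 1) m n = f k l m n + b * q ^ l * (x * q ^ n) * (1 - a * q ^ k)
    / (1 - c * q ^ m) * f (k + 1) (l + 1) (m + 1) n.
Proof. by move=> Cf k l m n; case: (Cf k l m n). Qed.

Lemma contiguityC a b c x f : contiguous q a b c x f -> forall k l m n : int,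
  f k l m n = f k l (m + 1) n
    + c * q ^ m * (x * q ^ n) * (1 - a * q ^ k) * (1 - b * q ^ l)
      / ((1 - c * q ^ m) * (1 - c * q ^ m * q)) * f (k + 1) (l + 1) (m + 2) n.
Proof. by move=> Cf k l m n; case: (Cf k l m n). Qed.

Lemma contiguityX a b c x f : contiguous q a b c x f -> forall k l m n : int,
  f k l m (n + 1) = f k l m n - x * q ^ n * (1 - a * q ^ k) * (1 - b * q ^ l)
    / (1 - c * q ^ m) * f (k + 1) (l + 1) (m + 1) n.
Proof. by move=> Cf k l m n; case: (Cf k l m n). Qed.

Section Heine.
Variables (a b c x : K) (h : int -> int -> int -> int -> K).
Hypothesis a0 : a != 0.
Hypotheses (ND : q_generic q a b c x) (ND' : q_generic q x (c / a) (b * x) a).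
Hypothesis Ch : contiguous q x (c / a) (b * x) a h.

(** The contiguous relations for F h at the origin, with the ratios of F
    written out. Here h is taken at the indices (n, m - k, l + n, k), the
    action of sigma1 on shifts. *)
Lemma heine_origin :
  [/\ (1 - a)^-1 * h 0 (-1) 0 1 = h 0 0 0 0
        + a * x * (1 - b) / (1 - c) * ((1 - c) / ((1 - a) * (1 - b * x)) * h 0 0 1 1),
      (1 - b * x)^-1 * h 0 0 1 0 = h 0 0 0 0
        + b * x * (1 - a) / (1 - c) * ((1 - c) / ((1 - a) * (1 - b * x)) * h 0 0 1 1),
      h 0 0 0 0 = (1 - c) * h 0 1 0 0 + c * x * (1 - a) * (1 - b)
         / ((1 - c) * (1 - c * q))
         * ((1 - c) * (1 - c * q) / ((1 - a) * (1 - b * x)) * h 0 1 1 1)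
    & (1 - x) / (1 - b * x) * h 1 0 1 0 = h 0 0 0 0
        - x * (1 - a) * (1 - b) / (1 - c)
         * ((1 - c) / ((1 - a) * (1 - b * x)) * h 0 0 1 1)].
Proof.
have [na0 _ nc0 _ _] := q_generic_neq0 0 ND.
have [_ _ nc1 _ _] := q_generic_neq0 1 ND.
have [_ _ nbx0 _ _] := q_generic_neq0 0 ND'.
have [_ _ nbx1 _ _] := q_generic_neq0 1 ND'.
rewrite !(expr0z, expr1z, exprN1, mulr1) in na0 nc0 nc1 nbx0 nbx1.
instance (contiguityA Ch) at (-1) (-1) 0 0 as A1.
instance (contiguityB Ch) at 0 (-1) 0 0 as B1.
instance (contiguityX Ch) at 0 (-1) 0 0 as X1.
instance (contiguityA Ch) at 0 0 1 0 as A2.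
instance (contiguityX Ch) at 0 0 1 0 as X2.
instance (contiguity_e2_at ND' Ch) at (-1) (-1) 0 0 as e1.
instance (contiguityA Ch) at (-1) 0 0 0 as A3.
instance (contiguityB Ch) at 0 0 0 0 as B2.
instance (contiguityA Ch) at 0 1 1 0 as A4.
instance (contiguityX Ch) at 0 1 1 0 as X3.
instance (contiguity_e2_at ND' Ch) at (-1) 0 0 0 as e2.
split.
- by rewrite X1 B1 A1 X2 A2 e1; field; rewrite q0 a0 na0 nc0 nbx0 nbx1.
- by rewrite B1 A1 X2 A2 e1; field; rewrite q0 a0 na0 nc0 nbx0 nbx1.
- by rewrite X3 B2 A3 A4 e2; field; rewrite q0 a0 na0 nc0 nc1 nbx0 nbx1.
- by rewrite B1 A1 X2 A2 e1; field; rewrite q0 a0 na0 nc0 nbx0 nbx1.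
Qed.
End Heine.

Section Inversion.
Variables (a b c x : K) (h : int -> int -> int -> int -> K).
Hypotheses (x0 : x != 0) (a0 : a != 0) (b0 : b != 0) (c0 : c != 0).
Hypotheses (ND : q_generic q a b c x)
  (ND' : q_generic q (q / a) (q / b) (q ^+ 2 / c) (a * b * x / c)).
Hypothesis Ch : contiguous q (q / a) (q / b) (q ^+ 2 / c) (a * b * x / c) h.

Let d := c - a * b * x.
Let ra := (c - a * q) / ((1 - a) * d).
Let rb := (c - b * q) / ((1 - b) * d).
Let rc := - (1 - c) * (q - c) * (c * q - a * b * x) / (q * x * (c - a) * (c - b)).
Let rx := q * (1 - x) / d.
Let re := - (1 - c) * (q - c) / (x * (1 - a) * (1 - b) * d).
Let rce := (1 - c) ^+ 2 * (1 - c * q) * (q - c)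
  / ((c - a) * (c - b) * (1 - a) * (1 - b) * x ^+ 2).

(** The analogue of [heine_origin] for the indices
    (-k, -l, -m, k + l - m + n) of sigma2; ra, rb, rc, rx, re, rce are the
    ratios of F between the points that occur. *)
Lemma inversion_origin :
  [/\ ra * h (-1) 0 0 1 = h 0 0 0 0
        + a * x * (1 - b) / (1 - c) * (re * h (-1) (-1) (-1) 1),
      rb * h 0 (-1) 0 1 = h 0 0 0 0
        + b * x * (1 - a) / (1 - c) * (re * h (-1) (-1) (-1) 1),
      h 0 0 0 0 = rc * h 0 0 (-1) (-1) + c * x * (1 - a) * (1 - b)
         / ((1 - c) * (1 - c * q)) * (rce * h (-1) (-1) (-2) 0)
    & rx * h 0 0 0 1 = h 0 0 0 0
        - x * (1 - a) * (1 - b) / (1 - c) * (re * h (-1) (-1) (-1) 1)].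
Proof.
have [na0 nb0 nc0 nx0 [nca ncb ncabx _]] := q_generic_neq0 0 ND.
have [_ _ nc1 _ [nca1 ncb1 _ _]] := q_generic_neq0 1 ND.
have [_ _ mc1 _ _] := q_generic_neq0 (-1) ND.
have [_ _ mc2 _ _] := q_generic_neq0 (-2) ND.
rewrite !(expr0z, expr1z, exprN1, mulr1) in na0 nb0 nc0 nx0 nca ncb ncabx nc1 nca1 ncb1 mc1.
have cq : c - q != 0.
  by rewrite (_ : _ - _ = - (1 - c / q) * q) ?mulf_neq0 ?oppr_eq0//; field.
have cqq : c - q ^+ 2 != 0.
  rewrite exprN2z in mc2; rewrite (_ : _ - _ = - (1 - c / (q * q)) * (q * q)).
    by rewrite !mulf_neq0 ?oppr_eq0.
  by field.
have cqq' : c - q * q != 0 by rewrite -expr2.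
have nc0' : c - 1 != 0 by rewrite -opprB oppr_eq0.
instance (contiguityA Ch) at (-1) 0 0 0 as A1.
instance (contiguityX Ch) at (-1) 0 0 0 as X1.
instance (contiguityX Ch) at (-1) (-1) (-1) 0 as X2.
instance (contiguityA Ch) at (-2) (-1) (-1) 0 as A2.
instance (contiguity_e2_at ND' Ch) at (-2) (-1) (-1) 0 as e1.
instance (contiguityB Ch) at 0 (-1) 0 0 as B1.
instance (contiguityX Ch) at 0 (-1) 0 0 as X3.
instance (contiguityB Ch) at (-1) (-2) (-1) 0 as B2.
instance (contiguity_e2_at ND' Ch) at (-1) (-2) (-1) 0 as e2.
instance (contiguityX Ch) at 0 0 0 0 as X4.
instance (contiguity_e2_at ND' Ch) at (-1) (-1) (-1) 0 as e3.
instance (contiguityX Ch) at (-1) (-1) (-2) (-1) as X5.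
instance (contiguityC Ch) at 0 0 (-1) (-1) as C1.
instance (contiguityC Ch) at (-1) (-1) (-2) (-1) as C2.
instance (contiguityX Ch) at 0 0 0 (-1) as X6.
instance (contiguity_e2_at ND' Ch) at (-1) (-1) (-1) (-1) as e4.
split.
- rewrite X1 X2 A2 A1 e1 /ra /re /d; field.
  by rewrite c0 cqq b0 q0 a0 cq ncabx nb0 na0 x0 nc0.
- rewrite X3 X2 B2 B1 e2 /rb /re /d; field.
  by rewrite c0 cqq b0 q0 a0 cq ncabx nb0 na0 x0 nc0.
- rewrite X5 C2 C1 X6 e4 /rc /rce; field.
  by rewrite q0 c0 cqq' cq b0 a0 nc0' x0 nb0 na0 ncb nca nc1 nc0.
- rewrite X4 X2 e3 /rx /re /d; field.
  by rewrite q0 c0 cq b0 a0 cqq' ncabx nb0 na0 x0 nc0.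
Qed.
End Inversion.

(** Only the ratios of F at neighbouring points enter the relations, so that
    translation to the origin reduces them to [heine_origin]. *)
Lemma contiguous_heine a b c x F h : x != 0 -> a != 0 ->
  q_generic q a b c x -> q_generic q x (c / a) (b * x) a ->
  (forall k l m n : int, let a' := a * q ^ k in let b' := b * q ^ l in
     let c' := c * q ^ m in let x' := x * q ^ n in
   [/\ F (k + 1) l m n = (1 - a')^-1 * F k l m n,
       F k (l + 1) m n = (1 - b' * x')^-1 * F k l m n,
       F k l (m + 1) n = (1 - c') * F k l m n &
       F k l m (n + 1) = (1 - x') / (1 - b' * x') * F k l m n]) ->
  contiguous q x (c / a) (b * x) a h ->
  contiguous q a b c x (fun k l m n => F k l m n * h n (m - k) (l + n) k).
Proof.
move=> x0 a0 ND ND' HF Ch k l m n /=.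
have e1 : c / a * q ^ (m - k) = (c * q ^ m) / (a * q ^ k).
  by rewrite expfzDr// -invr_expz; field; rewrite a0 expfz_neq0.
have e2 : b * x * q ^ (l + n) = b * q ^ l * (x * q ^ n).
  by rewrite expfzDr//; ring.
have := q_generic_shift q0 n (m - k) (l + n) k ND'; rewrite e1 e2 => NDs'.
have := contiguous_shift q0 n (m - k) (l + n) k Ch; rewrite e1 e2 => Chs.
have := heine_origin (mulf_neq0 a0 (expfz_neq0 k q0))
  (q_generic_shift q0 k l m n ND) NDs' Chs.
have i1 : m - (k + 1) = m - k - 1 by ring.
have i2 : m + 1 - k = m - k + 1 by ring.
have i3 : m + 1 - (k + 1) = m - k by ring.
have i4 : m + 2 - (k + 1) = m - k + 1 by ring.
have i5 : l + (n + 1) = l + n + 1 by ring.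
have i6 : l + 1 + n = l + n + 1 by ring.
have i7 : m + 2 = m + 1 + 1 by ring.
rewrite /= !addr0 i1 i2 i3 i4 i5 i6 i7.
have [-> -> Fm ->] := HF k l m n; have [_ _ _ _] := HF k l m n.
have [_ Fkl _ _] := HF (k + 1) l m n.
have [_ _ Fklm _] := HF (k + 1) (l + 1) m n.
have [_ _ Fklmm _] := HF (k + 1) (l + 1) (m + 1) n.
have [Fk _ _ _] := HF k l m n.
have qm : c * q ^ (m + 1) = c * q ^ m * q by rewrite expfzDr// mulrA.
rewrite Fklmm Fklm Fkl Fk Fm qm.
move: (F k l m n) => y [E1 E2 E3 E4]; split.
- by rewrite mulrAC E1 !invfM; ring.
- by rewrite mulrAC E2 !invfM; ring.
- by rewrite {1}E3 !invfM; ring.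
- by rewrite mulrAC E4 !invfM; ring.
Qed.

(** As in [contiguous_heine], by reduction to [inversion_origin]. *)
Lemma contiguous_inversion a b c x F h :
  x != 0 -> a != 0 -> b != 0 -> c != 0 -> q_generic q a b c x ->
  q_generic q (q / a) (q / b) (q ^+ 2 / c) (a * b * x / c) ->
  (forall k l m n : int, let a' := a * q ^ k in let b' := b * q ^ l in
     let c' := c * q ^ m in let x' := x * q ^ n in let d := c' - a' * b' * x' in
   [/\ F (k + 1) l m n = (c' - a' * q) / ((1 - a') * d) * F k l m n,
       F k (l + 1) m n = (c' - b' * q) / ((1 - b') * d) * F k l m n,
       F k l (m + 1) n = - (1 - c') * (q - c') * (c' * q - a' * b' * x')
         / (q * x' * (c' - a') * (c' - b')) * F k l m n &
       F k l m (n + 1) = q * (1 - x') / d * F k l m n]) ->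
  contiguous q (q / a) (q / b) (q ^+ 2 / c) (a * b * x / c) h ->
  contiguous q a b c x (fun k l m n => F k l m n * h (- k) (- l) (- m) (k + l - m + n)).
Proof.
move=> x0 a0 b0 c0 ND ND' HF Ch k l m n /=.
have qi i : q ^ i != 0 by rewrite expfz_neq0.
have e1 : q / a * q ^ (- k) = q / (a * q ^ k).
  by rewrite -invr_expz; field; rewrite a0 qi.
have e2 : q / b * q ^ (- l) = q / (b * q ^ l).
  by rewrite -invr_expz; field; rewrite b0 qi.
have e3 : q ^+ 2 / c * q ^ (- m) = q ^+ 2 / (c * q ^ m).
  by rewrite -invr_expz; field; rewrite c0 qi.
have e4 : a * b * x / c * q ^ (k + l - m + n) =
   (a * q ^ k) * (b * q ^ l) * (x * q ^ n) / (c * q ^ m).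
  by rewrite !expfzDr// -invr_expz; field; rewrite c0 qi.
have := q_generic_shift q0 (- k) (- l) (- m) (k + l - m + n) ND'.
rewrite e1 e2 e3 e4 => NDs'.
have := contiguous_shift q0 (- k) (- l) (- m) (k + l - m + n) Ch.
rewrite e1 e2 e3 e4 => Chs.
have NDs := q_generic_shift q0 k l m n ND.
have [na0 nb0 nc0 nx0 [nca ncb ncabx _]] := q_generic_neq0 0 NDs.
have [_ _ _ _ [nca1 ncb1 ncabx1 _]] := q_generic_neq0 1 NDs.
have [_ _ _ _ [_ _ ncabx2 _]] := q_generic_neq0 2 NDs.
rewrite !(expr0z, expr1z, exprN1, mulr1) in na0 nb0 nc0 nx0 nca ncb ncabx nca1 ncb1 ncabx1.
have := inversion_origin (mulf_neq0 x0 (qi n)) (mulf_neq0 a0 (qi k))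
  (mulf_neq0 b0 (qi l)) (mulf_neq0 c0 (qi m)) NDs NDs' Chs.
have i1 i : - (i + 1) = - i - 1 :> int by ring.
have i2 : k + 1 + l - m + n = k + l - m + n + 1 by ring.
have i3 : k + (l + 1) - m + n = k + l - m + n + 1 by ring.
have i4 : k + l - (m + 1) + n = k + l - m + n - 1 by ring.
have i5 : k + l - m + (n + 1) = k + l - m + n + 1 by ring.
have i6 : k + 1 + (l + 1) - (m + 1) + n = k + l - m + n + 1 by ring.
have i7 : k + 1 + (l + 1) - (m + 2) + n = k + l - m + n by ring.
have i8 : m + 2 = m + 1 + 1 by ring.
have i9 : - (m + 2) = - m - 2 by ring.
rewrite /= !addr0 i2 i3 i4 i5 i6 i7 i9 !i1 i8.
have [-> -> Fm ->] := HF k l m n.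
have [_ Fkl _ _] := HF (k + 1) l m n.
have [_ _ Fklm _] := HF (k + 1) (l + 1) m n.
have [_ _ Fklmm _] := HF (k + 1) (l + 1) (m + 1) n.
have [Fk _ _ _] := HF k l m n.
have qS y i : y * q ^ (i + 1) = y * q ^ i * q by rewrite expfzDr// mulrA.
have x0' : x * q ^ n != 0 by rewrite mulf_neq0.
rewrite !qS in Fklmm Fklm Fkl.
move: (a * _) (b * _) (c * _) (x * _) na0 nb0 nc0 nx0 nca ncb ncabx nca1 ncb1
  ncabx1 x0' Fm Fkl Fklm Fklmm Fk.
clear -q0; move=> a b c x a1 b1 c1 x1 ca cb cabx caq cbq cabxq x0 Fm Fkl Fklm Fklmm Fk.
have cabxq' : c - a * q * b * x != 0.
  by apply: contra cabxq => /eqP <-; apply/eqP; ring.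
have Fe : F (k + 1) (l + 1) (m + 1) n =
    - (1 - c) * (q - c) / (x * (1 - a) * (1 - b) * (c - a * b * x)) * F k l m n.
  rewrite Fklm Fkl Fk; field.
  by rewrite q0 x0 a1 b1 caq cbq cabx cabxq'.
have Fce : F (k + 1) (l + 1) (m + 1 + 1) n = (1 - c) ^+ 2 * (1 - c * q) * (q - c) /
    ((c - a) * (c - b) * (1 - a) * (1 - b) * x ^+ 2) * F k l m n.
  rewrite Fklmm Fe; field; rewrite q0 x0 a1 b1 cabx ca cb /=.
  by rewrite -!mulrBl !mulf_neq0.
rewrite Fce Fe Fm; move: (F k l m n) => y [E1 E2 E3 E4]; split.
- by rewrite mulrAC E1; ring.
- by rewrite mulrAC E2; ring.
- by rewrite {1}E3; ring.
- by rewrite mulrAC E4; ring.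
Qed.

End Transformations.

(** * The factors of the generators *)

Section Factors.
Variables (K : fieldType) (q : K) (q0 : q != 0).
Implicit Types (a b c x : K) (f g h F : int -> int -> int -> int -> K).

Lemma qpochS (y : K) (i : int) : (forall j : int, 1 - y * q ^ j != 0) ->
  qpoch q y (i + 1) = qpoch q y i * (1 - y * q ^ i).
Proof.
move=> y1; case: i => [n|[|n]].
- by rewrite -PoszD addn1 /= big_ord_recr.
- by rewrite /= big_ord0 big_ord1 mulVf//; exact: (y1 (-1)).
- rewrite (_ : Negz n.+1 + 1 = Negz n); last by rewrite !NegzE; ring.
  rewrite /= [in RHS]big_ord_recr /= invfM -mulrA mulVf ?mulr1//.
  exact: (y1 (Negz n.+1)).
Qed.

Lemma qpoch_neq0 (y : K) (i : int) : (forall j : int, 1 - y * q ^ j != 0) ->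
  qpoch q y i != 0.
Proof.
move=> y1; case: i => n /=; rewrite ?invr_eq0; apply/prodf_neq0 => j _.
  exact: (y1 j).
exact: (y1 (Negz j)).
Qed.

Lemma triangularS (m : int) :
  ((m + 1) * (m + 1 - 1) %/ 2)%Z = (m * (m - 1) %/ 2)%Z + m.
Proof.
rewrite (_ : (m + 1) * _ = m * 2 + m * (m - 1)); last by ring.
by rewrite divzMDl// addrC.
Qed.

Lemma qpochS_at (y z : K) (i j : int) : (forall j : int, 1 - y * q ^ j != 0) ->
  j = i + 1 -> z = 1 - y * q ^ i -> qpoch q y j = qpoch q y i * z.
Proof. by move=> y1 -> ->; exact: qpochS. Qed.

Lemma expS_at (y : K) (i j : int) : y != 0 -> j = i + 1 -> y ^ j = y ^ i * y.
Proof. by move=> y0 ->; rewrite expfzDr. Qed.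

Section Point.
Variables (a b c x : K).
Hypothesis ne0 : [&& a != 0, b != 0, c != 0 & x != 0].
Hypothesis ND : q_generic q a b c x.

Let a0 : a != 0. Proof. by case/and4P: ne0. Qed.
Let b0 : b != 0. Proof. by case/and4P: ne0. Qed.
Let c0 : c != 0. Proof. by case/and4P: ne0. Qed.
Let x0 : x != 0. Proof. by case/and4P: ne0. Qed.

Let ga j : 1 - a * q ^ j != 0. Proof. by case: (q_generic_neq0 j ND). Qed.
Let gb j : 1 - b * q ^ j != 0. Proof. by case: (q_generic_neq0 j ND). Qed.
Let gc j : 1 - c * q ^ j != 0. Proof. by case: (q_generic_neq0 j ND). Qed.
Let gx j : 1 - x * q ^ j != 0. Proof. by case: (q_generic_neq0 j ND). Qed.
Let gca j : 1 - a / c * q ^ j != 0.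
Proof.
have [_ _ _ _ [+ _ _ _]] := q_generic_neq0 j ND.
by apply: contra => /eqP h; rewrite -[c](mulr1) -[X in c * X](subrK (a / c * q ^ j)) h; apply/eqP; field.
Qed.
Let gcb j : 1 - b / c * q ^ j != 0.
Proof.
have [_ _ _ _ [_ + _ _]] := q_generic_neq0 j ND.
by apply: contra => /eqP h; rewrite -[c](mulr1) -[X in c * X](subrK (b / c * q ^ j)) h; apply/eqP; field.
Qed.
Let gabx j : 1 - a * b * x / c * q ^ j != 0.
Proof.
have [_ _ _ _ [_ _ + _]] := q_generic_neq0 j ND.
by apply: contra => /eqP h; rewrite -[c](mulr1) -[X in c * X](subrK (a * b * x / c * q ^ j)) h; apply/eqP; field.
Qed.
Let gbx j : 1 - b * x * q ^ j != 0.
Proof. by case: (q_generic_neq0 j ND) => _ _ _ _ []. Qed.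

Let shift y i : (forall j : int, 1 - y * q ^ j != 0) ->
  forall j : int, 1 - y * q ^ i * q ^ j != 0.
Proof. by move=> y1 j; rewrite -mulrA -expfzDr. Qed.

(** The ratios are the determinants in [lattice_steps]: [factor0] follows the
    Casoratian. *)
Lemma factor0_steps : let F k l m n := factor0 q (Args k l m n ne0) in
  F 0 0 0 0 = -1 /\
  (forall k l m n : int, let a' := a * q ^ k in let b' := b * q ^ l in
     let c' := c * q ^ m in let x' := x * q ^ n in let c'' := c * q ^ (m + 1) in
   [/\ F (k + 1) l m n =
         (c' - a' * q) / ((1 - a' * q) * (c' - a' * b' * q * x')) * F k l m n,
       F k (l + 1) m n =
         (c' - b' * q) / ((1 - b' * q) * (c' - a' * b' * q * x')) * F k l m n,
       F k l m n = (- (c'' - a' * q) * (c'' - b' * q) * x'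
         / ((q - c'') * (1 - c'') * (c'' - a' * b' * q * x'))) * F k l (m + 1) n &
       F k l m (n + 1) = (1 - x') / (c' - a' * b' * q * x') * F k l m n]).
Proof.
move=> F; split.
  rewrite /F /factor0 /= !big_ord0 !(mulr0, expr0z, mulr1, oppr0, invr1, addr0, mul0r).
  by [].
have qi i : q ^ i != 0 by rewrite expfz_neq0.
have gcq : forall j : int, 1 - c * q * q ^ j != 0 by exact: (@shift c 1 gc).
have gaq : forall j : int, 1 - a * q * q ^ j != 0 by exact: (@shift a 1 ga).
have gbq : forall j : int, 1 - b * q * q ^ j != 0 by exact: (@shift b 1 gb).
have gcaq : forall j : int, 1 - a * q / c * q ^ j != 0.
  by move=> j; have := shift 1 gca j; rewrite [a / c * _]mulrAC.
have gcbq : forall j : int, 1 - b * q / c * q ^ j != 0.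
  by move=> j; have := shift 1 gcb j; rewrite [b / c * _]mulrAC.
have gabxq : forall j : int, 1 - a * b * x * q / c * q ^ j != 0.
  by move=> j; have := shift 1 gabx j; rewrite [a * b * x / c * _]mulrAC.
move=> k l m n a' b' c' x' c''.
have qD i j : q ^ (i + j) = q ^ i * q ^ j by rewrite expfzDr.
have qB i j : q ^ (i - j) = q ^ i / q ^ j by rewrite expfzDr// invr_expz.
have Da : 1 - a * q ^ k * q != 0 by have := gaq k; rewrite mulrAC.
have Db : 1 - b * q ^ l * q != 0 by have := gbq l; rewrite mulrAC.
have D : c * q ^ m - a * q ^ k * (b * q ^ l) * q * (x * q ^ n) != 0.
  apply: contra (gabxq (k + l - m + n)) => /eqP h.
  apply/eqP; rewrite -[X in X - _](mulfV (mulf_neq0 c0 (qi m))).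
  rewrite -[X in X / _](subrK (a * q ^ k * (b * q ^ l) * q * (x * q ^ n))) h.
  by rewrite !qD -invr_expz; field; rewrite c0 qi.
have D' : c * q ^ m * q - a * q ^ k * (b * q ^ l) * q * (x * q ^ n) != 0.
  apply: contra (gabxq (k + l - m + n - 1)) => /eqP h.
  apply/eqP; rewrite -[X in X - _](mulfV (mulf_neq0 (mulf_neq0 c0 (qi m)) q0)).
  rewrite -[X in X / _](subrK (a * q ^ k * (b * q ^ l) * q * (x * q ^ n))) h.
  by rewrite !qD -invr_expz exprN1; field; rewrite c0 qi q0.
have c1 : 1 - c * q ^ m != 0 by [].
have c1q : 1 - c * q ^ m * q != 0 by have := gcq m; rewrite mulrAC.
have ca0 : c * q ^ m - a * q ^ k != 0.
  by case: (q_generic_neq0 0 (q_generic_shift q0 k l m n ND)); rewrite expr0z !mulr1 => _ _ _ _ [].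
have cabx0 : c * q ^ m - a * q ^ k * (b * q ^ l) * (x * q ^ n) != 0.
  by case: (q_generic_neq0 0 (q_generic_shift q0 k l m n ND)); rewrite expr0z !mulr1 => _ _ _ _ [].
have E3 : q - c * q ^ m * q != 0.
  by rewrite -[X in X - _]mul1r -mulrBl mulf_neq0.
have cb0 : c * q ^ m - b * q ^ l != 0.
  by case: (q_generic_neq0 0 (q_generic_shift q0 k l m n ND)); rewrite expr0z !mulr1 => _ _ _ _ [].
have cz i : c ^ i != 0 by rewrite expfz_neq0.
have xz i : x ^ i != 0 by rewrite expfz_neq0.
have Pa := qpoch_neq0 k gaq; have Pb := qpoch_neq0 l gbq.
have Pabx := qpoch_neq0 (k + l - m + n) gabxq.
have Pabx' := qpoch_neq0 (k + l - (m + 1) + n) gabxq.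
rewrite /a' /b' /c' /x' /c''; split.
- rewrite /F /factor0 (qpochS_at (i := k - m) gcaq _ erefl); last by ring.
  rewrite (qpochS_at (i := k) gaq _ erefl)//.
  rewrite (qpochS_at (i := k + l - m + n) gabxq _ erefl); last by ring.
  rewrite !qD -!invr_expz; field.
  by rewrite Pa Pb Pabx !qi cz xz D Da c0.
- rewrite /F /factor0 (qpochS_at (i := l - m) gcbq _ erefl); last by ring.
  rewrite (qpochS_at (i := l) gbq _ erefl)//.
  rewrite (qpochS_at (i := k + l - m + n) gabxq _ erefl); last by ring.
  rewrite !qD -!invr_expz; field.
  by rewrite Pa Pb Pabx !qi cz xz D Db c0.
- rewrite /F /factor0 (qpochS_at (i := m) (j := m + 1) gc _ erefl)//.
  rewrite (qpochS_at (i := m) (j := m + 1) gcq _ erefl)//.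
  rewrite (qpochS_at (i := k - (m + 1)) (j := k - m) gcaq _ erefl); last by ring.
  rewrite (qpochS_at (i := l - (m + 1)) (j := l - m) gcbq _ erefl); last by ring.
  rewrite (qpochS_at (i := k + l - (m + 1) + n) (j := k + l - m + n) gabxq _ erefl); last by ring.
  rewrite triangularS (_ : (m + 1) * n = m * n + n); last by ring.
  rewrite (expS_at (i := m + n) (j := m + 1 + n) c0); last by ring.
  rewrite (_ : - (m + 1) = - m - 1); last by ring.
  rewrite (@expfzDr _ x _ _ x0) (@expfzDr _ (-1) (m + 1)) ?oppr_eq0 ?oner_neq0//.
  rewrite !qD -!invr_expz ?exprN1 ?expr1z ?opprD ?qD ?exprN1; field.
  have D2 := D'; rewrite !mulrA in D2.
  rewrite -opprD Pabx' Pa Pb c0 !cz !qi x0 xz q0 !mulrA D2 c1q E3 /=.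
  rewrite (_ : _ - _ = c * q ^ m - a * q ^ k * (b * q ^ l) * (x * q ^ n)) ?cabx0//.
  by ring.
- rewrite /F /factor0 (qpochS_at (i := n) (j := n + 1) gx _ erefl)//.
  rewrite (qpochS_at (i := k + l - m + n) gabxq _ erefl); last by ring.
  rewrite (_ : m * (n + 1) = m * n + m); last by ring.
  rewrite (expS_at (i := m + n) (j := m + (n + 1)) c0); last by ring.
  rewrite !qD -!invr_expz; field.
  by rewrite Pabx Pb Pa !cz !qi xz D c0.
Qed.

Let qi i : q ^ i != 0. Proof. by rewrite expfz_neq0. Qed.
Let qD i j : q ^ (i + j) = q ^ i * q ^ j. Proof. by rewrite expfzDr. Qed.

Let qp0 (y : K) : qpoch q y 0 = 1. Proof. by rewrite /= big_ord0. Qed.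
Let qpN1 (y : K) : qpoch q y (-1) = (1 - y / q)^-1.
Proof. by rewrite /= big_ord1 expr1. Qed.
Let qp2 (y : K) : qpoch q y 2 = (1 - y) * (1 - y * q).
Proof. by rewrite /= !big_ord_recl big_ord0 expr0 !mulr1. Qed.

(** The value at (1, 1, 1, 0) fixes the normalisation, and the ratios are those
    assumed in [contiguous_heine]. *)
Lemma factor1_steps : let F k l m n := factor1 q (Args k l m n ne0) in
  F 1 1 1 0 = (1 - b) * (c - a * b * x) / ((c - a) * (c - b) * (1 - x)) /\
  (forall k l m n : int, let a' := a * q ^ k in let b' := b * q ^ l in
     let c' := c * q ^ m in let x' := x * q ^ n in
   [/\ F (k + 1) l m n = (1 - a')^-1 * F k l m n,
       F k (l + 1) m n = (1 - b' * x')^-1 * F k l m n,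
       F k l (m + 1) n = (1 - c') * F k l m n &
       F k l m (n + 1) = (1 - x') / (1 - b' * x') * F k l m n]).
Proof.
move=> F; split.
  rewrite /F /factor1 addr0 subrr sub0r !qp0 qpN1 mulfK// !mulr1 divr1 mul1r.
  by rewrite !invfM; ring.
have gcq : forall j : int, 1 - c * q * q ^ j != 0 by exact: (@shift c 1 gc).
have gaq : forall j : int, 1 - a * q * q ^ j != 0 by exact: (@shift a 1 ga).
have gxq : forall j : int, 1 - x * q * q ^ j != 0 by exact: (@shift x 1 gx).
have gbxq : forall j : int, 1 - b * x * q * q ^ j != 0.
  by exact: (@shift (b * x) 1 gbx).
move=> k l m n a' b' c' x'; rewrite /a' /b' /c' /x'.
have pred y i : y * q ^ i = y * q * q ^ (i - 1).
  by rewrite qD exprN1; field.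
split.
- rewrite /F /factor1 (qpochS_at (i := k - 1) (j := k + 1 - 1) gaq _ erefl); last by ring.
  by rewrite -pred !invfM; ring.
- rewrite /F /factor1 (qpochS_at (i := l + n - 1) (j := l + 1 + n - 1) gbxq _ erefl); last by ring.
  rewrite -pred qD (_ : b * x * (q ^ l * q ^ n) = b * q ^ l * (x * q ^ n)); last by ring.
  by rewrite !invfM; ring.
- rewrite /F /factor1 (qpochS_at (i := m - 1) (j := m + 1 - 1) gcq _ erefl); last by ring.
  by rewrite -pred; ring.
- rewrite /F /factor1 (qpochS_at (i := n - 1) (j := n + 1 - 1) gxq _ erefl); last by ring.
  rewrite (qpochS_at (i := l + n - 1) (j := l + (n + 1) - 1) gbxq _ erefl); last by ring.
  rewrite -!pred qD (_ : b * x * (q ^ l * q ^ n) = b * q ^ l * (x * q ^ n)); last by ring.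
  by rewrite !invfM; ring.
Qed.

(** The ratios are those assumed in [contiguous_inversion]. *)
Lemma factor2_steps : let F k l m n := factor2 q (Args k l m n ne0) in
  F 1 1 1 0 = (1 - c / q ^+ 2) * (1 - c / q)
     / ((1 - a / q) * (1 - b / q) * (1 - x) * x) /\
  (forall k l m n : int, let a' := a * q ^ k in let b' := b * q ^ l in
     let c' := c * q ^ m in let x' := x * q ^ n in let d := c' - a' * b' * x' in
   [/\ F (k + 1) l m n = (c' - a' * q) / ((1 - a') * d) * F k l m n,
       F k (l + 1) m n = (c' - b' * q) / ((1 - b') * d) * F k l m n,
       F k l (m + 1) n = - (1 - c') * (q - c') * (c' * q - a' * b' * x')
         / (q * x' * (c' - a') * (c' - b')) * F k l m n &
       F k l m (n + 1) = q * (1 - x') / d * F k l m n]).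
Proof.
move=> F; split.
  rewrite /F /factor2.
  have -> : ((1 * (1 - 1) %/ 2)%Z + (1 - 1) * (0 - 1) = 0 :> int) by [].
  rewrite addr0 subrr sub0r !qp0 qpN1 !qp2 mulfK// mul1r !expr0z exprN1.
  rewrite (_ : (-1 : K) ^ (1 + 1) = 1) ?divfK//; last first.
    by rewrite -[LHS]/((-1) ^+ 2) sqrrN expr1n.
  have a1 : 1 - a != 0 by have := ga 0; rewrite expr0z mulr1.
  have b1 : 1 - b != 0 by have := gb 0; rewrite expr0z mulr1.
  have x1 : 1 - x != 0 by have := gx 0; rewrite expr0z mulr1.
  have aq : q - a != 0.
    have := ga (-1); rewrite exprN1; apply: contra => /eqP h.
    by rewrite -[a](subKr q) h subr0 mulfV// subrr.
  have bq : q - b != 0.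
    have := gb (-1); rewrite exprN1; apply: contra => /eqP h.
    by rewrite -[b](subKr q) h subr0 mulfV// subrr.
  by field; rewrite x0 x1 b1 a1 bq aq q0.
have gcq : forall j : int, 1 - c * q * q ^ j != 0 by exact: (@shift c 1 gc).
have gxq : forall j : int, 1 - x * q * q ^ j != 0 by exact: (@shift x 1 gx).
have gcqq : forall j : int, 1 - c / q ^+ 2 * q ^ j != 0 by exact: (@shift c (-2) gc).
have gaq : forall j : int, 1 - a / q * q ^ j != 0.
  by move=> j; have := @shift a (-1) ga j; rewrite exprN1.
have gbq : forall j : int, 1 - b / q * q ^ j != 0.
  by move=> j; have := @shift b (-1) gb j; rewrite exprN1.
have gcaq : forall j : int, 1 - a * q / c * q ^ j != 0.
  by move=> j; have := shift 1 gca j; rewrite [a / c * _]mulrAC.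
have gcbq : forall j : int, 1 - b * q / c * q ^ j != 0.
  by move=> j; have := shift 1 gcb j; rewrite [b / c * _]mulrAC.
have gabxq : forall j : int, 1 - a * b * x * q / c * q ^ j != 0.
  by move=> j; have := shift 1 gabx j; rewrite [a * b * x / c * _]mulrAC.
move=> k l m n a' b' c' x' d; rewrite /d /a' /b' /c' /x'.
have NDs := q_generic_neq0 0 (q_generic_shift q0 k l m n ND).
rewrite expr0z !mulr1 in NDs.
have [a1 b1 c1 x1 [ca cb cabx _]] := NDs.
have := q_generic_neq0 (-1) (q_generic_shift q0 k l m n ND).
rewrite exprN1 => -[_ _ cN _ [_ _ cabxN _]].
have cz i : c ^ i != 0 by rewrite expfz_neq0.
have xz i : x ^ i != 0 by rewrite expfz_neq0.
have Pa := qpoch_neq0 (k + 1) gaq; have Pb := qpoch_neq0 (l + 1) gbq.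
have Pabx := qpoch_neq0 (k + l - m + n - 1) gabxq.
have Pabx' := qpoch_neq0 (k + l - (m + 1) + n - 1) gabxq.
split.
- rewrite /F /factor2.
  rewrite (qpochS_at (i := k - m) (j := k + 1 - m) gcaq _ erefl); last by ring.
  rewrite (qpochS_at (i := k + 1) (j := k + 1 + 1) gaq _ erefl)//.
  rewrite (qpochS_at (i := k + l - m + n - 1) (j := k + 1 + l - m + n - 1) gabxq _ erefl); last by ring.
  rewrite (_ : a / q * q ^ (k + 1) = a * q ^ k); last by rewrite qD expr1z; field.
  rewrite (_ : a * b * x * q / c * _ = (a * q ^ k) * (b * q ^ l) * (x * q ^ n) / (c * q ^ m)); last first.
    by rewrite !qD -invr_expz exprN1; field; rewrite qi c0 q0.
  rewrite (_ : a * q / c * _ = (a * q ^ k) * q / (c * q ^ m)); last first.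
    by rewrite !qD -invr_expz; field; rewrite qi c0.
  rewrite -!invr_expz; field.
  by rewrite xz Pabx Pb Pa cz !qi cabx a1 c0.
- rewrite /F /factor2.
  rewrite (qpochS_at (i := l - m) (j := l + 1 - m) gcbq _ erefl); last by ring.
  rewrite (qpochS_at (i := l + 1) (j := l + 1 + 1) gbq _ erefl)//.
  rewrite (qpochS_at (i := k + l - m + n - 1) (j := k + (l + 1) - m + n - 1) gabxq _ erefl); last by ring.
  rewrite (_ : b / q * q ^ (l + 1) = b * q ^ l); last by rewrite qD expr1z; field.
  rewrite (_ : a * b * x * q / c * _ = (a * q ^ k) * (b * q ^ l) * (x * q ^ n) / (c * q ^ m)); last first.
    by rewrite !qD -invr_expz exprN1; field; rewrite qi c0 q0.
  rewrite (_ : b * q / c * _ = (b * q ^ l) * q / (c * q ^ m)); last first.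
    by rewrite !qD -invr_expz; field; rewrite qi c0.
  rewrite -!invr_expz; field.
  by rewrite xz Pabx Pb Pa cz !qi cabx b1 c0.
- rewrite /F /factor2.
  rewrite (qpochS_at (i := k - (m + 1)) (j := k - m) gcaq _ erefl); last by ring.
  rewrite (qpochS_at (i := l - (m + 1)) (j := l - m) gcbq _ erefl); last by ring.
  rewrite (qpochS_at (i := k + l - (m + 1) + n - 1) (j := k + l - m + n - 1) gabxq _ erefl); last by ring.
  rewrite (qpochS_at (i := m - 1) (j := m + 1 - 1) gcq _ erefl); last by ring.
  rewrite (qpochS_at (i := m + 1) (j := m + 1 + 1) gcqq _ erefl); last by ring.
  rewrite triangularS (_ : (m + 1 - 1) * (n - 1) = (m - 1) * (n - 1) + n - 1); last by ring.
  rewrite (expS_at (i := m + n - 1) (j := m + 1 + n - 1) c0); last by ring.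
  rewrite (_ : - (m + 1) = - m - 1); last by ring.
  rewrite (@expfzDr _ x _ _ x0) (@expfzDr _ (-1) (m + 1)) ?oppr_eq0 ?oner_neq0//.
  rewrite (_ : a * b * x * q / c * _ = (a * q ^ k) * (b * q ^ l) * (x * q ^ n) / (c * q ^ m * q)); last first.
    by rewrite !(opprD, qD) -invr_expz exprN1; field; rewrite qi c0 q0.
  rewrite (_ : a * q / c * _ = (a * q ^ k) / (c * q ^ m)); last first.
    by rewrite !(opprD, qD) -invr_expz exprN1; field; rewrite qi c0.
  rewrite (_ : b * q / c * _ = (b * q ^ l) / (c * q ^ m)); last first.
    by rewrite !(opprD, qD) -invr_expz exprN1; field; rewrite qi c0.
  rewrite (_ : c * q * q ^ (m - 1) = c * q ^ m); last first.
    by rewrite qD exprN1; field.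
  rewrite (_ : c / q ^+ 2 * q ^ (m + 1) = c * q ^ m / q); last first.
    by rewrite qD expr1z; field.
  rewrite !qD -!invr_expz ?exprN1 ?expr1z; field.
  rewrite -opprD xz q0 !qi c0 Pabx' Pb Pa !cz x0 ca cb /=.
  rewrite (_ : _ - _ = (c * q ^ m - a * q ^ k * (b * q ^ l) * (x * q ^ n) / q) * q).
    by rewrite !mulf_neq0.
  by field.
- rewrite /F /factor2.
  rewrite (qpochS_at (i := k + l - m + n - 1) (j := k + l - m + (n + 1) - 1) gabxq _ erefl); last by ring.
  rewrite (qpochS_at (i := n - 1) (j := n + 1 - 1) gxq _ erefl); last by ring.
  rewrite (_ : (m - 1) * (n + 1 - 1) = (m - 1) * (n - 1) + (m - 1)); last by ring.
  rewrite (expS_at (i := m + n - 1) (j := m + (n + 1) - 1) c0); last by ring.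
  rewrite (_ : a * b * x * q / c * _ = (a * q ^ k) * (b * q ^ l) * (x * q ^ n) / (c * q ^ m)); last first.
    by rewrite !qD -invr_expz exprN1; field; rewrite qi c0 q0.
  rewrite (_ : x * q * q ^ (n - 1) = x * q ^ n); last first.
    by rewrite qD exprN1; field.
  rewrite !qD -!invr_expz ?exprN1 ?expr1z; field.
  by rewrite xz Pabx Pb Pa cz !qi cabx c0 q0.
Qed.

Let shifted_factors_neq0 :
  [/\ forall j : int, 1 - c * q * q ^ j != 0, forall j : int, 1 - a * q * q ^ j != 0,
      forall j : int, 1 - b * q * q ^ j != 0, forall j : int, 1 - x * q * q ^ j != 0 &
  [/\ forall j : int, 1 - a * q / c * q ^ j != 0,
      forall j : int, 1 - b * q / c * q ^ j != 0,
      forall j : int, 1 - a * b * x * q / c * q ^ j != 0,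
      forall j : int, 1 - c / q ^+ 2 * q ^ j != 0 &
  [/\ forall j : int, 1 - a / q * q ^ j != 0,
      forall j : int, 1 - b / q * q ^ j != 0 &
      forall j : int, 1 - b * x * q * q ^ j != 0]]].
Proof.
split; [exact: (@shift c 1 gc) | exact: (@shift a 1 ga) | exact: (@shift b 1 gb) |
  exact: (@shift x 1 gx) | split; last split].
- by move=> j; have := shift 1 gca j; rewrite [a / c * _]mulrAC.
- by move=> j; have := shift 1 gcb j; rewrite [b / c * _]mulrAC.
- by move=> j; have := shift 1 gabx j; rewrite [a * b * x / c * _]mulrAC.
- exact: (@shift c (-2) gc).
- by move=> j; have := @shift a (-1) ga j; rewrite exprN1.
- by move=> j; have := @shift b (-1) gb j; rewrite exprN1.
- exact: (@shift (b * x) 1 gbx).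
Qed.

(** Needed to pass from the identity for a map to the identity for its
    inverse. *)
Lemma factors_neq0 (k l m n : int) : [/\ factor0 q (Args k l m n ne0) != 0,
  factor1 q (Args k l m n ne0) != 0 & factor2 q (Args k l m n ne0) != 0].
Proof.
have [gcq gaq gbq gxq [gcaq gcbq gabxq gcqq [gaq' gbq' gbxq]]] := shifted_factors_neq0.
have N1 i : (-1 : K) ^ i != 0 by rewrite expfz_neq0 ?oppr_eq0 ?oner_neq0.
have [a1 b1 _ _ [ca cb cabx _]] := q_generic_neq0 0 ND.
rewrite !expr0z !mulr1 in a1 b1 ca cb cabx.
rewrite /factor0 /factor1 /factor2.
by split; rewrite !(mulf_eq0, invr_eq0, negb_or) ?a1 ?b1 ?ca ?cb ?cabx
  ?N1 ?qi ?(expfz_neq0 _ c0) ?(expfz_neq0 _ x0) !qpoch_neq0.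
Qed.

End Point.

Lemma subr_neq0_div (y z : K) : z != 0 -> 1 - y / z != 0 -> z - y != 0.
Proof.
by move=> z0; apply: contra; rewrite subr_eq0 => /eqP <-; rewrite mulfV// subrr.
Qed.

(** (0, 0, 1, 1) is the image of (1, 1, 1, 0) under the index map of sigma1, so
    this value normalises the transformed solution. *)
Lemma heine_value a b c x f : x != 0 -> q_generic q a b c x ->
  contiguous q a b c x f -> f 0 0 0 0 = 0 -> f 1 1 1 0 = 1 ->
  f 0 0 1 1 = (1 - a) * (1 - b) * (c - a * b * x) / ((c - a) * (c - b)).
Proof.
move=> x0 ND Cf f0 f1.
instance (contiguityC Cf) at 0 0 0 0 as C1.
instance (contiguityC Cf) at 1 1 1 0 as C2.
instance (contiguity_e2_at q0 ND Cf) at 0 0 1 0 as e1.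
instance (contiguityX Cf) at 0 0 1 0 as X1.
have [_ _ c1 _ [ca cb cabx _]] := q_generic_neq0 0 ND.
have [_ _ c1q _ _] := q_generic_neq0 1 ND.
have [_ _ c1qq _ _] := q_generic_neq0 2 ND.
rewrite !(expr0z, expr1z, mulr1) in c1 c1q ca cb cabx.
have {}c1qq : 1 - c * q * q != 0 by rewrite -mulrA.
rewrite f0 in C1; rewrite f1 in C2.
set y1 := f 0 0 1 0 in C1 e1 X1; set y2 := f 1 1 2 0 in C1 C2 e1 X1.
set y3 := f 2 2 3 0 in C2 e1.
have y1E : y1 = - (c * x * (1 - a) * (1 - b) / ((1 - c) * (1 - c * q)) * y2).
  by apply/eqP; rewrite -addr_eq0 -C1.
have y3E : x * (1 - a * q) * (1 - b * q) * (c * q - a * b * q * x) /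
    ((1 - c * q) * (1 - c * q * q)) * y3 =
    y1 + (a * x * (1 - b) / (1 - c * q) + b * x * (1 - a * q) / (1 - c * q) - 1) * y2.
  by rewrite e1; ring.
have : (c - a * b * x) * 1 = - (c - a) * (c - b) * x / ((1 - c) * (1 - c * q)) * y2.
  rewrite [in LHS]C2 mulrDr [X in _ + X](_ : _ = c * (x * (1 - a * q) * (1 - b * q) * (c * q - a * b * q * x) /
    ((1 - c * q) * (1 - c * q * q)) * y3)); last by field; rewrite c1q c1qq.
  by rewrite y3E y1E; field; rewrite c1 c1q.
rewrite mulr1 X1 y1E => ->; field.
by rewrite c1 c1q ca cb.
Qed.

(** (-1, -1, -1, 1) is the image of (1, 1, 1, 0) under the index map of
    sigma2. *)
Lemma inversion_value a b c x f : q_generic q a b c x ->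
  contiguous q a b c x f -> f 0 0 0 0 = 0 -> f 1 1 1 0 = 1 ->
  f (-1) (-1) (-1) 1 = x * (1 - a) * (1 - b) * (c / q - a * b * x / q)
      / ((1 - c / q) * (1 - c)).
Proof.
move=> ND Cf f0 f1.
instance (contiguity_e2_at q0 ND Cf) at (-1) (-1) (-1) 0 as e1.
instance (contiguityX Cf) at (-1) (-1) (-1) 0 as X1.
have [_ _ c1 _ _] := q_generic_neq0 0 ND.
have [_ _ cN _ _] := q_generic_neq0 (-1) ND.
rewrite !(expr0z, exprN1, mulr1) in c1 cN.
have cq : q - c != 0 by rewrite (_ : _ - _ = (1 - c / q) * q) ?mulf_neq0//; field.
rewrite X1 e1 f0 f1; field.
by rewrite c1 cq q0.
Qed.

Section Identities.
Variables (a b c x : K) (f h : int -> int -> int -> int -> K).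
Hypothesis ne0 : [&& a != 0, b != 0, c != 0 & x != 0].
Hypotheses (ND : q_generic q a b c x) (Cf : contiguous q a b c x f).
Hypotheses (f0 : f 0 0 0 0 = 0) (f1 : f 1 1 1 0 = 1).
Hypotheses (h0 : h 0 0 0 0 = 0) (h1 : h 1 1 1 0 = 1).

Lemma identity0 k l m n :
  contiguous q (a * q ^ k) (b * q ^ l) (c * q ^ m) (x * q ^ n) h ->
  f k l m n = factor0 q (Args k l m n ne0) * h (- k) (- l) (- m) (- n).
Proof.
move=> Ch; have [F0 HF] := factor0_steps ne0 ND.
have /and4P[_ _ _ x0] := ne0.
exact: (reflection_identity q0 ND x0 Cf f0 f1 Ch h0 h1 F0 HF).
Qed.

Lemma identity1 k l m n : q_generic q x (c / a) (b * x) a ->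
  contiguous q x (c / a) (b * x) a h ->
  f k l m n = factor1 q (Args k l m n ne0) * h n (m - k) (l + n) k.
Proof.
move=> ND' Ch; have [F1 HF] := factor1_steps ne0 ND.
have /and4P[a0 b0 c0 x0] := ne0.
move: k l m n; apply: (contiguous_unique q0 ND x0 Cf) => //.
- exact: (contiguous_heine q0 x0 a0 ND ND' HF Ch).
- by rewrite h0 mulr0.
rewrite F1 subrr addr0 (heine_value a0 ND' Ch h0 h1).
have [a1 b1 _ x1 [ca cb cabx _]] := q_generic_neq0 0 ND.
rewrite !(expr0z, mulr1) in a1 b1 x1 ca cb cabx.
field.
rewrite a0 x1 ca cb (_ : b * x - x = - (1 - b) * x) ?mulf_neq0 ?oppr_eq0//=; last by ring.
by rewrite (_ : _ - _ = - (c - a * b * x)) ?oppr_eq0 ?cabx//; ring.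
Qed.

Lemma identity2 k l m n :
  q_generic q (q / a) (q / b) (q ^+ 2 / c) (a * b * x / c) ->
  contiguous q (q / a) (q / b) (q ^+ 2 / c) (a * b * x / c) h ->
  f k l m n = factor2 q (Args k l m n ne0)
    * h (- k) (- l) (- m) (k + l - m + n).
Proof.
move=> ND' Ch; have [F2 HF] := factor2_steps ne0 ND.
have /and4P[a0 b0 c0 x0] := ne0.
move: k l m n; apply: (contiguous_unique q0 ND x0 Cf) => //.
- exact: (contiguous_inversion q0 x0 a0 b0 c0 ND ND' HF Ch).
- by rewrite !(oppr0, addr0) h0 mulr0.
rewrite F2 addrK addr0 (inversion_value ND' Ch h0 h1).
have [_ _ _ x1 _] := q_generic_neq0 0 ND.
have [a1 b1 c1 _ _] := q_generic_neq0 (-1) ND.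
have [_ _ c2 _ _] := q_generic_neq0 (-2) ND.
rewrite !(expr0z, exprN1, exprN2z, mulr1) in a1 b1 c1 c2 x1.
field.
have cN y z : z - y != 0 -> y - z != 0 by rewrite -opprB oppr_eq0.
rewrite c0 q0 b0 a0 x0 x1 (subr_neq0_div q0 a1) (subr_neq0_div q0 b1).
by rewrite (cN _ _ _ (subr_neq0_div q0 c1)) expr2 (cN _ _ _ (subr_neq0_div _ c2)) ?mulf_neq0.
Qed.

Lemma identity3 k l m n : contiguous q b a c x h -> f k l m n = h l k m n.
Proof.
move=> Ch; have /and4P[_ _ _ x0] := ne0.
exact: (contiguous_unique q0 ND x0 Cf (contiguous_swap Ch)).
Qed.
End Identities.
End Factors.

(** * Polynomials vanishing on a grid *)

Section Grid.
Variable K : fieldType.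

Let widenS n (i : 'I_n) : 'I_n.+1 := widen_ord (leqnSn n) i.

Lemma muni_eq0 n (p : mpoly.mpoly n.+1 K) : mpoly.muni p = 0 -> p = 0.
Proof.
move=> p0; apply/mpoly.mpolyP => m; rewrite mpoly.mcoeff0; apply/eqP; apply: contraT => pm.
have mp : m \in mpoly.msupp p by rewrite mpoly.mcoeff_msupp.
have := congr1 (fun r : {poly mpoly.mpoly n K} =>
  mpoly.mcoeff (mpoly.Multinom [tuple m (widenS i) | i < n]) (r`_(m ord_max))) p0.
rewrite coef0 mpoly.mcoeff0 mpoly.muniE coef_sum raddf_sum (bigD1_seq m) ?mpoly.msupp_uniq//=.
rewrite big1_seq => [|m' /andP[m'm _]].
  rewrite addr0 coefZ coefXn eqxx mulr1 mpoly.mcoeffZ mpoly.mcoeffX eqxx mulr1.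
  by move/eqP: pm.
rewrite coefZ coefXn; case: eqP => [mm|_]; last by rewrite mulr0 mpoly.mcoeff0.
rewrite mulr1 mpoly.mcoeffZ mpoly.mcoeffX; case: eqP => [/mpoly.mnmP h|_]; last by rewrite mulr0.
case/eqP: m'm; apply/mpoly.mnmP => i.
have [->//|ni] := eqVneq i ord_max.
have lti : (i < n)%N by rewrite ltn_neqAle -ltnS ltn_ord andbT; move: ni; rewrite -val_eqE.
have := h (Ordinal lti); rewrite !mpoly.mnmE.
have E : widen_ord (leqnSn n) (Ordinal lti) = i by exact: val_inj.
by rewrite /widenS E.
Qed.

Lemma meval_muni n (p : mpoly.mpoly n.+1 K) (v : 'I_n.+1 -> K) :
  mpoly.meval v p = (map_poly (mpoly.meval (fun i => v (widenS i))) (mpoly.muni p)).[v ord_max].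
Proof.
rewrite mpoly.muniE mpoly.mevalE raddf_sum horner_sum; apply: eq_bigr => m _.
rewrite /= map_polyZ /= hornerZ mpoly.mevalZ map_polyXn hornerXn mpoly.mevalX big_ord_recr /=.
rewrite -!mulrA; congr (_ * (_ * _)); apply: eq_bigr => i _.
by rewrite mpoly.mnmE.
Qed.

Lemma poly_eq0_seq (p : {poly K}) (s : nat -> K) : injective s ->
  (forall j, p.[s j] = 0) -> p = 0.
Proof.
move=> sI ps; apply/eqP; apply: contraT => p0.
have := max_poly_roots p0 (rs := [seq s j | j <- iota 0 (size p)]).
rewrite map_inj_uniq// iota_uniq size_map size_iota ltnn => -> //.
by apply/allP => y /mapP[j _ ->]; rewrite /root ps.
Qed.

(** Induction on the number of variables: with the other variables at grid
    points, the polynomial in the last variable has infinitely many roots. *)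
Lemma mpoly_eq0_grid n (p : mpoly.mpoly n K) (s : 'I_n -> nat -> K) :
  (forall i, injective (s i)) ->
  (forall t : 'I_n -> nat, mpoly.meval (fun i => s i (t i)) p = 0) -> p = 0.
Proof.
elim: n p s => [|n ih] p s sI ps.
  suff <- : mpoly.mpolyC 0 (mpoly.meval (fun i => s i 0%N) p) = p by rewrite ps mpoly.mpolyC0.
  elim/mpoly.mpolyind: p {ps} => [|c m p _ _ h]; first by rewrite mpoly.meval0 mpoly.mpolyC0.
  rewrite mpoly.mevalD mpoly.mpolyCD h; congr (_ + _).
  by rewrite mpoly.mevalZ mpoly.mevalX big_ord0 mulr1 (_ : m = mpoly.mnm0) ?mpoly.mpolyX0 ?mpoly.alg_mpolyC//; apply/mpoly.mnmP => -[].
apply: muni_eq0; apply/polyP => d; rewrite coef0.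
apply: (ih _ (fun i => s (widenS i))) => [i|t]; first exact: sI.
rewrite -[LHS](coef_map (mpoly.meval (fun i => s (widenS i) (t i)))).
suff -> : map_poly (mpoly.meval (fun i => s (widenS i) (t i))) (mpoly.muni p) = 0.
  by rewrite coef0.
apply: (poly_eq0_seq (sI ord_max)) => j.
pose t' (i : 'I_n.+1) : nat := if insub (val i) is Some i' then t i' else j.
have := ps t'; rewrite meval_muni.
have -> : t' ord_max = j by rewrite /t' insubF//= ltnn.
suff -> : (fun i => s (widenS i) (t' (widenS i))) = (fun i => s (widenS i) (t i)) by [].
by apply/funext => i; rewrite /t' /= insubT//= => ?; congr (s _ (t _)); apply/val_inj.
Qed.
End Grid.

(** * Evaluation of rational functions *)

Section Evaluation.
Variable R : realType.
Local Notation C := (cplx R).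
Local Notation P5 := (mpoly.mpoly 5 C).
Local Notation F := (ratfun R).

Section RatAt.
Variables (K : fieldType) (iota : {rmorphism C -> K}) (v : 'I_5 -> K).
Implicit Types (f g : F) (y z : K).

Let mM p r : mpoly.mmap iota v (p * r) = mpoly.mmap iota v p * mpoly.mmap iota v r.
Proof. exact: (mpoly.mmap_is_multiplicative v iota).1. Qed.

Let tofrac_neq0 (p : P5) : mpoly.mmap iota v p != 0 -> tofrac p != 0.
Proof. by apply: contra; rewrite tofrac_eq0 => /eqP ->; rewrite mpoly.mmap0. Qed.

Lemma rat_at_poly (p : P5) : rat_at iota v (tofrac p) (mpoly.mmap iota v p).
Proof.
exists p, 1; rewrite tofrac1 divr1 (mpoly.mmap_is_multiplicative v iota).2 divr1.
by split; rewrite ?oner_neq0.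
Qed.

Lemma rat_at_eval f y : rat_at iota v f y -> rat_eval iota v f = y.
Proof. by case=> N [D [-> D0 ->]]; exact: rat_evalE. Qed.

Lemma rat_at_uniq f y z : rat_at iota v f y -> rat_at iota v f z -> y = z.
Proof. by move=> /rat_at_eval <- /rat_at_eval. Qed.

Lemma rat_at_const (s : C) : rat_at iota v (rconst s) (iota s).
Proof. by have := rat_at_poly (mpoly.mpolyC 5 s); rewrite mpoly.mmapC. Qed.

Lemma rat_at_var i : rat_at iota v (rvar R i) (v i).
Proof.
have := rat_at_poly (mpoly.mpolyX C (mpoly.mnm1 i)).
by rewrite mpoly.mmapX mpoly.mmap1U.
Qed.

Lemma rat_atD f g y z : rat_at iota v f y -> rat_at iota v g z ->
  rat_at iota v (f + g) (y + z).
Proof.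
move=> [N [D [-> D0 ->]]] [N' [D' [-> D0' ->]]].
exists (N * D' + N' * D), (D * D'); rewrite mpoly.mmapD !mM mulf_neq0//.
split=> //; last by rewrite addf_div.
by rewrite addf_div ?tofrac_neq0// tofracD !tofracM.
Qed.

Lemma rat_atM f g y z : rat_at iota v f y -> rat_at iota v g z ->
  rat_at iota v (f * g) (y * z).
Proof.
move=> [N [D [-> D0 ->]]] [N' [D' [-> D0' ->]]].
exists (N * N'), (D * D'); rewrite !mM mulf_neq0//; split=> //; last by rewrite mulf_div.
by rewrite !tofracM mulf_div.
Qed.

Lemma rat_at1 : rat_at iota v 1 1.
Proof. by have := rat_at_const 1; rewrite rmorph1 /rconst mpoly.mpolyC1 tofrac1. Qed.

Lemma rat_at0 : rat_at iota v 0 0.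
Proof. by have := rat_at_const 0; rewrite rmorph0 /rconst mpoly.mpolyC0 tofrac0. Qed.

Lemma rat_atN f y : rat_at iota v f y -> rat_at iota v (- f) (- y).
Proof.
move=> [N [D [-> D0 ->]]]; exists (- N), D.
by rewrite tofracN mpoly.mmapN !mulNr; split.
Qed.

Lemma rat_atB f g y z : rat_at iota v f y -> rat_at iota v g z ->
  rat_at iota v (f - g) (y - z).
Proof. by move=> fy gz; apply: rat_atD => //; exact: rat_atN. Qed.

Lemma rat_atV f y : rat_at iota v f y -> y != 0 -> rat_at iota v f^-1 y^-1.
Proof.
move=> [N [D [-> D0 ->]]]; rewrite mulf_eq0 negb_or => /andP[N0 _].
by exists D, N; rewrite !invf_div; split.
Qed.

Lemma rat_atX f y (n : nat) : rat_at iota v f y -> rat_at iota v (f ^+ n) (y ^+ n).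
Proof.
move=> fy; elim: n => [|n ih]; first by rewrite !expr0; exact: rat_at1.
by rewrite !exprS; exact: rat_atM.
Qed.

Lemma rat_atXz f y (i : int) : rat_at iota v f y -> y != 0 ->
  rat_at iota v (f ^ i) (y ^ i).
Proof.
move=> fy y0; case: i => n; first exact: rat_atX.
by rewrite NegzE -!exprnN; apply: rat_atV; [exact: rat_atX|rewrite expf_neq0].
Qed.

(** Substitution into a polynomial over C commutes with evaluation. *)
Lemma rat_at_mmap (w : 'I_5 -> F) (y : 'I_5 -> K) (p : P5) :
  (forall i, rat_at iota v (w i) (y i)) ->
  rat_at iota v (mpoly.mmap (@rconst R) w p) (mpoly.mmap iota y p).
Proof.
move=> wy; rewrite /mpoly.mmap; elim/big_rec2: _ => [|m g f _ fg]; first exact: rat_at0.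
apply: rat_atD => //; apply: rat_atM; first exact: rat_at_const.
rewrite /mpoly.mmap1; elim/big_rec2: _ => [|i g' f' _ fg']; first exact: rat_at1.
by apply: rat_atM => //; apply: rat_atX.
Qed.

End RatAt.

(** [rconst] with the structure of ring morphism that the lemmas on [rat_at]
    ask for. *)
Definition rconstM : {rmorphism C -> F} := @FracField.tofrac P5 \o @mpoly.mpolyC 5 C.

Definition alg_indep (v : 'I_5 -> F) :=
  forall p : P5, mpoly.mmap (@rconst R) v p = 0 -> p = 0.

(** No denominator vanishes at an algebraically independent point, so that
    evaluation there is defined on the whole field. *)
Lemma alg_indep_morphism (v : 'I_5 -> F) : alg_indep v ->
  exists e : {rmorphism F -> F}, [/\ forall f, rat_eval (@rconst R) v f = e f,
    forall z, e (rconst z) = rconst z & forall i, e (rvar R i) = v i].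
Proof.
move=> vI; pose e f := rat_eval rconstM v f.
have eP f : rat_at rconstM v f (e f).
  have [N [D [D0 fE]]] := fractionE f.
  have D0' : mpoly.mmap rconstM v D != 0 by apply: contra D0 => /eqP /vI ->.
  have H : rat_at rconstM v f (mpoly.mmap rconstM v N / mpoly.mmap rconstM v D).
    by exists N, D.
  by rewrite /e (rat_at_eval H).
have eE f y : rat_at rconstM v f y -> e f = y by exact: rat_at_eval.
have eB : zmod_morphism e by move=> f g; apply/eE/rat_atB.
have eM : monoid_morphism e.
  by split=> [|f g]; apply/eE; [exact: rat_at1|exact: rat_atM].
pose e1 := GRing.isZmodMorphism.Build _ _ e eB.
pose e2 := GRing.isMonoidMorphism.Build _ _ e eM.
pose E : {rmorphism F -> F} := HB.pack e e1 e2.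
exists E; split=> // [z|i]; first exact/eE/rat_at_const.
exact/eE/rat_at_var.
Qed.

Lemma mmap_morphism (e : {rmorphism F -> F}) (w : 'I_5 -> F) p :
  (forall z, e (rconst z) = rconst z) ->
  e (mpoly.mmap (@rconst R) w p) = mpoly.mmap (@rconst R) (e \o w) p.
Proof.
move=> ez; rewrite rmorph_sum; apply: eq_bigr => m _; rewrite rmorphM ez.
by rewrite rmorph_prod; congr (_ * _); apply: eq_bigr => i _; rewrite rmorphXn.
Qed.

Lemma alg_indep_comp (e : {rmorphism F -> F}) (w : 'I_5 -> F) :
  (forall z, e (rconst z) = rconst z) -> alg_indep w -> alg_indep (e \o w).
Proof.
move=> ez wI p; rewrite -mmap_morphism// => /eqP; rewrite fmorph_eq0 => /eqP.
exact: wI.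
Qed.

(** A polynomial relation between the coordinates of w specialises, at the
    points v, to one that holds on all tuples of nonzero complex numbers, in
    particular on an infinite grid. *)
Lemma alg_indep_points (w : 'I_5 -> F) :
  (forall y : 'I_5 -> C, (forall i, y i != 0) -> exists v : 'I_5 -> C,
     forall i, rat_at idfun v (w i) (y i)) -> alg_indep w.
Proof.
move=> H p wp; apply: (mpoly_eq0_grid (s := fun i j => j.+1%:R)) => [_ i j|t].
  by move/eqP; rewrite eqr_nat => /eqP[].
have [|v vP] := H (fun i => (t i).+1%:R); first by move=> i; rewrite pnatr_eq0.
have := rat_at_mmap (iota := idfun) p vP; rewrite wp => h.
exact: rat_at_uniq h (rat_at0 idfun v).
Qed.

End Evaluation.

(** * The generator identities at algebraically independent points *)

Lemma div_divK (K : fieldType) (s u : K) : s != 0 -> s / (s / u) = u.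
Proof. by move=> s0; rewrite invf_div mulrC divfK. Qed.

Lemma inversionK (K : fieldType) (s a b c x : K) :
  s != 0 -> a != 0 -> b != 0 -> c != 0 ->
  s / a * (s / b) * (x * a * b / c) / (s ^+ 2 / c) = x.
Proof. by move=> s0 a0 b0 c0; field; rewrite s0 a0 b0 c0. Qed.

Section Transport.
Variable R : realType.
Local Notation C := (cplx R).
Local Notation F := (ratfun R).
Local Notation q := (Xq R).
Local Notation q0 := (Xq_neq0 R).

Definition point (t : args F) : 'I_5 -> F := coords (aa t) (ab t) (ac t) q (ax t).

Lemma coordsP (K : fieldType) (a b c x q' : K) (P : 'I_5 -> K -> Prop) :
  P 0 a -> P 1 b -> P 2 c -> P 3 q' -> P 4 x ->
  forall i, P i (coords a b c q' x i).
Proof.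
move=> Pa Pb Pc Pq Px [[|[|[|[|[|]]]]]] //= i5; rewrite /coords /=.
- by rewrite (_ : Ordinal i5 = 0)//; exact: val_inj.
- by rewrite (_ : Ordinal i5 = 1)//; exact: val_inj.
- by rewrite (_ : Ordinal i5 = 2)//; exact: val_inj.
- by rewrite (_ : Ordinal i5 = 3)//; exact: val_inj.
- by rewrite (_ : Ordinal i5 = 4)//; exact: val_inj.
Qed.

Lemma generic_indep k l m n : alg_indep (point (generic R k l m n)).
Proof.
apply: alg_indep_points => y y0; exists y; rewrite /point /=.
apply: (coordsP (P := fun i f => rat_at idfun y f (y i)));
  exact: (rat_at_var idfun).
Qed.

Local Notation at_ v := (rat_at (R := R) idfun v).

Section Monomials.
Variable v : 'I_5 -> C.
Lemma at_a : at_ v (Xa R) (v 0). Proof. exact: (rat_at_var idfun). Qed.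
Lemma at_b : at_ v (Xb R) (v 1). Proof. exact: (rat_at_var idfun). Qed.
Lemma at_c : at_ v (Xc R) (v 2). Proof. exact: (rat_at_var idfun). Qed.
Lemma at_q : at_ v (Xq R) (v 3). Proof. exact: (rat_at_var idfun). Qed.
Lemma at_x : at_ v (Xx R) (v 4). Proof. exact: (rat_at_var idfun). Qed.
Definition atM := @rat_atM R C (idfun : {rmorphism C -> C}) v.
Definition atV := @rat_atV R C (idfun : {rmorphism C -> C}) v.
Definition atXz := @rat_atXz R C (idfun : {rmorphism C -> C}) v.
Definition atX := @rat_atX R C (idfun : {rmorphism C -> C}) v.

Lemma rat_at_eq (f : F) (y z : C) : at_ v f y -> y = z -> at_ v f z.
Proof. by move=> + <-. Qed.
End Monomials.

(** Each generator acts invertibly on tuples of nonzero complex numbers; the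
    point v in this and the next three proofs is the preimage of y. *)
Lemma sigma0_indep k l m n : alg_indep (point (sigma0 q0 (generic R k l m n))).
Proof.
apply: alg_indep_points => y y0; set s := y 3; have s0 : s != 0 by exact: y0.
have sz i : s ^ i != 0 by rewrite expfz_neq0.
pose v := coords (y 0 / s ^ k) (y 1 / s ^ l) (y 2 / s ^ m) s (y 4 / s ^ n).
exists v; apply: (coordsP (P := fun i f => at_ v f (y i))).
- apply: rat_at_eq (atM (at_a v) (atXz k (at_q v) _)) _ => //; exact: divfK.
- apply: rat_at_eq (atM (at_b v) (atXz l (at_q v) _)) _ => //; exact: divfK.
- apply: rat_at_eq (atM (at_c v) (atXz m (at_q v) _)) _ => //; exact: divfK.
- exact: at_q.
- apply: rat_at_eq (atM (at_x v) (atXz n (at_q v) _)) _ => //; exact: divfK.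
Qed.

Lemma sigma1_indep k l m n : alg_indep (point (sigma1 (generic R k l m n))).
Proof.
apply: alg_indep_points => y y0.
pose v := coords (y 4) (y 2 / y 0) (y 1 * y 4) (y 3) (y 0).
exists v; apply: (coordsP (P := fun i f => at_ v f (y i))).
- exact: at_x.
- apply: rat_at_eq (atM (at_c v) (atV (at_a v) _)) _; first exact: y0.
  by rewrite /v /coords /= mulfK.
- apply: rat_at_eq (atM (at_b v) (at_x v)) _; exact: divfK.
- exact: at_q.
- exact: at_a.
Qed.

Lemma sigma2_indep k l m n : alg_indep (point (sigma2 q0 (generic R k l m n))).
Proof.
apply: alg_indep_points => y y0; set s := y 3; have s0 : s != 0 by exact: y0.
pose v := coords (s / y 0) (s / y 1) (s ^+ 2 / y 2) s (y 4 * y 0 * y 1 / y 2).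
have va : v 0 != 0 by rewrite mulf_neq0 ?invr_eq0.
have vb : v 1 != 0 by rewrite mulf_neq0 ?invr_eq0.
have vc : v 2 != 0 by rewrite mulf_neq0 ?invr_eq0// expf_neq0.
exists v; apply: (coordsP (P := fun i f => at_ v f (y i))).
- apply: rat_at_eq (atM (at_q v) (atV (at_a v) va)) _.
  exact: div_divK.
- apply: rat_at_eq (atM (at_q v) (atV (at_b v) vb)) _.
  exact: div_divK.
- apply: rat_at_eq (atM (atX 2 (at_q v)) (atV (at_c v) vc)) _.
  by apply: div_divK; rewrite expf_neq0.
- exact: at_q.
- apply: rat_at_eq (atM (atM (atM (at_a v) (at_b v)) (at_x v)) (atV (at_c v) vc)) _.
  exact: inversionK.
Qed.

Lemma sigma3_indep k l m n : alg_indep (point (sigma3 (generic R k l m n))).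
Proof.
apply: alg_indep_points => y y0.
pose v := coords (y 1) (y 0) (y 2) (y 3) (y 4).
exists v; apply: (coordsP (P := fun i f => at_ v f (y i))).
- exact: at_b.
- exact: at_a.
- exact: at_c.
- exact: at_q.
- exact: at_x.
Qed.

Lemma generic_q_generic : q_generic q (Xa R) (Xb R) (Xc R) (Xx R).
Proof.
(* At q = 1 every power of q is 1, so it suffices that a, b, c, x, bx and the
   quotients a/c, b/c, abx/c differ from 1. *)
move=> j; pose v := coords (2%:R : C) 3%:R 5%:R 1 7%:R.
have v1 : v 3 != 0 by exact: oner_neq0.
have neq (f g : F) (y z : C) : at_ v f (y * v 3 ^ j) -> at_ v g z -> y != z -> f != g.
  move=> fy gz yz; apply: contra yz => /eqP fg; rewrite fg in fy.
  by rewrite (rat_at_uniq (iota := idfun) gz fy) /v /coords /= exp1rz mulr1.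
have aq := atXz j (at_q v) v1; have r1 := rat_at1 idfun v.
split; [| | | |split].
- by apply: neq (atM (at_a v) aq) r1 _; rewrite (eqr_nat _ 2 1).
- by apply: neq (atM (at_b v) aq) r1 _; rewrite (eqr_nat _ 3 1).
- by apply: neq (atM (at_c v) aq) r1 _; rewrite (eqr_nat _ 5 1).
- by apply: neq (atM (at_x v) aq) r1 _; rewrite (eqr_nat _ 7 1).
- by apply: neq (atM (at_a v) aq) (at_c v) _; rewrite eqr_nat.
- by apply: neq (atM (at_b v) aq) (at_c v) _; rewrite eqr_nat.
- apply: neq (atM (atM (atM (at_a v) (at_b v)) (at_x v)) aq) (at_c v) _.
  by rewrite /v /coords /= -!natrM eqr_nat.
- apply: neq (atM (atM (at_b v) (at_x v)) aq) r1 _.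
  by rewrite /v /coords /= -!natrM (eqr_nat _ _ 1).
Qed.

Section Morphism.
Variable t : args F.
Hypothesis tI : alg_indep (point t).

Lemma args_morphism : exists e : {rmorphism F -> F},
  [/\ forall f, rat_eval (@rconst R) (point t) f = e f,
      forall z, e (rconst z) = rconst z &
      [/\ e (Xa R) = aa t, e (Xb R) = ab t, e (Xc R) = ac t, e q = q
        & e (Xx R) = ax t]].
Proof.
have [e [ee ez ev]] := alg_indep_morphism tI; exists e; split=> //.
by rewrite /Xa /Xb /Xc /Xx /Xq !ev.
Qed.

Lemma args_q_generic : q_generic q (aa t) (ab t) (ac t) (ax t).
Proof.
have [e [_ _ [<- <- <- eq <-]]] := args_morphism.
move=> j; have [na nb nc nx [nac nbc nabx nbx]] := generic_q_generic j.
have key (f g : F) : f != g -> e f != e g by rewrite (inj_eq (fmorph_inj e)).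
have eq_j : e (q ^ j) = q ^ j by rewrite fmorphXz eq.
split; [| | | |split].
- by have := key _ _ na; rewrite rmorphM eq_j rmorph1.
- by have := key _ _ nb; rewrite rmorphM eq_j rmorph1.
- by have := key _ _ nc; rewrite rmorphM eq_j rmorph1.
- by have := key _ _ nx; rewrite rmorphM eq_j rmorph1.
- by have := key _ _ nac; rewrite rmorphM eq_j.
- by have := key _ _ nbc; rewrite rmorphM eq_j.
- by have := key _ _ nabx; rewrite !rmorphM eq_j.
- by have := key _ _ nbx; rewrite !rmorphM eq_j rmorph1.
Qed.

(** An algebraically independent tuple is the image of the generic one under
    an endomorphism that fixes q, and such an endomorphism commutes with the
    generators. *)
Lemma sigma_indep : [/\ alg_indep (point (sigma0 q0 t)), alg_indep (point (sigma1 t)),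
  alg_indep (point (sigma2 q0 t)) & alg_indep (point (sigma3 t))].
Proof.
have [e [_ ez [ea eb ec eq ex]]] := args_morphism.
have H (w w' : 'I_5 -> F) : alg_indep w -> (forall i, w' i = e (w i)) -> alg_indep w'.
  by move=> wI h; rewrite (_ : w' = e \o w); [exact: alg_indep_comp|exact/funext].
case: t ea eb ec ex => k l m n a b c x n0 /= ea eb ec ex; split.
- apply: (H _ _ (@sigma0_indep k l m n)) => -[[|[|[|[|[|]]]]]] //= i5;
  by rewrite /point /coords/= ?rmorphM ?fmorphXz ?eq ?ea ?eb ?ec ?ex.
- apply: (H _ _ (@sigma1_indep k l m n)) => -[[|[|[|[|[|]]]]]] //= i5;
  by rewrite /point /coords/= ?fmorph_div ?rmorphM ?eq ?ea ?eb ?ec ?ex.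
- apply: (H _ _ (@sigma2_indep k l m n)) => -[[|[|[|[|[|]]]]]] //= i5;
  by rewrite /point /coords/= ?fmorph_div ?rmorphXn ?rmorphM ?eq ?ea ?eb ?ec ?ex.
- apply: (H _ _ (@sigma3_indep k l m n)) => -[[|[|[|[|[|]]]]]] //= i5;
  by rewrite /point /coords/= ?eq ?ea ?eb ?ec ?ex.
Qed.
End Morphism.

Section Solution.
Variable Q : int -> int -> int -> int -> F.
Hypotheses (CQ : contiguous q (Xa R) (Xb R) (Xc R) (Xx R) Q)
  (Q0 : Q 0 0 0 0 = 0) (Q1 : Q 1 1 1 0 = 1).

(** The coefficients of the system for Q are rational functions, and the
    evaluation morphism maps them to those of the system at t. *)
Lemma subst_solution (t : args F) : alg_indep (point t) ->
  let h k l m n := subst Q (Args k l m n (args_neq0 t)) in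
  [/\ contiguous q (aa t) (ab t) (ac t) (ax t) h, h 0 0 0 0 = 0 & h 1 1 1 0 = 1].
Proof.
move=> tI h; have [e [ee ez [ea eb ec eq ex]]] := args_morphism tI.
have hE k l m n : h k l m n = e (Q k l m n) by rewrite /h /subst -ee.
split; last first.
- by rewrite (hE 1 1 1 0) Q1; exact: rmorph1.
- by rewrite (hE 0 0 0 0) Q0; exact: rmorph0.
move=> k l m n /=; rewrite !hE; have [qA qB qC qX] := CQ k l m n.
have Ea : e (Xa R * q ^ k) = aa t * q ^ k by rewrite rmorphM fmorphXz ea eq.
have Eb : e (Xb R * q ^ l) = ab t * q ^ l by rewrite rmorphM fmorphXz eb eq.
have Ec : e (Xc R * q ^ m) = ac t * q ^ m by rewrite rmorphM fmorphXz ec eq.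
have Ex : e (Xx R * q ^ n) = ax t * q ^ n by rewrite rmorphM fmorphXz ex eq.
have Ecq : e (Xc R * q ^ m) * q = e (Xc R * q ^ m * q) by rewrite [RHS]rmorphM eq.
rewrite -Ea -Eb -Ec -Ex Ecq.
move: qA qB qC qX; move: (Xa R * _) (Xb R * _) (Xc R * _) (Xx R * _) => a b c x.
move=> qA qB qC qX; split; rewrite -(rmorph1 e) -?rmorphM -!rmorphB -?rmorphM -fmorph_div.
- by rewrite -rmorphM -rmorphD qA.
- by rewrite -rmorphM -rmorphD qB.
- by rewrite -rmorphM -rmorphD -qC.
- by rewrite -rmorphM -rmorphB qX.
Qed.

Lemma generator_identities (t : args F) : alg_indep (point t) ->
  [/\ subst Q t = factor0 q t * subst Q (sigma0 q0 t),
      subst Q t = factor1 q t * subst Q (sigma1 t),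
      subst Q t = factor2 q t * subst Q (sigma2 q0 t) &
      subst Q t = subst Q (sigma3 t)].
Proof.
move=> tI; have [s0I s1I s2I s3I] := sigma_indep tI.
have [Cf f0 f1] := subst_solution tI; have ND := args_q_generic tI.
have [C0 h0 h0'] := subst_solution s0I.
have [C1 h1 h1'] := subst_solution s1I; have ND1 := args_q_generic s1I.
have [C2 h2 h2'] := subst_solution s2I; have ND2 := args_q_generic s2I.
have [C3 h3 h3'] := subst_solution s3I.
case: t tI s0I s1I s2I s3I Cf f0 f1 ND C0 h0 h0' C1 h1 h1' ND1 C2 h2 h2' ND2 C3 h3 h3'.
move=> k l m n a b c x n0 tI s0I s1I s2I s3I Cf f0 f1 ND C0 h0 h0' C1 h1 h1' ND1 C2 h2 h2' ND2 C3 h3 h3'.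
split.
- exact: (identity0 q0 n0 ND Cf f0 f1 h0 h0' C0).
- exact: (identity1 q0 n0 ND Cf f0 f1 h1 h1' k l m n ND1 C1).
- exact: (identity2 q0 n0 ND Cf f0 f1 h2 h2' k l m n ND2 C2).
- exact: (identity3 q0 n0 ND Cf f0 f1 h3 h3' k l m n C3).
Qed.

Lemma generator_factors_neq0 (t : args F) : alg_indep (point t) ->
  [/\ factor0 q t != 0, factor1 q t != 0 & factor2 q t != 0].
Proof.
by move=> /args_q_generic; case: t => k l m n a b c x n0 ND; exact: (factors_neq0 q0 n0 ND).
Qed.
End Solution.
End Transport.

(** * Coefficients of the basic hypergeometric series *)

(** Coefficients of the product of the polynomial with coefficient list s and
    the power series with coefficients u. *)
Fixpoint pmul (K : nzRingType) (s : seq K) (u : nat -> K) (i : nat) : K :=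
  if s is c :: s' then c * u i + (if i is j.+1 then pmul s' u j else 0) else 0.

Section Coefficients.
Variables (K : fieldType) (q : K).

Lemma qpoch_recr (y : K) (i : nat) : qpoch q y i.+1 = qpoch q y i * (1 - y * q ^+ i).
Proof. by rewrite /= big_ord_recr. Qed.

Lemma qpoch_recl (y : K) (i : nat) : qpoch q y i.+1 = (1 - y) * qpoch q (y * q) i.
Proof.
rewrite /= big_ord_recl expr0 mulr1; congr (_ * _); apply: eq_bigr => j _.
by rewrite exprS mulrA.
Qed.

Definition coef21 (a b c : K) (i : nat) : K :=
  qpoch q a i * qpoch q b i / (qpoch q q i * qpoch q c i).

Definition no_pole (y : K) := forall j : nat, 1 - y * q ^+ j != 0.

Lemma no_pole_qpoch y i : no_pole y -> qpoch q y (Posz i) != 0.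
Proof. by move=> y1; apply/prodf_neq0 => j _; exact: y1. Qed.

Lemma no_poleS y : no_pole y -> no_pole (y * q).
Proof. by move=> y1 j; rewrite -mulrA -exprS. Qed.

Lemma coef21_0 a b c : coef21 a b c 0 = 1.
Proof. by rewrite /coef21 /= !big_ord0 !mulr1 divr1. Qed.

Lemma coef21S a b c i : no_pole c -> no_pole q -> coef21 a b c i.+1 =
  coef21 a b c i * ((1 - a * q ^+ i) * (1 - b * q ^+ i)
    / ((1 - q * q ^+ i) * (1 - c * q ^+ i))).
Proof.
move=> c1 q1; rewrite /coef21 !qpoch_recr; field.
by rewrite c1 q1 !no_pole_qpoch.
Qed.

Section Contiguous.
Variables (a b c : K) (i : nat).
Hypotheses (c1 : no_pole c) (q1 : no_pole q).

Let nz : [/\ 1 - c != 0, qpoch q (c * q) i != 0, qpoch q q i != 0 & 1 - q * q ^+ i != 0].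
Proof.
split; [|exact/no_pole_qpoch/no_poleS|exact: no_pole_qpoch|exact: q1].
by have := c1 0; rewrite expr0 mulr1.
Qed.

(** The contiguous relations hold coefficient by coefficient; this and the next
    three lemmas are the relations in a, b, c and x. *)
Lemma coef21_a : coef21 (a * q) b c i.+1 - coef21 a b c i.+1 =
  a * (1 - b) / (1 - c) * coef21 (a * q) (b * q) (c * q) i.
Proof.
have [nc nC nQ nq] := nz.
rewrite /coef21 (qpoch_recr (a * q)) (qpoch_recl a) (qpoch_recl b) (qpoch_recl c).
rewrite (qpoch_recr q); field.
by rewrite nC nc nQ nq.
Qed.

Lemma coef21_b : coef21 a (b * q) c i.+1 - coef21 a b c i.+1 =
  b * (1 - a) / (1 - c) * coef21 (a * q) (b * q) (c * q) i.
Proof.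
have [nc nC nQ nq] := nz.
rewrite /coef21 (qpoch_recr (b * q)) (qpoch_recl a) (qpoch_recl b) (qpoch_recl c).
rewrite (qpoch_recr q); field.
by rewrite nC nc nQ nq.
Qed.

Lemma coef21_c : coef21 a b c i.+1 - coef21 a b (c * q) i.+1 =
  c * (1 - a) * (1 - b) / ((1 - c) * (1 - c * q))
    * coef21 (a * q) (b * q) (c * q * q) i.
Proof.
have [nc nC nQ nq] := nz.
have ncq : 1 - c * q != 0 by have := c1 1; rewrite expr1.
have nCC : qpoch q (c * q * q) i != 0 by exact/no_pole_qpoch/no_poleS/no_poleS.
have nci : 1 - c * q * q ^+ i != 0 by exact: no_poleS.
have E := qpoch_recr (c * q) i; rewrite qpoch_recl in E.
have {}E : qpoch q (c * q) i = (1 - c * q) * qpoch q (c * q * q) i / (1 - c * q * q ^+ i).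
  by rewrite E mulfK.
rewrite /coef21 (qpoch_recl a) (qpoch_recl b) (qpoch_recl c) (qpoch_recl (c * q)).
rewrite (qpoch_recr q) E; field.
by rewrite nCC ncq nc nci nQ nq.
Qed.

Lemma coef21_x : coef21 a b c i.+1 * q ^+ i.+1 - coef21 a b c i.+1 =
  - ((1 - a) * (1 - b) / (1 - c)) * coef21 (a * q) (b * q) (c * q) i.
Proof.
have [nc nC nQ nq] := nz.
rewrite /coef21 (qpoch_recl a) (qpoch_recl b) (qpoch_recl c).
rewrite (qpoch_recr q) exprS; field.
by rewrite nC nc nQ nq.
Qed.

(** The two base series differ termwise by a rational function of q^i, which is
    the source of their independence. *)
Lemma coef21_shift : coef21 (a * q) (b * q) (c * q) i * (1 - a) * (1 - b) * (1 - c * q ^+ i)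
   = coef21 a b c i * (1 - a * q ^+ i) * (1 - b * q ^+ i) * (1 - c).
Proof.
have [nc nC nQ nq] := nz.
have E y := qpoch_recr y i.
rewrite /coef21.
have cE : qpoch q c i = (1 - c) * qpoch q (c * q) i / (1 - c * q ^+ i).
  by rewrite -qpoch_recl qpoch_recr mulfK// c1.
rewrite cE.
have -> : qpoch q (a * q) i * qpoch q (b * q) i / (qpoch q q i * qpoch q (c * q) i) *
    (1 - a) * (1 - b) * (1 - c * q ^+ i) =
  ((1 - a) * qpoch q (a * q) i) * ((1 - b) * qpoch q (b * q) i) * (1 - c * q ^+ i)
    / (qpoch q q i * qpoch q (c * q) i) by field; rewrite nQ nC.
rewrite -(qpoch_recl a) -(qpoch_recl b) (qpoch_recr a) (qpoch_recr b); field.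
by rewrite c1 nc nC nQ.
Qed.
End Contiguous.
End Coefficients.

(** * Bounds on the coefficients *)

Section Series.
Variable R : realType.
Local Notation C := (cplx R).
Import Normc.
Local Notation N := (@normc R).

Lemma normc_nneg (z : C) : 0 <= N z. Proof. by case: z => x y; exact: sqrtr_ge0. Qed.

Lemma normc_0 : N (0 : C) = 0. Proof. exact: normc0. Qed.

Lemma normcX (z : C) n : N (z ^+ n) = N z ^+ n.
Proof. by elim: n => [|n ih]; rewrite ?expr0 ?normc1// !exprS normcM ih. Qed.

Lemma normc_pos (z : C) : z != 0 -> 0 < N z.
Proof.
move=> z0; rewrite lt_neqAle normc_nneg andbT eq_sym.
by apply: contra z0 => /eqP /eq0_normc ->.
Qed.

Lemma normcB (z w : C) : N (z - w) <= N z + N w.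
Proof. by rewrite (le_trans (le_normcD _ _))// normcN. Qed.

Lemma normcB_ge (z w : C) : N z - N w <= N (z - w).
Proof. by rewrite lerBlDr (le_trans _ (le_normcD _ _))// subrK. Qed.

Lemma normr_normc (z : C) : `|z| = real_complex R (N z).
Proof. by []. Qed.

Lemma normc_small (r y e : R) : 0 <= r < 1 -> 0 <= y -> 0 < e -> exists n, y * r ^+ n <= e.
Proof.
move=> /andP[r0 r1] y0 e0; have r1' : `|r| < 1 by rewrite ger0_norm.
have := cvg_geometric y r1'.
move=> /cvgrPdist_lt /(_ _ e0)[n _ /(_ n (leqnn n))].
rewrite /= sub0r normrN ger0_norm => [/ltW|]; first by exists n.
by rewrite mulr_ge0 ?exprn_ge0.
Qed.

(** 1 - y q^j never vanishes and tends to 1 as j grows. *)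
Lemma no_pole_bound (q y : C) : N q < 1 -> no_pole q y ->
  exists2 d, 0 < d & forall j : nat, d <= N (1 - y * q ^+ j).
Proof.
move=> q1; have [||n] := @normc_small (N q) (N y) 2^-1 _ (normc_nneg y).
- by rewrite normc_nneg q1.
- by rewrite invr_gt0.
elim: n y => [|n ih] y yn y1.
  exists 2^-1 => [|j]; first by rewrite invr_gt0.
  apply: le_trans (normcB_ge _ _); rewrite normc1 normcM normcX.
  have : N y * N q ^+ j <= 2^-1.
    rewrite expr0 mulr1 in yn; apply: le_trans yn.
    by rewrite ler_piMr ?normc_nneg// exprn_ile1 ?normc_nneg ?ltW.
  lra.
have [||d d0 dP] := ih (y * q); first by rewrite normcM -mulrA -exprS.
  exact: no_poleS.
exists (Num.min d (N (1 - y))) => [|[|j]].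
- rewrite lt_min d0 normc_pos//.
  by have := y1 0; rewrite expr0 mulr1.
- by rewrite expr0 mulr1 ge_min lexx orbT.
- by rewrite exprS mulrA ge_min dP.
Qed.

(** The ratios of consecutive coefficients are bounded, so that the series
    converges near 0. *)
Lemma coef21_bound (a b c q : C) : N q < 1 -> no_pole q c -> no_pole q q ->
  exists2 r, 0 < r & forall i, N (coef21 q a b c i) <= r ^+ i.
Proof.
move=> q1 pc pq; have [d d0 dP] := no_pole_bound q1 pc.
have [e e0 eP] := no_pole_bound q1 pq.
pose r := (1 + N a) * (1 + N b) / (d * e).
have r0 : 0 < r.
  by rewrite divr_gt0 ?mulr_gt0// ltr_wpDr ?normc_nneg.
exists r => //; elim=> [|i ih]; first by rewrite coef21_0 normc1.
rewrite coef21S// normcM exprSr ler_pM ?normc_nneg//.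
have up (y : C) : N (1 - y * q ^+ i) <= 1 + N y.
  rewrite (le_trans (normcB _ _))// normc1 lerD2l normcM normcX.
  by rewrite ler_piMr ?normc_nneg// exprn_ile1 ?normc_nneg ?ltW.
rewrite normcM normcV !normcM -[q in q * q ^+ i]/q.
have di := dP i; have ei := eP i.
rewrite ler_pM ?mulr_ge0 ?invr_ge0 ?mulr_ge0 ?normc_nneg//.
  by rewrite ler_pM ?normc_nneg.
rewrite lef_pV2 ?posrE ?mulr_gt0//.
- by rewrite mulrC ler_pM// ltW.
- by rewrite (lt_le_trans e0).
- by rewrite (lt_le_trans d0).
Qed.

End Series.

(** * Power series *)

Section NumFieldSeries.
Variable K : numFieldType.
Implicit Types (u v w : nat -> K) (k : K).
Local Open Scope classical_set_scope.

(** Compares power series whose coefficients satisfy a contiguous relation; the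
    shift of the index is absorbed by the power of x contained in k. *)
Lemma lim_series_relation u v w k : u 0%N = v 0%N ->
  (forall i, u i.+1 = v i.+1 + k * w i) ->
  cvgn (series u) -> cvgn (series v) -> cvgn (series w) ->
  limn (series u) = limn (series v) + k * limn (series w).
Proof.
move=> uv0 uvw cu cv cw.
have E n : series u n.+1 = series v n.+1 + k * series w n.
  elim: n => [|n ih]; first by rewrite !seriesEnat /= !big_nat1 big_geq// mulr0 addr0.
  by rewrite seriesSr ih [in RHS]seriesSr (seriesSr w) uvw; ring.
apply: (@cvg_lim K); first exact: norm_hausdorff.
rewrite -cvg_shiftS (funext E); apply: cvgD; first by rewrite (cvg_shiftS (series v)).
by apply: cvgMl_tmp.
Qed.

Lemma lim_seriesM u k : cvgn (series u) ->
  cvgn (series (fun i => k * u i)) /\ limn (series (fun i => k * u i)) = k * limn (series u).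
Proof.
move=> cu; have E : series (fun i => k * u i) = fun n => k * series u n.
  by apply/funext => n; rewrite !seriesEnat /= mulr_sumr.
have kcu : series (fun i => k * u i) @ \oo --> k * limn (series u).
  by rewrite E; apply: cvgMl_tmp.
split; first by apply/cvg_ex; exists (k * limn (series u)).
by apply: (@cvg_lim K); first exact: norm_hausdorff.
Qed.

Lemma lim_series0 : limn (series (fun=> 0 : K)) = 0.
Proof.
apply: (@cvg_lim K); first exact: norm_hausdorff.
rewrite (_ : series _ = fun=> 0); first exact: cvg_cst.
by apply/funext => n; rewrite seriesEnat /= big1.
Qed.

Lemma lim_series_eq0 u : cvgn (series u) -> limn (series u) = 0 ->
  forall e : K, 0 < e -> exists n0, forall n, (n0 <= n)%N -> `|series u n| < e.
Proof.
move=> cu u0 e e0; have : series u @ \oo --> limn (series u) by exact: cu.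
rewrite u0 => /cvgrPdist_lt /(_ _ e0)[n0 _ H]; exists n0 => n /H.
by rewrite /= sub0r normrN.
Qed.
End NumFieldSeries.

Section PowerSeries.
Variable R : realType.
Local Notation C := (cplx R).
Import Normc.
Local Notation N := (@normc R).
Implicit Types (u v w : nat -> C) (x : C).

Definition bounded_by (M r : R) u := forall i, N (u i) <= M * r ^+ i.

Definition psum u x : C := limn (series (fun i => u i * x ^+ i)).

Lemma cvg_psum M r u x : 0 <= M -> 0 <= r -> bounded_by M r u -> N x * r < 1 ->
  cvgn (series (fun i => u i * x ^+ i)).
Proof.
move=> M0 r0 ub xr; apply: (@cvg_series_normc _ _ (geometric M (N x * r))) => [n|].
  rewrite normcM normcX /= exprMn [X in _ <= _ * X]mulrC mulrA ler_wpM2r ?exprn_ge0 ?normc_nneg//.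
by apply: is_cvg_geometric_series; rewrite ger0_norm ?mulr_ge0 ?normc_nneg.
Qed.

Lemma pmul_bounded s M r u : 0 <= M -> 0 < r -> bounded_by M r u ->
  exists2 M', 0 <= M' & bounded_by M' r (pmul s u).
Proof.
move=> M0 r0 ub; elim: s => [|c s [M' M'0 ih]].
  by exists 0 => // i; rewrite [pmul _ _ _]/(0 : C) normc_0 mul0r.
exists (N c * M + M' / r) => [|i].
  by apply: addr_ge0; [apply: mulr_ge0 => //; exact: normc_nneg|
    apply: divr_ge0 => //; exact: ltW].
rewrite /= mulrDl (le_trans (le_normcD _ _))// lerD//.
  by rewrite normcM -mulrA ler_wpM2l ?normc_nneg.
case: i => [|i]; first by rewrite normc_0 expr0 mulr1 divr_ge0// ltW.
by rewrite exprS mulrA mulfVK ?gt_eqF.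
Qed.

Lemma psum_pmul (s : seq C) u x M r : 0 <= M -> 0 < r -> bounded_by M r u ->
  N x * r < 1 -> psum (pmul s u) x = (Poly s).[x] * psum u x.
Proof.
move=> M0 r0 ub xr; elim: s => [|c s ih].
  rewrite /= hornerC mul0r /psum; under eq_fun do rewrite mul0r.
  exact: lim_series0.
have cu := cvg_psum M0 (ltW r0) ub xr.
have [M1 M10 b1] := pmul_bounded s M0 r0 ub.
have c1 := cvg_psum M10 (ltW r0) b1 xr.
have [M2 M20 b2] := pmul_bounded (c :: s) M0 r0 ub.
have c2 := cvg_psum M20 (ltW r0) b2 xr.
have [cc ccE] := lim_seriesM c cu.
rewrite /psum (lim_series_relation (k := x) _ _ c2 cc c1) /=.
- rewrite ccE [X in x * X]ih horner_cons mulrDl addrC; congr (_ + _).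
  by rewrite mulrCA mulrA.
- by rewrite addr0 mulrA.
- by move=> i; rewrite exprS; ring.
Qed.

Lemma psumD u v x M r M' r' : 0 <= M -> 0 <= r -> bounded_by M r u -> N x * r < 1 ->
  0 <= M' -> 0 <= r' -> bounded_by M' r' v -> N x * r' < 1 ->
  psum (fun i => u i + v i) x = psum u x + psum v x.
Proof.
move=> M0 r0 ub xr M0' r0' vb xr'.
have cu := cvg_psum M0 r0 ub xr; have cv := cvg_psum M0' r0' vb xr'.
rewrite /psum -(lim_seriesD cu cv); congr (limn (series _)).
by apply/funext => i; rewrite mulrDl.
Qed.

(** If w n is the first nonzero coefficient, then w n * x^n dominates the rest
    of the series for small x, so that x = 0 is the only possible
    zero of the sum near 0. *)
Lemma psum_eq0 w M r : 0 <= M -> 0 < r -> bounded_by M r w ->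
  (forall e : R, 0 < e -> exists x, 0 < N x < e /\ psum w x = 0) ->
  forall i, w i = 0.
Proof.
move=> M0 r0 wb H; elim/ltn_ind => n ih; apply/eqP; apply: contraT => wn0.
have wn : 0 < N (w n) by exact: normc_pos.
pose e := Num.min (2 * r)^-1 (N (w n) / (2 * M * r ^+ n.+1 + 1)).
have D0 : 0 < 2 * M * r ^+ n.+1 + 1.
  by apply: ltr_wpDl => //; apply: mulr_ge0; [apply: mulr_ge0|apply/exprn_ge0/ltW].
have e0 : 0 < e by rewrite lt_min invr_gt0 mulr_gt0//=; exact: divr_gt0.
have [x [/andP[x0 xe] sx]] := H _ e0.
move: xe; rewrite lt_min => /andP[xe1 xe2].
pose t := N x * r.
have t0 : 0 < t by rewrite mulr_gt0.
have t2 : t <= 2^-1.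
  move/ltW: xe1; rewrite invfM -(ler_pM2r r0) -/t => /le_trans; apply.
  by rewrite mulfVK ?gt_eqF.
pose s k := series (fun i => w i * x ^+ i) k.
have near_main k : N (s (n.+1 + k)%N - w n * x ^+ n) <=
    2 * M * t ^+ n.+1 - 2 * M * t ^+ (n.+1 + k).
  elim: k => [|k ihk].
    rewrite addn0 subrr /s seriesSr [series _ n]big_nat_cond big1 => [|i /andP[/= iN _]].
      by rewrite add0r subrr normc_0.
    by rewrite ih// mul0r.
  rewrite addnS /s seriesSr addrAC (le_trans (le_normcD _ _))//.
  have : N (w (n.+1 + k)%N * x ^+ (n.+1 + k)) <= M * t ^+ (n.+1 + k).
    have -> : M * t ^+ (n.+1 + k) = M * r ^+ (n.+1 + k) * N x ^+ (n.+1 + k).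
      by rewrite /t exprMn; ring.
    by rewrite normcM normcX; apply: ler_wpM2r; [exact/exprn_ge0/normc_nneg|].
  have T0 : 0 <= M * t ^+ (n.+1 + k) by apply: mulr_ge0 => //; apply/exprn_ge0/ltW.
  have : 2 * (M * t ^+ (n.+1 + k)) * t <= M * t ^+ (n.+1 + k).
    have := ler_wpM2l T0 t2; lra.
  move: ihk; rewrite -/(s (n.+1 + k)%N) [t ^+ (n.+1 + k).+1]exprSr; lra.
(* lower bound for the partial sums: the leading term minus a geometric tail
   of ratio at most 1/2 *)
pose del := N x ^+ n * (N (w n) - 2 * M * r ^+ n.+1 * N x).
have del0 : 0 < del.
  apply: mulr_gt0; [exact: exprn_gt0|rewrite subr_gt0].
  move: xe2; rewrite ltr_pdivlMr// => /le_lt_trans; apply.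
  by rewrite mulrDr mulr1 mulrC lerDl ltW.
have low k : del <= N (s (n.+1 + k)%N).
  have := near_main k; have := normcB_ge (w n * x ^+ n) (w n * x ^+ n - s (n.+1 + k)%N).
  rewrite opprB addrCA subrr addr0 -[w n * _ - _]opprB normcN normcM normcX.
  have T0 : 0 <= 2 * M * t ^+ (n.+1 + k) by apply: mulr_ge0; [exact: mulr_ge0|apply/exprn_ge0/ltW].
  have -> : del = N (w n) * N x ^+ n - 2 * M * t ^+ n.+1.
    by rewrite /del /t exprMn [N x ^+ n.+1]exprS; ring.
  lra.
have cs := cvg_psum M0 (ltW r0) wb (le_lt_trans t2 _).
have h21 : 2^-1 < 1 :> R by rewrite invf_lt1// ltr1n.
have dC : 0 < real_complex R del by rewrite ltcR.
have [k /(_ (n.+1 + k)%N (leq_addl _ _))] := lim_series_eq0 (cs h21) sx dC.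
by rewrite normr_normc ltcR ltNge low.
Qed.
End PowerSeries.

(** * Independence of the two base series: coefficients *)

(** One summand of the polynomial T in [coef21_relation_heads]: the
    coefficients vt and v1 at t + h are expressed by the coefficient v0 at t. *)
Lemma relation_term (K : fieldType) (P1 P2 P3 P4 P5 P6 P7 k v0 vt v1 r0 r1 : K) :
  vt * (P4 * P5) = v0 * P1 -> v1 * P7 = vt * k * P6 ->
  v0 * (P1 * P2 * P3 * (r0 * P7 + r1 * k * P6)) =
  P4 * P2 * (P5 * (P7 * P3)) * (r1 * v1 + r0 * vt).
Proof.
move=> E0 E1.
have -> : v0 * (P1 * P2 * P3 * (r0 * P7 + r1 * k * P6)) =
  v0 * P1 * P2 * P3 * (r0 * P7 + r1 * k * P6) by ring.
have -> : P4 * P2 * (P5 * (P7 * P3)) * (r1 * v1 + r0 * vt) =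
  P4 * P2 * P5 * P3 * (r1 * (v1 * P7) + r0 * vt * P7) by ring.
by rewrite -E0 E1; ring.
Qed.

Section Core.
Variable K : fieldType.
Local Notation C := K.
Variables (q a b c : C).
Hypotheses (q0 : q != 0) (c0 : c != 0) (qI : injective (fun t : nat => q ^+ t)).
Hypotheses (pa : no_pole q a) (pb : no_pole q b) (pc : no_pole q c) (pq : no_pole q q).
Hypotheses (ca : forall i j : nat, c * q ^+ i != a * q ^+ j).
Hypotheses (cb : forall i j : nat, c * q ^+ i != b * q ^+ j).

Let u0 := coef21 q a b c.
Let u1 := coef21 q (a * q) (b * q) (c * q).

Lemma pmul_nth (s : seq C) u n i : (size s <= n.+1)%N ->
  pmul s u (n + i)%N = \sum_(h < n.+1) s`_(n - h) * u (i + h)%N.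
Proof.
elim: n s => [|n ih] [|d s] //= sn.
- by rewrite big1// => h _; rewrite ?nth_nil mul0r.
- case: s sn => //= _; rewrite big_ord1 /= add0n addn0.
  by case: i => [|i]; rewrite addr0.
- by rewrite big1// => h _; rewrite ?nth_nil mul0r.
rewrite big_ord_recr /= subnn /= [RHS]addrC ih// (addnC n.+1); congr (_ + _).
by apply: eq_bigr => h _; rewrite subSn// -ltnS.
Qed.

Let nn (s : nat) (y : C) := (1 - a * q ^+ s * y) * (1 - b * q ^+ s * y).
Let dd (s : nat) (y : C) := 1 - q * q ^+ s * y.
Let ee (s : nat) (y : C) := 1 - c * q ^+ s * y.

Let u0_shift t h : u0 (t + h)%N * \prod_(0 <= s < h) (dd s (q ^+ t) * ee s (q ^+ t)) =
  u0 t * \prod_(0 <= s < h) nn s (q ^+ t).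
Proof.
elim: h => [|h ih]; first by rewrite addn0 !big_geq.
rewrite !big_nat_recr//= addnS /u0 coef21S// -/u0.
have E y : y * q ^+ (t + h) = y * q ^+ h * q ^+ t by rewrite addnC exprD mulrA.
rewrite [RHS]mulrA -ih !E -/(dd h _) -/(ee h _).
have d0 : dd h (q ^+ t) != 0 by rewrite /dd -E.
have e0 : ee h (q ^+ t) != 0 by rewrite /ee -E.
by rewrite /nn; field; rewrite d0 e0.
Qed.

Let k := (1 - c) / ((1 - a) * (1 - b)).

Let a1 : 1 - a != 0. Proof. by have := pa 0; rewrite expr0 mulr1. Qed.
Let b1 : 1 - b != 0. Proof. by have := pb 0; rewrite expr0 mulr1. Qed.
Let c1 : 1 - c != 0. Proof. by have := pc 0; rewrite expr0 mulr1. Qed.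

Let u1_shift t h : u1 (t + h)%N * ee h (q ^+ t) = u0 (t + h)%N * k * nn h (q ^+ t).
Proof.
have := coef21_shift a b (t + h) pc pq; rewrite -/u0 -/u1.
have E y : y * q ^+ (t + h) = y * q ^+ h * q ^+ t by rewrite addnC exprD mulrA.
rewrite !E -/(ee h _) => E1.
have -> : u1 (t + h)%N * ee h (q ^+ t) = u1 (t + h)%N * (1 - a) * (1 - b) * ee h (q ^+ t) / ((1 - a) * (1 - b)).
  by field; rewrite a1 b1.
by rewrite E1 /k /nn; field; rewrite a1 b1.
Qed.

Let u0_neq0 t : u0 t != 0.
Proof. by rewrite /u0 /coef21 !mulf_neq0 ?invr_eq0 ?mulf_neq0 ?no_pole_qpoch. Qed.

Let np (s : nat) : {poly C} := (1 - (a * q ^+ s) *: 'X) * (1 - (b * q ^+ s) *: 'X).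
Let dp (s : nat) : {poly C} := 1 - (q * q ^+ s) *: 'X.
Let ep (s : nat) : {poly C} := 1 - (c * q ^+ s) *: 'X.

Let npE s y : (np s).[y] = nn s y. Proof. by rewrite /np !hornerE. Qed.
Let dpE s y : (dp s).[y] = dd s y. Proof. by rewrite /dp !hornerE. Qed.
Let epE s y : (ep s).[y] = ee s y. Proof. by rewrite /ep !hornerE. Qed.

(** For large i the relation, divided by a coefficient of the base series, is
    rational in q^t with i = n + t. Clearing denominators gives a polynomial T
    that vanishes at all powers of q, hence T = 0. All its summands but the
    last contain the factor 1 - c q^n y, and the last one does so up to the
    term with coefficient s1`_0; evaluating at y = 1 / (c q^n) isolates
    s1`_0. *)
Lemma coef21_relation_heads (n : nat) (s1 s0 : seq C) :
  (size s1 <= n.+1)%N -> (size s0 <= n.+1)%N ->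
  (forall i, pmul s1 u1 i + pmul s0 u0 i = 0) -> s1`_0 = 0 /\ s0`_0 = 0.
Proof.
move=> n1 n0 w0.
suff s10 : s1`_0 = 0.
  split=> //; have := w0 0%N; case: s1 s10 {n1 w0} => [_|d s1 /= ->];
    case: s0 {n0} => [|d' s0] //=; rewrite ?add0r ?addr0 ?mul0r ?add0r ?addr0;
    by rewrite /u0 coef21_0 mulr1.
(* u0 t * T.[q ^+ t] is a multiple of the relation at index n + t *)
pose T : {poly C} := \sum_(h < n.+1)
  (\prod_(0 <= s < h) np s) * (\prod_(h <= s < n) dp s) * (\prod_(h.+1 <= s < n.+1) ep s)
   * (s0`_(n - h) *: ep h + (s1`_(n - h) * k) *: np h).
have T0 : T = 0.
  apply: (poly_eq0_seq qI) => t.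
  apply: (mulfI (u0_neq0 t)); rewrite mulr0 /T horner_sum mulr_sumr.
  have := w0 (n + t)%N; rewrite !pmul_nth// -big_split /= => wt.
  rewrite -[RHS](mulr0 (\prod_(0 <= s < n) dd s (q ^+ t) * \prod_(0 <= s < n.+1) ee s (q ^+ t))) -[in RHS]wt mulr_sumr.
  apply: eq_bigr => h _; have hn : (h <= n)%N by rewrite -ltnS.
  have Pn : (\prod_(0 <= s < h) np s).[q ^+ t] = \prod_(0 <= s < h) nn s (q ^+ t).
    by rewrite horner_prod; apply: eq_bigr => s _; exact: npE.
  have Pd : (\prod_(h <= s < n) dp s).[q ^+ t] = \prod_(h <= s < n) dd s (q ^+ t).
    by rewrite horner_prod; apply: eq_bigr => s _; exact: dpE.
  have Pe : (\prod_(h.+1 <= s < n.+1) ep s).[q ^+ t] =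
      \prod_(h.+1 <= s < n.+1) ee s (q ^+ t).
    by rewrite horner_prod; apply: eq_bigr => s _; exact: epE.
  rewrite !hornerM hornerD !hornerZ Pn Pd Pe npE epE.
  rewrite (@big_cat_nat _ _ _ h 0 n)//= (@big_cat_nat _ _ _ h 0 n.+1)//= 1?ltnW//.
  rewrite [\prod_(h <= i < n.+1) ee i _]big_ltn//.
  have := u1_shift t h; have := u0_shift t h; rewrite big_split /=.
  exact: relation_term.
(* the root of ep n *)
pose y := (c * q ^+ n)^-1.
have cq : c * q ^+ n != 0 by rewrite mulf_neq0 ?expf_neq0.
have en : ee n y = 0 by rewrite /ee /y mulfV ?subrr.
have nny s : nn s y != 0.
  rewrite /nn /y; have F z : c * q ^+ n != z -> 1 - z / (c * q ^+ n) != 0.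
    move=> zc; rewrite subr_eq0 eq_sym -(inj_eq (mulIf cq)) mulfVK// mul1r eq_sym.
    exact: zc.
  by apply: mulf_neq0; apply: F.
have := congr1 (fun p => p.[y]) T0; rewrite horner0 /T horner_sum big_ord_recr /=.
rewrite big1 => [|h _]; last first.
  rewrite hornerM hornerM [X in _ * X * _]horner_prod big_nat_recr/=; last exact: ltn_ord.
  by rewrite epE en !mulr0 mul0r.
rewrite add0r !hornerM hornerD !hornerZ npE epE en mulr0 add0r subnn horner_prod.
rewrite [\prod_(n <= s < n) _]big_geq// [\prod_(n.+1 <= s < n.+1) _]big_geq//.
have h1 : (1 : {poly K}).[y] = 1 by rewrite -polyC1 hornerC.
have P0 : \prod_(0 <= s < n) (np s).[y] != 0.
  by rewrite prodf_seq_neq0; apply/allP => s _ /=; rewrite npE nny.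
have k0 : k != 0 by apply: mulf_neq0 => //; rewrite invr_eq0; exact: mulf_neq0.
rewrite h1 !mulr1 => /eqP; rewrite mulf_eq0 (negPf P0) /= mulf_eq0 (negPf (nny n)).
by rewrite orbF mulf_eq0 (negPf k0) orbF => /eqP.
Qed.

(** Once the constant coefficients vanish, both polynomials can be divided by
    the variable. *)
Lemma coef21_relation (s1 s0 : seq K) :
  (forall i, pmul s1 u1 i + pmul s0 u0 i = 0) -> forall j, s1`_j = 0 /\ s0`_j = 0.
Proof.
have behead_nth (s : seq K) j : (behead s)`_j = s`_j.+1 by case: s => //=; rewrite nth_nil.
have pmul_behead (s : seq K) u i : s`_0 = 0 -> pmul s u i.+1 = pmul (behead s) u i.
  by case: s => //= d s ->; rewrite mul0r add0r.
have size_b (s : seq K) m : (size s <= m.+1)%N -> (size (behead s) <= m)%N.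
  by rewrite size_behead; case: (size s).
pose n := maxn (size s1) (size s0).
have : (size s1 <= n)%N by exact: leq_maxl.
have : (size s0 <= n)%N by exact: leq_maxr.
move: {n} (n : nat) => n; elim: n s1 s0 => [|n ih] s1 s0.
  by rewrite !leqn0 => /nilP -> /nilP -> _ j; rewrite !nth_nil.
move=> n0 n1 w0; have [h1 h0] := coef21_relation_heads n1 n0 w0.
have IH := ih _ _ (size_b _ _ n0) (size_b _ _ n1) _.
case=> [//|j]; rewrite -!behead_nth; apply: IH => i.
by rewrite -!pmul_behead.
Qed.
End Core.

(** * Independence over the polynomials in x *)

Section BaseSeries.
Variable R : realType.
Local Notation C := (cplx R).
Import Normc.
Local Notation N := (@normc R).

Definition no_qpower (q a b c : C) := forall j : int, [/\ a != q ^ j, b != q ^ j & c != q ^ j].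

Lemma normc_lt1 (q : C) : (0 < `|q| < 1) = (0 < N q < 1).
Proof. by rewrite normr_normc !ltcR. Qed.

Lemma q_injective (q : C) : 0 < `|q| < 1 -> injective (fun t : nat => q ^+ t).
Proof.
rewrite normc_lt1 => /andP[q0 q1] s t /(congr1 N); rewrite !normcX => /ieexprIn; apply => //.
by rewrite lt_eqF.
Qed.

Lemma no_pole_q (q : C) : 0 < `|q| < 1 -> no_pole q q.
Proof.
move=> q01 j; rewrite subr_eq0 -exprS -(expr0 q).
by apply/eqP => /(q_injective q01).
Qed.

Lemma no_pole_qpower (q y : C) : q != 0 -> (forall j : int, y != q ^ j) -> no_pole q y.
Proof.
move=> q0 yq j; rewrite subr_eq0; apply: contra (yq (- j%:Z)) => /eqP h.
by rewrite -invr_expz -[q ^ j%:Z]/(q ^+ j) -[X in _ == X]mul1r h mulfK// expf_neq0.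
Qed.

Lemma q_neq0 (q : C) : 0 < `|q| < 1 -> q != 0.
Proof. by move=> /andP[]; rewrite normr_gt0. Qed.

Lemma qpower_shift (q y : C) (k : int) : q != 0 -> (forall j : int, y != q ^ j) ->
  forall j : int, y * q ^ k != q ^ j.
Proof.
move=> q0 yq j; apply: contra (yq (j - k)) => /eqP h.
by rewrite expfzDr// -h -invr_expz mulfK// expfz_neq0.
Qed.

Lemma phi21E (a b c q x : C) : 0 < `|q| < 1 -> no_qpower q a b c ->
  phi21 a b c q x = psum (coef21 q a b c) x.
Proof.
move=> q01 abc; rewrite /phi21 /psum; congr (limn (series _)); apply/funext => i.
have q0 := q_neq0 q01.
have E y : (forall j : int, y != q ^ j) -> qpochC q y i = qpoch q y i.
  move=> yq; apply: qpochCE => // j; have := no_pole_qpower q0 yq (i + j)%N.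
  by rewrite subr_eq0 eq_sym.
rewrite /coef21 (E a) 1?(E b) 1?(E c); try by move=> j; case: (abc j).
rewrite qpochCE// => j; have := no_pole_q q01 (i + j)%N.
by rewrite subr_eq0 eq_sym.
Qed.

Lemma bounded_by_le (M r r' : R) u : 0 <= M -> 0 <= r -> r <= r' ->
  bounded_by M r u -> bounded_by M r' u.
Proof.
move=> M0 r0 rr ub i; apply: le_trans (ub i) _; apply: ler_wpM2l => //.
by rewrite lerXn2r// nnegrE// (le_trans r0).
Qed.

Lemma coef21_bounded_by (a b c q : C) : 0 < `|q| < 1 -> no_qpower q a b c ->
  exists2 r, 0 < r & bounded_by 1 r (coef21 q a b c).
Proof.
move=> q01 abc; have q0 := q_neq0 q01.
have [|||r r0 rP] := @coef21_bound R a b c q.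
- by move: q01; rewrite normc_lt1 => /andP[].
- by apply: no_pole_qpower => // j; case: (abc j).
- exact: no_pole_q.
by exists r => // i; rewrite mul1r.
Qed.

Lemma small_nonroot (d : {poly C}) (e : R) : d != 0 -> 0 < e ->
  exists x : C, 0 < N x < e /\ d.[x] != 0.
Proof.
move=> d0 e0; pose s (j : nat) : C := real_complex R (e / j.+2%:R).
have sI : injective s.
  move=> i j /(congr1 (@complex.Re R)) /= /(mulfI (lt0r_neq0 e0)) /invr_inj /eqP.
  by rewrite eqr_nat => /eqP[].
have [j dj] : exists j, d.[s j] != 0.
  apply: contrapT => h; case/eqP: d0; apply: (poly_eq0_seq sI) => j.
  by apply: contrapT => /eqP dj; apply: h; exists j.
exists (s j); split=> //.
have ej : 0 < e / j.+2%:R by rewrite divr_gt0.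
have -> : N (s j) = e / j.+2%:R.
  by rewrite /= expr0n /= addr0 sqrtr_sqr ger0_norm// ltW.
by rewrite ej ltr_pdivrMr// ltr_pMr// ltr1n.
Qed.

Section Base.
Variables (a b c q : C).
Hypotheses (q01 : 0 < `|q| < 1) (abc : no_qpower q a b c) (c0 : c != 0).
Hypothesis cab : forall j : int, c != a * q ^ j /\ c != b * q ^ j.

(** Expanding in powers of x turns the hypothesis into a relation between the
    coefficients of the base series. *)
Lemma base_independence (p1 p0 d : {poly C}) (e : R) : d != 0 -> 0 < e ->
  (forall x, 0 < N x < e -> d.[x] != 0 ->
     p1.[x] * psum (coef21 q (a * q) (b * q) (c * q)) x
     + p0.[x] * psum (coef21 q a b c) x = 0) -> p1 = 0.
Proof.
move=> d0 e0 H; have q0 := q_neq0 q01.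
set u0 := coef21 q a b c in H; set u1 := coef21 q (a * q) (b * q) (c * q) in H.
have [r' r'0 ub0'] := coef21_bounded_by q01 abc.
have abc1 : no_qpower q (a * q) (b * q) (c * q).
  by move=> j; split; apply: (@qpower_shift q _ 1 q0) => i; case: (abc i).
have [r'' r''0 ub1'] := coef21_bounded_by q01 abc1.
pose r := Num.max r' r''.
have r0 : 0 < r by rewrite lt_max r'0.
have ub0 : bounded_by 1 r u0 by apply: bounded_by_le ub0' => //; rewrite ?le_max ?lexx// ltW.
have ub1 : bounded_by 1 r u1.
  by apply: bounded_by_le ub1' => //; rewrite ?le_max ?lexx ?orbT// ltW.
have [M1 M10 b1] := pmul_bounded p1 ler01 r0 ub1.
have [M0 M00 b0] := pmul_bounded p0 ler01 r0 ub0.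
have w0 : forall i, pmul p1 u1 i + pmul p0 u0 i = 0.
  apply: (@psum_eq0 _ _ (M1 + M0) r) => //; first exact: addr_ge0.
    by move=> i; rewrite mulrDl (le_trans (le_normcD _ _))// lerD.
  move=> e' e'0; pose e2 := Num.min e' (Num.min e r^-1).
  have e20 : 0 < e2 by rewrite !lt_min e'0 e0 invr_gt0.
  have [x [/andP[x0 xe] dx]] := small_nonroot d0 e20.
  move: xe; rewrite !lt_min => /and3P[xe' xe xr].
  exists x; split; first by rewrite x0.
  have xr1 : N x * r < 1 by rewrite -ltr_pdivlMr// div1r.
  rewrite (@psumD _ _ _ x M1 r M0 r)//; try exact: ltW.
  rewrite (psum_pmul p1 ler01 r0 ub1 xr1) (psum_pmul p0 ler01 r0 ub0 xr1).
  by rewrite !polyseqK; apply: H => //; rewrite x0.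
have pa : no_pole q a by apply: no_pole_qpower => // j; case: (abc j).
have pb : no_pole q b by apply: no_pole_qpower => // j; case: (abc j).
have pc : no_pole q c by apply: no_pole_qpower => // j; case: (abc j).
have cE (y : C) : (forall j : int, c != y * q ^ j) -> forall i j : nat, c * q ^+ i != y * q ^+ j.
  move=> h i j; apply: contra (h (j%:Z - i%:Z)) => /eqP E.
  by rewrite expfzDr// -invr_expz mulrA -[y * q ^ j]E mulfK// expf_neq0.
have ca : forall i j : nat, c * q ^+ i != a * q ^+ j by apply: cE => j; case: (cab j).
have cb : forall i j : nat, c * q ^+ i != b * q ^+ j by apply: cE => j; case: (cab j).
apply/polyP => j; rewrite coef0.
by have [] := coef21_relation q0 c0 (q_injective q01) pa pb pc (no_pole_q q01) ca cb w0 j.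
Qed.
End Base.
End BaseSeries.

(** * Independence over the rational functions *)

Lemma coordsE (K : fieldType) (v : 'I_5 -> K) : v = coords (v 0) (v 1) (v 2) (v 3) (v 4).
Proof. by apply/funext => i; apply/esym; move: i; apply: (coordsP (P := fun i y => y = v i)). Qed.

Lemma horner_mmap (K : fieldType) n (w : 'I_n -> {poly K}) (p : mpoly.mpoly n K) x :
  (mpoly.mmap polyC w p).[x] = mpoly.mmap idfun (fun i => (w i).[x]) p.
Proof.
rewrite /mpoly.mmap horner_sum; apply: eq_bigr => m _; rewrite hornerM hornerC.
congr (_ * _); rewrite /mpoly.mmap1 horner_prod; apply: eq_bigr => i _.
by rewrite horner_exp.
Qed.

Section Grid.
Variable K : numFieldType.
Implicit Types (q t : K).

(** If 0 < q < 1/2, the only power of q strictly between 1/2 and 2 is 1. *)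
Lemma qpower_range q t (j : int) : 0 < q < 2^-1 -> 2^-1 < t < 2 -> t != 1 -> t != q ^ j.
Proof.
move=> /andP[q0 q2] /andP[t2 t2'] t1; have q1 : q <= 1.
  by rewrite (le_trans (ltW q2))// invf_le1// ler1n.
have qn n : q ^+ n.+1 < 2^-1.
  rewrite exprS; apply: le_lt_trans q2; apply: ler_piMr; first exact: ltW.
  by apply: exprn_ile1 => //; exact: ltW.
case: j => [[|n]|n]; first by [].
  by rewrite gt_eqF// (lt_trans (qn n)).
by rewrite lt_eqF// (lt_trans t2')// NegzE -exprnN -[X in X < _]invrK ltf_pV2 ?posrE ?exprn_gt0 ?invr_gt0.
Qed.

(** The sample points are chosen so that a, b, c and the quotients c/a, c/b lie
    strictly between 1/2 and 2 and differ from 1, while 0 < q < 1/2. *)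
Definition grid_a (j : nat) : K := 2^-1 + j.+4.+1%:R^-1.
Definition grid_c (j : nat) : K := 3 / 4 + j.+4.+1%:R^-1.
Definition grid_q (j : nat) : K := j.+3%:R^-1.

Lemma shifted_invr_inj (m : nat) (y : K) : injective (fun j : nat => y + (m + j).+1%:R^-1).
Proof. by move=> i j /addrI /invr_inj /eqP; rewrite eqr_nat => /eqP[/addnI]. Qed.

Lemma grid_a_inj : injective grid_a. Proof. exact: (@shifted_invr_inj 4). Qed.
Lemma grid_c_inj : injective grid_c. Proof. exact: (@shifted_invr_inj 4). Qed.
Lemma grid_q_inj : injective grid_q.
Proof. by move=> i j /invr_inj /eqP; rewrite eqr_nat => /eqP[]. Qed.

Lemma invr_nat_lt (m j : nat) : (0 < m)%N -> (m < j)%N ->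
  (0 < j%:R^-1 :> K) && (j%:R^-1 < m%:R^-1 :> K).
Proof.
move=> m0 mj; have j0 : (0 < j)%N by exact: leq_ltn_trans mj.
by rewrite invr_gt0 ltr0n j0 ltf_pV2 ?posrE ?ltr0n// ltr_nat.
Qed.

Lemma grid_q_range j : 0 < grid_q j < 2^-1.
Proof. exact: (@invr_nat_lt 2). Qed.

Lemma grid_a_range j : 2^-1 < grid_a j < 3 / 4.
Proof.
have /andP[i0 i4] := @invr_nat_lt 4 j.+4.+1 isT isT.
rewrite /grid_a ltrDl i0/= (_ : 3 / 4 = 2^-1 + 4^-1 :> K) ?ltrD2l//.
by field.
Qed.

Lemma grid_c_range j : 3 / 4 < grid_c j < 1.
Proof.
have /andP[i0 i4] := @invr_nat_lt 4 j.+4.+1 isT isT.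
rewrite /grid_c ltrDl i0/= [X in _ < X](_ : 1 = 3 / 4 + 4^-1 :> K) ?ltrD2l//.
by field.
Qed.

End Grid.

Lemma clear_denominators (K : fieldType) (na da nb db s1 s0 : K) : da != 0 -> db != 0 ->
  na / da * s1 + nb / db * s0 = 0 -> na * db * s1 + nb * da * s0 = 0.
Proof.
move=> da0 db0 h; rewrite -[RHS](mulr0 (da * db)) -h; field.
by rewrite da0 db0.
Qed.

Section Global.
Variable R : realType.
Local Notation C := (cplx R).
Local Notation P5 := (mpoly.mpoly 5 C).
Local Notation F := (ratfun R).
Import Normc.
Local Notation N := (@normc R).

(** The conditions on a, b, c, q under which the base series converge near 0 and
    are independent over the polynomials in x ([base_independence]). *)
Definition nonresonant (a b c q : C) := [/\ 0 < `|q| < 1, no_qpower q a b c, c != 0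
  & forall j : int, c != a * q ^ j /\ c != b * q ^ j].

Lemma grid_nonresonant i j k l : nonresonant (grid_a C i) (grid_a C j) (grid_c C k) (grid_q C l).
Proof.
have qr := @grid_q_range C l; have /andP[q0 q2] := qr.
have h34 : 3 / 4 < 1 :> C by rewrite ltr_pdivrMr ?mul1r ?ltr_nat.
have h12 : 2^-1 < 3 / 4 :> C by rewrite ltr_pdivlMr// ltr_pdivrMl// -natrM ltr_nat.
have h2 : 1 < 2 :> C by rewrite ltr1n.
have h1 : 2^-1 < 1 :> C by exact: lt_trans h34.
have A m : (forall z : int, @grid_a C m != @grid_q C l ^ z) /\
    (forall z : int, @grid_c C k != @grid_a C m * @grid_q C l ^ z).
  have /andP[a1 a2] := @grid_a_range C m; have /andP[c1 c2] := @grid_c_range C k.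
  have a0 : 0 < @grid_a C m by rewrite (lt_trans _ a1)// invr_gt0.
  split=> z.
    apply: qpower_range => //; first by rewrite a1 (lt_trans a2)// (lt_trans h34).
    by rewrite lt_eqF// (lt_trans a2).
  rewrite mulrC -subr_eq0 -(mulfVK (lt0r_neq0 a0) (@grid_c C k)) -mulrBl.
  rewrite mulf_neq0 ?(lt0r_neq0 a0)// subr_eq0; apply: qpower_range => //.
    rewrite ltr_pdivlMr// ltr_pdivrMr//; apply/andP; split.
      by apply: lt_trans (lt_trans a2 c1); rewrite -[ltRHS]mul1r ltr_pM2r.
    by apply: lt_trans c2 _; rewrite -[ltLHS](@mulfV _ (2 : C))// ltr_pM2l.
  rewrite gt_eqF// ltr_pdivlMr// mul1r; exact: lt_trans c1.
have /andP[c1 c2] := @grid_c_range C k.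
split.
- by rewrite ger0_norm ?ltW// q0 (lt_trans q2).
- move=> z; split; [by case: (A i)|by case: (A j)|].
  apply: qpower_range => //; first by rewrite (lt_trans h12)// (lt_trans c2).
  by rewrite lt_eqF.
- by rewrite lt0r_neq0// (lt_trans _ c1)// divr_gt0.
- by move=> z; split; [case: (A i)|case: (A j)].
Qed.

(** At a fixed sample point (a, b, c, q), clearing denominators leaves a
    relation with polynomial coefficients in x, and [base_independence] makes
    the first of them zero. Thus the numerator of A vanishes on a grid. The
    polynomial D stands for the exceptional set of the hypothesis. *)
Lemma rational_independence (A B : F) (D : P5) : D != 0 ->
  (forall a b c q, nonresonant a b c q -> exists2 e : R, 0 < e &
    forall x, 0 < N x < e -> mpoly.mmap idfun (coords a b c q x) D != 0 ->
    exists yA yB, [/\ rat_at idfun (coords a b c q x) A yA,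
      rat_at idfun (coords a b c q x) B yB &
      yA * psum (coef21 q (a * q) (b * q) (c * q)) x
      + yB * psum (coef21 q a b c) x = 0]) -> A = 0.
Proof.
move=> D0 H; have [NA [DA [DA0 AE]]] := fractionE A.
have [NB [DB [DB0 BE]]] := fractionE B.
pose E := D * DA * DB.
have E0 : E != 0 by rewrite !mulf_neq0.
pose ev v (p : P5) := mpoly.mmap idfun v p : C.
have evM v p r : ev v (p * r) = ev v p * ev v r.
  exact: (mpoly.mmap_is_multiplicative v idfun).1.
suff NE0 : NA * DB * E = 0.
  move/eqP: NE0; rewrite mulf_eq0 (negPf E0) orbF mulf_eq0 (negPf DB0) orbF => /eqP NA0.
  by rewrite AE NA0 tofrac0 mul0r.
pose s i (j : nat) : C :=
  coords (@grid_a C j) (@grid_a C j) (@grid_c C j) (@grid_q C j) j%:R i.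
apply: (mpoly_eq0_grid (s := s)).
  have natI : injective (fun j : nat => j%:R : C).
    by move=> i j /eqP; rewrite eqr_nat => /eqP.
  move=> -[[|[|[|[|[|]]]]]] //= i5.
  - exact: grid_a_inj.
  - exact: grid_a_inj.
  - exact: grid_c_inj.
  - exact: grid_q_inj.
move=> t; rewrite [fun i => _]coordsE.
have := grid_nonresonant (t 0) (t 1) (t 2) (t 3).
rewrite (_ : coords _ _ _ _ _ = coords (grid_a C (t 0)) (grid_a C (t 1))
  (grid_c C (t 2)) (grid_q C (t 3)) (t 4)%:R) //.
move: (grid_a C (t 0)) (grid_a C (t 1)) (grid_c C (t 2)) (grid_q C (t 3)) ((t 4)%:R) => a b c q x0 gd.
have [e e0 He] := H a b c q gd.
pose w (i : 'I_5) : {poly C} := nth 0 [:: a%:P; b%:P; c%:P; q%:P; 'X] i.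
have wE x p : (mpoly.mmap polyC w p).[x] = ev (coords a b c q x) p.
  rewrite horner_mmap; congr (mpoly.mmap idfun _ p); apply/funext.
  by move=> -[[|[|[|[|[|]]]]]] //= i5; rewrite /w /coords /= ?hornerC ?hornerX.
have -> : mpoly.meval (coords a b c q x0) (NA * DB * E) = ev (coords a b c q x0) (NA * DB * E) by [].
rewrite evM -!wE; have [->|Ew] := eqVneq (mpoly.mmap polyC w E) 0.
  by rewrite horner0 mulr0.
suff -> : mpoly.mmap polyC w (NA * DB) = 0 by rewrite horner0 mul0r.
have [q01 abc c0 cab] := gd.
apply: (base_independence (p0 := mpoly.mmap polyC w (NB * DA)) q01 abc c0 cab Ew e0).
move=> x xe; rewrite (wE x E) (wE x (NA * DB)) (wE x (NB * DA)).
rewrite (evM _ NA DB) (evM _ NB DA) (evM _ (D * DA) DB) (evM _ D DA).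
rewrite mulf_eq0 negb_or mulf_eq0 negb_or => /andP[/andP[D1 DA1] DB1].
have [yA [yB [hA hB rel]]] := He x xe D1.
have AA : rat_at idfun (coords a b c q x) A (ev (coords a b c q x) NA / ev (coords a b c q x) DA).
  by exists NA, DA.
have BB : rat_at idfun (coords a b c q x) B (ev (coords a b c q x) NB / ev (coords a b c q x) DB).
  by exists NB, DB.
have yAE := rat_at_uniq (iota := idfun) hA AA.
have yBE := rat_at_uniq (iota := idfun) hB BB.
rewrite yAE yBE in rel.
exact: clear_denominators rel.
Qed.
End Global.

(** * Contiguity of the series *)

Section SeriesContiguity.
Variable R : realType.
Local Notation C := (cplx R).
Local Notation P5 := (mpoly.mpoly 5 C).
Local Notation F := (ratfun R).
Local Notation qF := (Xq R).
Import Normc.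
Local Notation N := (@normc R).

Definition phi_at (a b c q x : C) (k l m n : int) : C :=
  phi21 (a * q ^ k) (b * q ^ l) (c * q ^ m) q (x * q ^ n).

Lemma no_qpower_shift (a b c q : C) k l m : q != 0 -> no_qpower q a b c ->
  no_qpower q (a * q ^ k) (b * q ^ l) (c * q ^ m).
Proof. by move=> q0 H j; split; apply: qpower_shift => // i; case: (H i). Qed.

(** The denominator of one chosen fraction serves as D. *)
Lemma generic_regular (f : F) : exists2 D : P5, D != 0 & forall v : 'I_5 -> C,
  mpoly.mmap idfun v D != 0 -> rat_regular idfun v f /\ rat_at idfun v f (rat_eval idfun v f).
Proof.
have [A [D [D0 fE]]] := fractionE f; exists D => // v Dv.
have H : rat_at idfun v f (mpoly.mmap idfun v A / mpoly.mmap idfun v D) by exists A, D.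
by split; [eexists; exact: H|rewrite (rat_at_eval (iota := idfun) H)].
Qed.

Lemma psum_term_shift (K : fieldType) (y z w : K) i : y * (z * w) ^+ i = y * w ^+ i * z ^+ i.
Proof. by rewrite exprMn; ring. Qed.

Lemma psum_relation (x : C) (u v w : nat -> C) (r s t : R) (k k' : C) :
  0 < r -> 0 < s -> 0 < t -> bounded_by 1 r u -> bounded_by 1 s v -> bounded_by 1 t w ->
  N x * r < 1 -> N x * s < 1 -> N x * t < 1 ->
  u 0%N = v 0%N -> (forall i, u i.+1 - v i.+1 = k * w i) -> k' = k * x ->
  psum u x = psum v x + k' * psum w x.
Proof.
move=> r0 s0 t0 bu bv bw xr xs xt uv uvw ->.
apply: lim_series_relation.
- by rewrite uv.
- by move=> i; rewrite -[u i.+1](subrK (v i.+1)) uvw exprS; ring.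
- exact: cvg_psum ler01 (ltW r0) bu xr.
- exact: cvg_psum ler01 (ltW s0) bv xs.
- exact: cvg_psum ler01 (ltW t0) bw xt.
Qed.

(** Summation of the relations between the coefficients. The bound e is chosen
    below the radii of convergence of all series that occur. *)
Lemma phi21_contiguity (a b c q : C) : 0 < `|q| < 1 -> no_qpower q a b c ->
  exists2 e : R, 0 < e & forall x : C, 0 < N x < e ->
  let f := phi_at a b c q x in
  [/\ f 1 0 0 0 = f 0 0 0 0 + a * x * (1 - b) / (1 - c) * f 1 1 1 0,
      f 0 1 0 0 = f 0 0 0 0 + b * x * (1 - a) / (1 - c) * f 1 1 1 0,
      f 0 0 0 0 = f 0 0 1 0 + c * x * (1 - a) * (1 - b)
         / ((1 - c) * (1 - c * q)) * f 1 1 2 0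
    & f 0 0 0 1 = f 0 0 0 0 - x * (1 - a) * (1 - b) / (1 - c) * f 1 1 1 0].
Proof.
move=> q01 abc; have q0 := q_neq0 q01.
have abcS k l m := no_qpower_shift k l m q0 abc.
have bnd k l m := coef21_bounded_by q01 (abcS k l m).
have [r1 r10 b1] := bnd 0 0 0; have [r2 r20 b2] := bnd 1 0 0.
have [r3 r30 b3] := bnd 0 1 0; have [r4 r40 b4] := bnd 0 0 1.
have [r5 r50 b5] := bnd 1 1 1; have [r6 r60 b6] := bnd 1 1 2.
pose e := (1 + r1 + r2 + r3 + r4 + r5 + r6)^-1.
have S0 : 0 < 1 + r1 + r2 + r3 + r4 + r5 + r6 by rewrite !addr_gt0.
exists e; first by rewrite invr_gt0.
move=> x /andP[x0 xe] f.
have small r : r <= 1 + r1 + r2 + r3 + r4 + r5 + r6 -> N x * r < 1.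
  move=> rS; apply: le_lt_trans (ler_wpM2l (normc_nneg x) rS) _.
  by rewrite -ltr_pdivlMr// div1r.
have h1 : N x * r1 < 1 by apply: small; lra.
have h2 : N x * r2 < 1 by apply: small; lra.
have h3 : N x * r3 < 1 by apply: small; lra.
have h4 : N x * r4 < 1 by apply: small; lra.
have h5 : N x * r5 < 1 by apply: small; lra.
have h6 : N x * r6 < 1 by apply: small; lra.
have pc : no_pole q c by apply: no_pole_qpower => // j; case: (abc j).
have pq := no_pole_q q01.
have fE k l m : f k l m 0 = psum (coef21 q (a * q ^ k) (b * q ^ l) (c * q ^ m)) x.
  by rewrite /f /phi_at (phi21E _ q01 (abcS k l m)) expr0z mulr1.
have fX : f 0 0 0 1 = psum (fun i => coef21 q a b c i * q ^+ i) x.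
  rewrite /f /phi_at (phi21E _ q01 (abcS 0 0 0)) expr1z !expr0z !mulr1 /psum.
  by congr (limn (series _)); apply/funext => i; exact: psum_term_shift.
rewrite !(expr0z, expr1z, mulr1) in b1 b2 b3 b4 b5 b6.
have q2 y : y * q ^ 2 = y * q * q by rewrite -[q ^ 2]/(q ^+ 2) expr2 mulrA.
rewrite q2 in b6.
have bX : bounded_by 1 r1 (fun i => coef21 q a b c i * q ^+ i).
  move=> i; apply: le_trans (b1 i); rewrite normcM normcX.
  apply: ler_piMr; first exact: normc_nneg.
  move: q01; rewrite normc_lt1 => /andP[/ltW Nq0 /ltW Nq1].
  exact: exprn_ile1.
have u00 a' b' c' a'' b'' c'' : coef21 q a' b' c' 0 = coef21 q a'' b'' c'' 0.
  by rewrite !coef21_0.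
rewrite fX !fE !(expr0z, expr1z, mulr1) q2; split.
- apply: (psum_relation r20 r10 r50 b2 b1 b5 h2 h1 h5 (u00 _ _ _ _ _ _)
    (fun i => coef21_a a b i pc pq)).
  by ring.
- apply: (psum_relation r30 r10 r50 b3 b1 b5 h3 h1 h5 (u00 _ _ _ _ _ _)
    (fun i => coef21_b a b i pc pq)).
  by ring.
- apply: (psum_relation r10 r40 r60 b1 b4 b6 h1 h4 h6 (u00 _ _ _ _ _ _)
    (fun i => coef21_c a b i pc pq)).
  by ring.
rewrite -mulNr; apply: (psum_relation r10 r10 r50 bX b1 b5 h1 h1 h5 _
    (fun i => coef21_x a b i pc pq)); last by ring.
by rewrite expr0 mulr1.
Qed.

End SeriesContiguity.

(** * Contiguity of the coefficient Q *)

Section CoefficientContiguity.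
Variable R : realType.
Local Notation C := (cplx R).
Local Notation P5 := (mpoly.mpoly 5 C).
Local Notation F := (ratfun R).
Local Notation qF := (Xq R).
Import Normc.
Local Notation N := (@normc R).
Local Notation at_ v := (rat_at (R := R) idfun v).

(** The three-term relation restricted to small x, where its hypotheses on x
    hold, with the exceptional set described by one polynomial D. *)
Lemma is_Q_small k l m n (f : F) : is_Q k l m n f -> exists (S : F) (D : P5), D != 0 /\
  forall a b c q, nonresonant a b c q -> exists2 e : R, 0 < e & forall x : C, 0 < N x < e ->
    let v := coords a b c q x in mpoly.mmap idfun v D != 0 -> exists y z,
    [/\ at_ v f y, at_ v S z & phi_at a b c q x k l m n =
      y * psum (coef21 q (a * q) (b * q) (c * q)) x + z * psum (coef21 q a b c) x].
Proof.
move=> [S fS]; have [D1 D10 H1] := generic_regular f; have [D2 D20 H2] := generic_regular S.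
exists S, (D1 * D2); split; first exact: mulf_neq0.
move=> a b c q [q01 abc _ _]; have q0 := q_neq0 q01.
have Nq : 0 < N (q ^ n).
  have : 0 < `|q ^ n| by rewrite normr_gt0 expfz_neq0.
  by rewrite normr_normc ltcR.
exists (Num.min 1 (N (q ^ n))^-1); first by rewrite lt_min ltr01 invr_gt0.
move=> x; rewrite lt_min => /and3P[x0 x1 xn] v.
rewrite (mpoly.mmap_is_multiplicative v idfun).1 mulf_eq0 negb_or => /andP[/H1[r1 e1] /H2[r2 e2]].
exists (rat_eval idfun v f), (rat_eval idfun v S); split; [exact: e1|exact: e2|].
have abc1 := no_qpower_shift 1 1 1 q0 abc; rewrite !expr1z in abc1.
rewrite -(phi21E x q01 abc1) -(phi21E x q01 abc); apply: fS q01 abc _ _ r1 r2.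
- by rewrite normr_normc ltcR.
- rewrite normr_normc ltcR normcM; rewrite -(mulVf (lt0r_neq0 Nq)).
  by rewrite ltr_pM2r.
Qed.

Lemma linear_relation_cancel (K : comPzRingType) (y1 y2 y3 z1 z2 z3 w u1 u0 p1 p2 p3 : K) :
  p1 = y1 * u1 + z1 * u0 -> p2 = y2 * u1 + z2 * u0 -> p3 = y3 * u1 + z3 * u0 ->
  p1 = p2 + w * p3 -> (y1 - y2 - w * y3) * u1 + (z1 - z2 - w * z3) * u0 = 0.
Proof.
move=> -> -> -> /eqP; rewrite -subr_eq0 => /eqP <-; ring.
Qed.

(** A linear relation between the series at three lattice points, combined with
    the three-term relations there, leaves a relation between the two base
    series whose first coefficient is f1 - f2 - w * f3. *)
Lemma is_Q_relation k1 l1 m1 n1 k2 l2 m2 n2 k3 l3 m3 n3 (f1 f2 f3 w : F) :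
  is_Q k1 l1 m1 n1 f1 -> is_Q k2 l2 m2 n2 f2 -> is_Q k3 l3 m3 n3 f3 ->
  (forall a b c q, nonresonant a b c q -> exists2 e : R, 0 < e & forall x : C, 0 < N x < e ->
    exists2 y, at_ (coords a b c q x) w y &
      phi_at a b c q x k1 l1 m1 n1 =
      phi_at a b c q x k2 l2 m2 n2 + y * phi_at a b c q x k3 l3 m3 n3) ->
  f1 = f2 + w * f3.
Proof.
move=> /is_Q_small[S1 [D1 [D10 H1]]] /is_Q_small[S2 [D2 [D20 H2]]].
move=> /is_Q_small[S3 [D3 [D30 H3]]] H.
suff E : f1 - f2 - w * f3 = 0.
  by rewrite -(subrK f2 f1) addrC -(subrK (w * f3) (f1 - f2)) E add0r.
have D0 : D1 * D2 * D3 != 0 by rewrite !mulf_neq0.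
apply: (rational_independence (B := S1 - S2 - w * S3) D0) => a b c q gd.
have [e e0 He] := H _ _ _ _ gd; have [e1 e10 He1] := H1 _ _ _ _ gd.
have [e2 e20 He2] := H2 _ _ _ _ gd; have [e3 e30 He3] := H3 _ _ _ _ gd.
exists (Num.min e (Num.min e1 (Num.min e2 e3))); first by rewrite !lt_min e0 e10 e20.
move=> x; rewrite !lt_min => /andP[x0 /and4P[xe xe1 xe2 xe3]].
have mM (p r : P5) : mpoly.mmap idfun (coords a b c q x) (p * r) =
    mpoly.mmap idfun (coords a b c q x) p * mpoly.mmap idfun (coords a b c q x) r.
  exact: (mpoly.mmap_is_multiplicative _ idfun).1.
rewrite !mM !mulf_eq0 !negb_or => /andP[/andP[d1 d2] d3].
have [y yP rel] : exists2 y, at_ (coords a b c q x) w y & phi_at a b c q x k1 l1 m1 n1 =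
      phi_at a b c q x k2 l2 m2 n2 + y * phi_at a b c q x k3 l3 m3 n3.
  by apply: He; rewrite x0.
have [y1 [z1 [f1P S1P E1]]] := He1 x (introT andP (conj x0 xe1)) d1.
have [y2 [z2 [f2P S2P E2]]] := He2 x (introT andP (conj x0 xe2)) d2.
have [y3 [z3 [f3P S3P E3]]] := He3 x (introT andP (conj x0 xe3)) d3.
exists (y1 - y2 - y * y3), (z1 - z2 - y * z3); split.
- exact: (rat_atB (iota := idfun) (rat_atB (iota := idfun) f1P f2P) (atM yP f3P)).
- exact: (rat_atB (iota := idfun) (rat_atB (iota := idfun) S1P S2P) (atM yP S3P)).
- exact: linear_relation_cancel E1 E2 E3 rel.
Qed.

Lemma is_Q_unique k l m n (f g : F) : is_Q k l m n f -> is_Q k l m n g -> f = g.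
Proof.
move=> fQ gQ; rewrite -[g]addr0 -(mul0r g); apply: (is_Q_relation fQ gQ gQ).
move=> a b c q _; exists 1 => // x _; exists 0; first exact: (rat_at0 idfun).
by rewrite mul0r addr0.
Qed.

Lemma lincomb01 (K : comPzRingType) (y z u1 u0 : K) : y = 0 -> z = 1 -> u0 = y * u1 + z * u0.
Proof. by move=> -> ->; rewrite mul0r add0r mul1r. Qed.

Lemma lincomb10 (K : comPzRingType) (y z u1 u0 : K) : y = 1 -> z = 0 -> u1 = y * u1 + z * u0.
Proof. by move=> -> ->; rewrite mul0r addr0 mul1r. Qed.

Lemma is_Q_origin : is_Q (R := R) 0 0 0 0 0.
Proof.
exists 1 => a b c q x _ _ _ _ v _ _; rewrite !expr0z !mulr1.
exact: (lincomb01 _ _ (rat_at_eval (rat_at0 idfun v)) (rat_at_eval (rat_at1 idfun v))).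
Qed.

Lemma is_Q_unit : is_Q (R := R) 1 1 1 0 1.
Proof.
exists 0 => a b c q x _ _ _ _ v _ _; rewrite !expr0z !expr1z mulr1.
exact: (lincomb10 _ _ (rat_at_eval (rat_at1 idfun v)) (rat_at_eval (rat_at0 idfun v))).
Qed.

Lemma mulr_expzD (K : fieldType) (y s : K) (i j : int) : s != 0 ->
  y * s ^ (i + j) = y * s ^ i * s ^ j.
Proof. by move=> s0; rewrite expfzDr// mulrA. Qed.

Lemma phi_at_shift (a b c q x : C) (k l m n k' l' m' n' : int) : q != 0 ->
  phi_at a b c q x (k + k') (l + l') (m + m') (n + n') =
  phi_at (a * q ^ k) (b * q ^ l) (c * q ^ m) q (x * q ^ n) k' l' m' n'.
Proof.
move=> q0; rewrite /phi_at (mulr_expzD a _ _ q0) (mulr_expzD b _ _ q0).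
by rewrite (mulr_expzD c _ _ q0) (mulr_expzD x _ _ q0).
Qed.

Lemma phi_at_contiguous (a b c q : C) k l m n : 0 < `|q| < 1 -> no_qpower q a b c ->
  exists2 e : R, 0 < e & forall x : C, 0 < N x < e ->
  let f := phi_at a b c q x in
  let a' := a * q ^ k in let b' := b * q ^ l in
  let c' := c * q ^ m in let x' := x * q ^ n in
  let fe := f (k + 1) (l + 1) (m + 1) n in
  [/\ f (k + 1) l m n = f k l m n + a' * x' * (1 - b') / (1 - c') * fe,
      f k (l + 1) m n = f k l m n + b' * x' * (1 - a') / (1 - c') * fe,
      f k l m n = f k l (m + 1) n + c' * x' * (1 - a') * (1 - b')
         / ((1 - c') * (1 - c' * q)) * f (k + 1) (l + 1) (m + 2) n
    & f k l m (n + 1) = f k l m n - x' * (1 - a') * (1 - b') / (1 - c') * fe].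
Proof.
move=> q01 abc; have q0 := q_neq0 q01.
have [e e0 H] := phi21_contiguity q01 (no_qpower_shift k l m q0 abc).
have Nq : 0 < N (q ^ n).
  have : 0 < `|q ^ n| by rewrite normr_gt0 expfz_neq0.
  by rewrite normr_normc ltcR.
exists (e / N (q ^ n)); first by rewrite divr_gt0.
move=> x; rewrite ltr_pdivlMr// -normcM => /andP[x0 xe].
have : 0 < N (x * q ^ n) < e by rewrite xe normcM mulr_gt0.
have E k' l' m' n' := esym (phi_at_shift a b c x k l m n k' l' m' n' q0).
move=> /H /=; rewrite !E (addr0 k) (addr0 l) (addr0 m) (addr0 n).
exact.
Qed.

Section Solution.
Variable Q : int -> int -> int -> int -> F.
Hypothesis HQ : forall k l m n : int, is_Q k l m n (Q k l m n).

Lemma is_Q_contiguous : contiguous qF (Xa R) (Xb R) (Xc R) (Xx R) Q.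
Proof.
move=> k l m n /=.
have val (a b c q x : C) : nonresonant a b c q -> let v := coords a b c q x in
  [/\ at_ v (Xa R * qF ^ k) (a * q ^ k), at_ v (Xb R * qF ^ l) (b * q ^ l),
      at_ v (Xc R * qF ^ m) (c * q ^ m), at_ v (Xx R * qF ^ n) (x * q ^ n) &
   [/\ 1 - c * q ^ m != 0, 1 - c * q ^ m * q != 0 & at_ v qF q]].
  move=> [q01 abc _ _] v; have q0 := q_neq0 q01.
  have qP i : at_ v (qF ^ i) (q ^ i) by apply: (atXz i (at_q v)).
  split; [exact: (atM (at_a v))|exact: (atM (at_b v))|exact: (atM (at_c v))|
    exact: (atM (at_x v))|].
  have pc : no_pole q (c * q ^ m).
    by apply: (no_pole_qpower q0) => j; case: (no_qpower_shift k l m q0 abc j).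
  split; [by have := pc 0; rewrite expr0 mulr1|by have := pc 1; rewrite expr1|exact: at_q].
have contig a b c q : nonresonant a b c q -> _ := fun gd =>
  let: And4 q01 abc _ _ := gd in phi_at_contiguous k l m n q01 abc.
have at1B v (f : F) (y : C) : at_ v f y -> at_ v (1 - f) (1 - y).
  exact: (rat_atB (iota := idfun) (rat_at1 idfun v)).
split.
- apply: (is_Q_relation (HQ _ _ _ _) (HQ _ _ _ _) (HQ _ _ _ _)) => a b c q gd.
  have [e e0 He] := contig _ _ _ _ gd; exists e => // x /He[h _ _ _].
  have [va vb vc vx [c1 c2 vq]] := val a b c q x gd; eexists; last exact: h.
  exact: (atM (atM (atM va vx) (at1B _ _ _ vb)) (atV (at1B _ _ _ vc) c1)).
- apply: (is_Q_relation (HQ _ _ _ _) (HQ _ _ _ _) (HQ _ _ _ _)) => a b c q gd.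
  have [e e0 He] := contig _ _ _ _ gd; exists e => // x /He[_ h _ _].
  have [va vb vc vx [c1 c2 vq]] := val a b c q x gd; eexists; last exact: h.
  exact: (atM (atM (atM vb vx) (at1B _ _ _ va)) (atV (at1B _ _ _ vc) c1)).
- apply: (is_Q_relation (HQ _ _ _ _) (HQ _ _ _ _) (HQ _ _ _ _)) => a b c q gd.
  have [e e0 He] := contig _ _ _ _ gd; exists e => // x /He[_ _ h _].
  have [va vb vc vx [c1 c2 vq]] := val a b c q x gd; eexists; last exact: h.
  exact: (atM (atM (atM (atM vc vx) (at1B _ _ _ va)) (at1B _ _ _ vb))
    (atV (atM (at1B _ _ _ vc) (at1B _ _ _ (atM vc vq)))
     (mulf_neq0 c1 c2))).
- rewrite -mulNr; apply: (is_Q_relation (HQ _ _ _ _) (HQ _ _ _ _) (HQ _ _ _ _)) => a b c q gd.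
  have [e e0 He] := contig _ _ _ _ gd; exists e => // x /He[_ _ _ h].
  have [va vb vc vx [c1 c2 vq]] := val a b c q x gd; eexists; last by rewrite -mulNr in h; exact: h.
  exact: (rat_atN (iota := idfun) (atM (atM (atM vx (at1B _ _ _ va))
    (at1B _ _ _ vb)) (atV (at1B _ _ _ vc) c1))).
Qed.
End Solution.
End CoefficientContiguity.

(** * The group of order 96 *)

Section Group.
Variables (K : fieldType) (q : K) (q0 : q != 0).
Local Notation args := (args K).

Lemma args_eq (t u : args) :
  (ak t, al t, am t, an t) = (ak u, al u, am u, an u) ->
  (aa t, ab t, ac t, ax t) = (aa u, ab u, ac u, ax u) -> t = u.
Proof.
case: t u => k l m n a b c x n0 [k' l' m' n' a' b' c' x' n0'] /=.
move=> [<- <- <- <-] [ea eb ec ex]; case: _ / ea n0'; case: _ / eb; case: _ / ec.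
by case: _ / ex => n0'; congr Args; exact: eq_irrelevance.
Qed.

Lemma invmapE (s u : args -> args) : cancel u s -> cancel s u -> invmap s = u.
Proof.
move=> us su; apply/funext => t; rewrite /invmap; case: pselect => [h|[]].
  by rewrite -[LHS]su (projT2 (cid h)).
by exists (u t).
Qed.

Lemma sigma0K : involutive (sigma0 q0).
Proof.
case=> k l m n a b c x n0; apply: args_eq; rewrite /= ?opprK//.
by rewrite -!mulrA -!expfzDr// !subrr !expr0z !mulr1.
Qed.

Lemma sigma1K : involutive (@sigma1 K).
Proof.
case=> k l m n a b c x n0; have /and4P[a0 b0 c0 x0] := n0.
apply: args_eq => /=; first by congr (_, _, _, _); ring.
by rewrite mulfK// divfK.
Qed.

Lemma sigma2K : involutive (sigma2 q0).
Proof.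
case=> k l m n a b c x n0; have /and4P[a0 b0 c0 x0] := n0.
apply: args_eq => /=; first by congr (_, _, _, _); ring.
by congr (_, _, _, _); field; rewrite ?a0 ?b0 ?c0 ?q0.
Qed.

Lemma sigma3K : involutive (@sigma3 K).
Proof. by case=> k l m n a b c x n0; exact: args_eq. Qed.

(** Indices beyond 3 stand for the identity, so that every word evaluates to an
    element of the group. *)
Definition sigma (i : nat) : args -> args :=
  nth idfun [:: sigma0 q0; @sigma1 K; sigma2 q0; @sigma3 K] i.

Lemma sigmaK i : involutive (sigma i).
Proof.
case: i => [|[|[|[|i]]]]; [exact: sigma0K|exact: sigma1K|exact: sigma2K|
  exact: sigma3K|by case: i].
Qed.

Lemma sigma0C i : sigma0 q0 \o sigma i = sigma i \o sigma0 q0.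
Proof.
apply/funext => -[k l m n a b c x n0]; have /and4P[a0 b0 c0 x0] := n0.
have qi j : q ^ j != 0 by rewrite expfz_neq0.
case: i => [|[|[|[|i]]]] //=; last by rewrite /sigma /= nth_nil.
- apply: args_eq => /=; first by congr (_, _, _, _); ring.
  rewrite !expfzDr// -!invr_expz.
  by congr (_, _, _, _); field; rewrite ?a0 ?qi.
- apply: args_eq => /=; first by congr (_, _, _, _); ring.
  rewrite !expfzDr// -!invr_expz.
  by congr (_, _, _, _); field; rewrite ?a0 ?b0 ?c0 ?qi.
- exact: args_eq.
Qed.

(** (r0, ra, rb, rc, rx) stands for the monomial
    q^r0 a^ra b^rb c^rc x^rx. On the shifts k, l, m, n the same exponents act
    linearly, and q contributes nothing. *)
Definition row : zmodType := (int * int * int * int * int)%type.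
Definition matrix4 := (row * row * row * row)%type.

Definition mon (r : row) (t : args) : K := let: (r0, ra, rb, rc, rx) := r in
  q ^ r0 * aa t ^ ra * ab t ^ rb * ac t ^ rc * ax t ^ rx.
Definition lin (r : row) (t : args) : int := let: (r0, ra, rb, rc, rx) := r in
  ra * ak t + rb * al t + rc * am t + rx * an t.

Lemma monD (r s : row) t : mon (r + s) t = mon r t * mon s t.
Proof.
case: t r s => k l m n a b c x n0 [[[[r0 ra] rb] rc] rx] [[[[s0 sa] sb] sc] sx].
by have /and4P[a0 b0 c0 x0] := n0; rewrite /mon /= !expfzDr//; ring.
Qed.

Lemma monN (r : row) t : mon (- r) t = (mon r t)^-1.
Proof.
case: t r => k l m n a b c x n0 [[[[r0 ra] rb] rc] rx].
by rewrite /mon /= -!invr_expz !invfM.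
Qed.

Lemma linD (r s : row) t : lin (r + s) t = lin r t + lin s t.
Proof.
case: r s => [[[[r0 ra] rb] rc] rx] [[[[s0 sa] sb] sc] sx].
by rewrite /lin /=; ring.
Qed.

Lemma linN (r : row) t : lin (- r) t = - lin r t.
Proof. by case: r => [[[[r0 ra] rb] rc] rx]; rewrite /lin /=; ring. Qed.

Definition qrow : row := (1, 0, 0, 0, 0).

(** Row operations describing the composition with sigma1, sigma2, sigma3 on
    the left. The entry at index 0 is a dummy: sigma0 mixes the shifts into the
    parameters and is not of this form. *)
Definition act_matrix (i : nat) (M : matrix4) : matrix4 :=
  let: (A, B, C, X) := M in
  nth M [:: M; (X, C - A, B + X, A);
    (qrow - A, qrow - B, qrow *+ 2 - C, A + B + X - C); (B, A, C, X)] i.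

Definition id_matrix : matrix4 :=
  ((0, 1, 0, 0, 0), (0, 0, 1, 0, 0), (0, 0, 0, 1, 0), (0, 0, 0, 0, 1)).

Definition represents (M : matrix4) (s : args -> args) : Prop :=
  let: (A, B, C, X) := M in forall t,
  (ak (s t), al (s t), am (s t), an (s t)) = (lin A t, lin B t, lin C t, lin X t) /\
  (aa (s t), ab (s t), ac (s t), ax (s t)) = (mon A t, mon B t, mon C t, mon X t).

Lemma represents_inj M s u : represents M s -> represents M u -> s = u.
Proof.
case: M => [[[A B] C] X] Ms Mu; apply/funext => t.
by have [s1 s2] := Ms t; have [u1 u2] := Mu t; apply: args_eq; rewrite ?s1 ?s2.
Qed.

Lemma represents_id : represents id_matrix idfun.
Proof.
move=> t; rewrite /lin /mon /= ?expr0z ?expr1z ?mulr1 ?mul1r ?mul0r.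
by rewrite !add0r !addr0.
Qed.

Lemma represents_sigma i M s : (0 < i < 4)%N -> represents M s ->
  represents (act_matrix i M) (sigma i \o s).
Proof.
case: M => [[[A B] C] X]; case: i => [|[|[|[|i]]]] // _ Ms t; have [Ms1 Ms2] := Ms t.
- rewrite !linD !linN !monD !monN /=.
  by case: (s t) Ms1 Ms2 => k l m n a b c x n0 /= [-> -> -> ->] [-> -> -> ->].
- rewrite mulr2n !linD !linN !monD !monN.
  have -> : lin qrow t = 0 by rewrite /lin /= !mul0r !addr0.
  have -> : mon qrow t = q by rewrite /mon /= expr1z !expr0z !mulr1.
  rewrite /= !add0r.
  case: (s t) Ms1 Ms2 => k l m n a b c x n0 /= [-> -> -> ->] [-> -> -> ->].
  by split => //; congr (_, _, _, _); ring.
- rewrite /=.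
  by case: (s t) Ms1 Ms2 => k l m n a b c x n0 /= [-> -> -> ->] [-> -> -> ->].
Qed.

Definition eval_word (w : seq nat) : args -> args :=
  foldr (fun i s => sigma i \o s) idfun w.

Definition matrix_word (w : seq nat) : matrix4 := foldr act_matrix id_matrix w.

Lemma represents_word w : all (fun i => 0 < i < 4)%N w -> represents (matrix_word w) (eval_word w).
Proof.
elim: w => [_|i w ih /= /andP[i0 w0]]; first exact: represents_id.
by apply: represents_sigma => //; exact: ih.
Qed.

Definition dihedral_words : seq (seq nat) :=
  [seq take r [:: 1; 3; 1; 3; 1; 3]%N | r <- iota 0 7]
  ++ [seq take r [:: 3; 1; 3; 1; 3]%N | r <- iota 1 5].

(** Normal forms for the products of sigma1, sigma2 and sigma3: sigma1 and
    sigma3 generate a dihedral group of order 12, and the four left factors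
    represent its cosets. *)
Definition words : seq (seq nat) :=
  [seq u ++ v | u <- [:: [::]; [:: 2]; [:: 1; 2]; [:: 2; 1; 2]]%N, v <- dihedral_words].

Lemma words_closed : all (fun i => all (fun w =>
  act_matrix i (matrix_word w) \in map matrix_word words) words) [:: 1; 2; 3]%N.
Proof. by vm_compute. Qed.

Lemma words_letters w : w \in words -> all (fun i => 0 < i < 4)%N w.
Proof. by move: w; apply/allP; vm_compute. Qed.

(** Since the matrices of [words] are closed under [act_matrix], a word can be
    normalised letter by letter. *)
Lemma eval_word_normal w : all (fun i => 0 < i < 4)%N w ->
  exists2 w', w' \in words & eval_word w = eval_word w'.
Proof.
elim: w => [_|i w ih /= /andP[i0 /ih[w' w'W ->]]]; first by exists [::].
have iL : i \in [:: 1; 2; 3]%N by case: i i0 => [|[|[|[|i]]]].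
have /mapP[w'' w''W E] := allP (allP words_closed i iL) w' w'W.
exists w'' => //; apply: (@represents_inj (matrix_word w'')).
  by rewrite -E; apply: represents_sigma => //; exact/represents_word/words_letters.
exact/represents_word/words_letters.
Qed.

Definition element (p : bool * seq nat) : args -> args :=
  if p.1 then sigma0 q0 \o eval_word p.2 else eval_word p.2.

Definition elements : seq (bool * seq nat) :=
  [seq (b, w) | b <- [:: false; true], w <- words].

Lemma eval_word_in w : exists2 p, p \in elements & eval_word w = element p.
Proof.
have inE b w' : w' \in words -> (b, w') \in elements.
  by move=> w'W; apply/allpairsP; exists (b, w'); case: b; split.
elim: w => [|i w [p /allpairsP[[b' w''] /= [_ w'W ->]] ih]].
  by exists (false, [::]).
rewrite /= ih /element /= {w ih}.
have [->|i0] := posnP i.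
  case: b'; last by exists (true, w''); first exact: inE.
  exists (false, w''); first exact: inE.
  by apply/funext => t; exact: sigma0K.
have [i4|i4] := ltnP i 4; last first.
  exists (b', w''); first exact: inE.
  by rewrite {1}/sigma nth_default.
have [|w3 w3W E] := @eval_word_normal (i :: w'').
  by rewrite /= i0 i4 words_letters.
case: b'; last by exists (false, w3); first exact: inE.
exists (true, w3); first exact: inE.
by rewrite /= -E /= compA -sigma0C.
Qed.

Lemma eval_word_cat w w' : eval_word (w ++ w') = eval_word w \o eval_word w'.
Proof. by elim: w => //= i w ->. Qed.

Lemma eval_revK w : cancel (eval_word w) (eval_word (rev w)).
Proof.
elim: w => [//|i w ih] t; rewrite rev_cons -cats1 eval_word_cat /=.
by rewrite sigmaK ih.
Qed.

Lemma eval_wordK w : cancel (eval_word (rev w)) (eval_word w).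
Proof. by have := eval_revK (rev w); rewrite revK. Qed.

Lemma symG_words s : symG q0 s <-> exists w, s = eval_word w.
Proof.
split=> [|[w ->]].
  elim=> {s} [| | | | |s u _ [w ->] _ [w' ->]|s _ [w ->]].
  - by exists [:: 0%N].
  - by exists [:: 1%N].
  - by exists [:: 2%N].
  - by exists [:: 3%N].
  - by exists [::].
  - by exists (w ++ w'); rewrite eval_word_cat.
  - by exists (rev w); exact: (invmapE (eval_wordK w) (eval_revK w)).
elim: w => [|i w ih]; first exact: symG_id.
apply: symG_comp => //; case: i => [|[|[|[|i]]]].
- exact: symG0.
- exact: symG1.
- exact: symG2.
- exact: symG3.
- by rewrite /sigma nth_default//; exact: symG_id.
Qed.

Lemma symG_bij s : symG q0 s -> cancel s (invmap s) /\ cancel (invmap s) s.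
Proof.
move=> /symG_words[w ->]; rewrite (invmapE (eval_wordK _) (eval_revK _)).
by split; [exact: eval_revK|exact: eval_wordK].
Qed.

(** The image of the shifts (0, 1, 3, 9), a vector with trivial stabiliser, as
    computed from the matrix of a word. *)
Definition vector (p : bool * seq nat) : seq int :=
  let: (A, B, C, X) := matrix_word p.2 in
  let v := [seq (let: (_, ra, rb, rc, rx) := r in ra * 0 + rb * 1 + rc * 3 + rx * 9)
              | r : row <- [:: A; B; C; X]] in
  if p.1 then [seq - z | z <- v] else v.

Lemma vector_uniq : uniq [seq vector p | p <- elements].
Proof. by vm_compute. Qed.

Lemma vector_element (t : args) p : (ak t, al t, am t, an t) = (0, 1, 3, 9) ->
  p \in elements ->
  vector p = [:: ak (element p t); al (element p t); am (element p t); an (element p t)].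
Proof.
move=> [kE lE mE nE]; case: p => b w /allpairsP[[b' w'] /= [_ w'W [-> ->]]] {b w}.
have := represents_word (words_letters w'W).
rewrite /vector /element /=; case: (matrix_word w') => [[[A B] C] X] /(_ t)[+ _].
have L (r : row) : lin r t =
    (let: (_, ra, rb, rc, rx) := r in ra * 0 + rb * 1 + rc * 3 + rx * 9).
  by case: r => [[[[r0 ra] rb] rc] rx]; rewrite /lin kE lE mE nE.
by case: b' => -[E1 E2 E3 E4]; rewrite /= -!L -?E1 -?E2 -?E3 -?E4.
Qed.

Lemma card_symG (t : args) : (ak t, al t, am t, an t) = (0, 1, 3, 9) ->
  (symG q0 #= `I_96)%card.
Proof.
move=> tE; pose el i := element (nth (false, [::]) elements i).
have sz : size elements = 96%N by [].
have -> : symG q0 = [set el i | i in `I_96]%classic.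
  apply/seteqP; split=> [s /symG_words[w ->]|_ [i /= i96 <-]].
    have [p pE ->] := eval_word_in w; exists (index p elements).
      by have := pE; rewrite -index_mem sz.
    by rewrite /el nth_index.
  apply/symG_words; rewrite /el; move: (nth _ _ _) => -[[] w].
    by exists (0%N :: w).
  by exists w.
apply: inj_card_eq => i j; rewrite !inE /= => i96 j96 elE.
have inj k : (k < 96)%N -> nth (false, [::]) elements k \in elements.
  by move=> k96; rewrite mem_nth ?sz.
apply/eqP; rewrite -(nth_uniq [::] _ _ vector_uniq) ?size_map ?sz//.
rewrite !(nth_map (false, [::])) ?sz//.
by rewrite !(vector_element tE) ?inj// -/(el i) -/(el j) elE.
Qed.

End Group.

(** * Composition of the generator identities *)

Section Composition.
Variable R : realType.
Local Notation F := (ratfun R).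
Local Notation q := (Xq R).
Local Notation q0 := (Xq_neq0 R).

Variable Q : int -> int -> int -> int -> F.
Hypotheses (CQ : contiguous q (Xa R) (Xb R) (Xc R) (Xx R) Q)
  (Q0 : Q 0 0 0 0 = 0) (Q1 : Q 1 1 1 0 = 1).

Lemma symG_indep s (t : args F) : symG q0 s -> alg_indep (point t) ->
  alg_indep (point (s t)) /\ alg_indep (point (invmap s t)).
Proof.
have word w (u : args F) : alg_indep (point u) -> alg_indep (point (eval_word q0 w u)).
  elim: w => //= i w ih uI; have [H0 H1 H2 H3] := sigma_indep (ih uI).
  by case: i => [|[|[|[|i]]]]//; rewrite /sigma nth_default//; exact: ih.
move=> /symG_words[w ->] tI; split; first exact: word.
by rewrite (invmapE (eval_wordK q0 w) (eval_revK q0 w)); exact: word.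
Qed.

(** Induction on the derivation, over all algebraically independent points at
    once, because composition moves the point; nonvanishing is carried along
    for the inverses. *)
Lemma sym_factorP s f : sym_factor q0 s f -> symG q0 s /\
  forall t, alg_indep (point t) ->
    f t != 0 /\ subst Q t = f t * act s (subst Q) t.
Proof.
elim=> {s f} [| | | | |s f u g _ [Gs sP] _ [Gu uP]|s f _ [Gs sP]].
- split=> [|t tI]; first exact: symG0.
  rewrite /act (invmapE (sigma0K q0) (sigma0K q0)).
  have [f0 _ _] := generator_factors_neq0 tI.
  by have [e0 _ _ _] := generator_identities CQ Q0 Q1 tI.
- split=> [|t tI]; first exact: symG1.
  rewrite /act (invmapE (@sigma1K F) (@sigma1K F)).
  have [_ f1 _] := generator_factors_neq0 tI.
  by have [_ e1 _ _] := generator_identities CQ Q0 Q1 tI.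
- split=> [|t tI]; first exact: symG2.
  rewrite /act (invmapE (sigma2K q0) (sigma2K q0)).
  have [_ _ f2] := generator_factors_neq0 tI.
  by have [_ _ e2 _] := generator_identities CQ Q0 Q1 tI.
- split=> [|t tI]; first exact: symG3.
  rewrite /act (invmapE (@sigma3K F) (@sigma3K F)) mul1r oner_neq0.
  by split; [|have [_ _ _ e3] := generator_identities CQ Q0 Q1 tI; exact: e3].
- split=> [|t tI]; first exact: symG_id.
  by rewrite /act (@invmapE _ idfun idfun)// mul1r oner_neq0.
- split=> [|t tI]; first exact: symG_comp.
  have [_ sI] := symG_indep Gs tI.
  have [f0 fE] := sP t tI; have [g0 gE] := uP _ sI.
  have [sK sK'] := symG_bij Gs; have [uK uK'] := symG_bij Gu.
  have compE : invmap (s \o u) = invmap u \o invmap s.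
    by apply: invmapE => y /=; rewrite ?uK' ?sK' ?sK ?uK.
  split; first exact: mulf_neq0 f0 g0.
  rewrite fE /act gE /act mulrA compE; reflexivity.
- split=> [|t tI]; first exact: symG_inv.
  have [sI _] := symG_indep Gs tI.
  have [f0 fE] := sP _ sI; have [sK sK'] := symG_bij Gs.
  rewrite /act (invmapE sK sK'); split; first by rewrite invr_eq0.
  by rewrite fE /act sK mulKf.
Qed.

Lemma sym_factor_exists s : symG q0 s -> exists f, sym_factor q0 s f.
Proof.
elim=> {s} [| | | | |s u _ [f fP] _ [g gP]|s _ [f fP]]; eexists.
- exact: sym_factor0.
- exact: sym_factor1.
- exact: sym_factor2.
- exact: sym_factor3.
- exact: sym_factor_id.
- exact: sym_factor_comp fP gP.
- exact: sym_factor_inv fP.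
Qed.

Lemma generic_sym_factor s f k l m n : sym_factor q0 s f ->
  Q k l m n = f (generic R k l m n) * act s (subst Q) (generic R k l m n).
Proof.
move=> /sym_factorP[_ /(_ _ (@generic_indep R k l m n))[_]].
by rewrite subst_generic.
Qed.

End Composition.

Theorem theorem3 (R : realType) (Q : int -> int -> int -> int -> ratfun R)
  (HQ : forall k l m n : int, is_Q k l m n (Q k l m n)) :
  let F := ratfun R in
  let q0 := Xq_neq0 R in
  (forall k l m n : int,
    let t := generic R k l m n in
    [/\ Q k l m n = factor0 (Xq R) t * act (sigma0 q0) (subst Q) t,
        Q k l m n = factor1 (Xq R) t * act (@sigma1 F) (subst Q) t,
        Q k l m n = factor2 (Xq R) t * act (sigma2 q0) (subst Q) t
      & Q k l m n = act (@sigma3 F) (subst Q) t]) /\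
  (symG q0 #= `I_96)%card /\
  (forall s : args F -> args F, symG q0 s ->
    (exists f : args F -> F, sym_factor q0 s f) /\
    (forall f : args F -> F, sym_factor q0 s f ->
      forall k l m n : int,
        let t := generic R k l m n in
        Q k l m n = f t * act s (subst Q) t)).
Proof.
move=> F q0; have CQ := is_Q_contiguous HQ.
have Q0 : Q 0 0 0 0 = 0 by exact: is_Q_unique (HQ 0 0 0 0) (is_Q_origin R).
have Q1 : Q 1 1 1 0 = 1 by exact: is_Q_unique (HQ 1 1 1 0) (is_Q_unit R).
have sf s f k l m n := @generic_sym_factor R Q CQ Q0 Q1 s f k l m n.
split=> [k l m n /=|].
  split; [exact: (sf _ _ k l m n (sym_factor0 q0))|
    exact: (sf _ _ k l m n (sym_factor1 q0))|
    exact: (sf _ _ k l m n (sym_factor2 q0))|].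
  by have := sf _ _ k l m n (sym_factor3 q0); rewrite mul1r; exact.
split.
  (* the shifts 0, 1, 3, 9 separate the 96 elements *)
  exact: (@card_symG _ _ _ (generic R 0 1 3 9)).
move=> s Gs; split; first exact: sym_factor_exists.
by move=> f fP k l m n; exact: sf.
Qed.
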